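(* Let $\Omega\subset\mathbb{C}$ be a bounded connected open set, $\varphi:\mathbb{D}\to\Omega$ an analytic covering map, and $\overline\varphi$ its extension by radial limits. Let $p,q\in\overline\Omega$, let $\gamma$ be a path in $\Omega$ (e.p.e.) joining $p$ and $q$, and let $\widehat\gamma$ be a lift of $\gamma$ with endpoints $\widehat p,\widehat q\in\overline{\mathbb{D}}$. If $\lambda\in\overline{[\gamma]}$, then there is a continuous lift $\widehat\lambda:[0,1]\to\overline{\mathbb{D}}$ of $\lambda$ (i.e. $\overline\varphi\circ\widehat\lambda=\lambda$) with $\widehat\lambda(0)=\widehat p$, $\widehat\lambda(1)=\widehat q$. Conversely, if $\lambda:[0,1]\to\overline\Omega$ is a path joining $p$ and $q$ which has a continuous lift $\widehat\lambda:[0,1]\to\overline{\mathbb{D}}$ with $\widehat\lambda(0)=\widehat p$ and $\widehat\lambda(1)=\widehat q$, then $\lambda\in\overline{[\gamma]}$.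
   Context: $\mathbb{D}$ is the open unit disk. $\overline\varphi$ is defined on $\mathbb{D}\cup\{\alpha\in\partial\mathbb{D}:\lim_{r\to1^-}\varphi(r\alpha)\text{ exists}\}$ by $\overline\varphi=\varphi$ on $\mathbb{D}$ and radial limits on $\partial\mathbb{D}$. A lift of a path $\gamma$ is a continuous path $\widehat\gamma$ in the domain of $\overline\varphi$ with $\overline\varphi\circ\widehat\gamma=\gamma$. A path in $\Omega$ (e.p.e.) joining $p$ and $q$ is a continuous $\gamma:[0,1]\to\mathbb{C}$ with $\gamma(0)=p$, $\gamma(1)=q$, $\gamma((0,1))\subset\Omega$. $\overline{[\gamma]}$ is the set of paths $\lambda$ for which there is a continuous $h:[0,1]^2\to\mathbb{C}$ with $h(\cdot,0)=\gamma$, $h(\cdot,1)=\lambda$, and $h(\cdot,t)$ a path in $\Omega$ (e.p.e.) joining $p$ and $q$ for every $t\in[0,1)$. *)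

(* Defs.v *)
From Stdlib Require Import Reals.
Open Scope R_scope.

Definition Cpx : Type := (R * R)%type.

Definition Cadd (z w : Cpx) : Cpx := (fst z + fst w, snd z + snd w).
Definition Csub (z w : Cpx) : Cpx := (fst z - fst w, snd z - snd w).
Definition Cmul (z w : Cpx) : Cpx :=
  (fst z * fst w - snd z * snd w, fst z * snd w + snd z * fst w).
Definition Cscal (r : R) (z : Cpx) : Cpx := (r * fst z, r * snd z).
Definition Cnorm (z : Cpx) : R := sqrt (fst z * fst z + snd z * snd z).

Definition in_disk (z : Cpx) : Prop := Cnorm z < 1.

Definition Cis_open (U : Cpx -> Prop) : Prop :=
  forall z, U z -> exists r, 0 < r /\ forall w, Cnorm (Csub w z) < r -> U w.

Definition Cbounded (U : Cpx -> Prop) : Prop :=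
  exists M, forall z, U z -> Cnorm z <= M.

Definition Cconnected (S : Cpx -> Prop) : Prop :=
  forall A B : Cpx -> Prop, Cis_open A -> Cis_open B ->
    (forall z, S z -> A z \/ B z) ->
    (forall z, S z -> A z -> B z -> False) ->
    (exists z, S z /\ A z) -> (exists z, S z /\ B z) -> False.

Definition Cclosure (S : Cpx -> Prop) (p : Cpx) : Prop :=
  forall eps, 0 < eps -> exists z, S z /\ Cnorm (Csub z p) < eps.

Definition Ccontinuous_on (S : Cpx -> Prop) (f : Cpx -> Cpx) : Prop :=
  forall z, S z -> forall eps, 0 < eps -> exists delta, 0 < delta /\
    forall w, S w -> Cnorm (Csub w z) < delta -> Cnorm (Csub (f w) (f z)) < eps.

Definition holomorphic_on (S : Cpx -> Prop) (f : Cpx -> Cpx) : Prop :=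
  forall z, S z -> exists f' : Cpx, forall eps, 0 < eps -> exists delta, 0 < delta /\
    forall h, Cnorm h < delta -> S (Cadd z h) ->
      Cnorm (Csub (Csub (f (Cadd z h)) (f z)) (Cmul f' h)) <= eps * Cnorm h.

Definition covering_map (Omega : Cpx -> Prop) (phi : Cpx -> Cpx) : Prop :=
  (forall z, in_disk z -> Omega (phi z)) /\
  (forall w, Omega w -> exists z, in_disk z /\ phi z = w) /\
  Ccontinuous_on in_disk phi /\
  forall w, Omega w ->
    exists (U : Cpx -> Prop), Cis_open U /\ U w /\ (forall u, U u -> Omega u) /\
    exists (I : Type) (V : I -> Cpx -> Prop),
      (forall i, Cis_open (V i)) /\
      (forall i z, V i z -> in_disk z) /\
      (forall i j z, V i z -> V j z -> i = j) /\
      (forall z, in_disk z -> (U (phi z) <-> exists i, V i z)) /\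
      (forall i, exists g : Cpx -> Cpx,
          (forall u, U u -> V i (g u)) /\
          (forall u, U u -> phi (g u) = u) /\
          (forall z, V i z -> g (phi z) = z) /\
          Ccontinuous_on U g).

Definition analytic_covering_map (Omega : Cpx -> Prop) (phi : Cpx -> Cpx) : Prop :=
  holomorphic_on in_disk phi /\ covering_map Omega phi.

Definition radial_limit (phi : Cpx -> Cpx) (alpha L : Cpx) : Prop :=
  forall eps, 0 < eps -> exists delta, 0 < delta /\
    forall r, 0 <= r < 1 -> 1 - delta < r ->
      Cnorm (Csub (phi (Cscal r alpha)) L) < eps.

(* graph of the extension phibar: phibar z = w, with z in the domain of
   phibar (the disk plus boundary points where the radial limit exists). *)
Definition phibar (phi : Cpx -> Cpx) (z w : Cpx) : Prop :=
  (Cnorm z < 1 /\ w = phi z) \/ (Cnorm z = 1 /\ radial_limit phi z w).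

(* paths are functions R -> Cpx considered on [0,1] *)
Definition I01 (t : R) : Prop := 0 <= t <= 1.

Definition continuous_01 (f : R -> Cpx) : Prop :=
  forall t, I01 t -> forall eps, 0 < eps -> exists delta, 0 < delta /\
    forall s, I01 s -> Rabs (s - t) < delta -> Cnorm (Csub (f s) (f t)) < eps.

Definition continuous_01x01 (h : R -> R -> Cpx) : Prop :=
  forall s t, I01 s -> I01 t -> forall eps, 0 < eps -> exists delta, 0 < delta /\
    forall s' t', I01 s' -> I01 t' -> Rabs (s' - s) < delta -> Rabs (t' - t) < delta ->
      Cnorm (Csub (h s' t') (h s t)) < eps.

Definition is_lift (phi : Cpx -> Cpx) (gamma ghat : R -> Cpx) : Prop :=
  continuous_01 ghat /\ forall t, I01 t -> phibar phi (ghat t) (gamma t).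

Definition path_epe (Omega : Cpx -> Prop) (p q : Cpx) (gamma : R -> Cpx) : Prop :=
  continuous_01 gamma /\ gamma 0 = p /\ gamma 1 = q /\
  forall t, 0 < t < 1 -> Omega (gamma t).

Definition in_hclass_closure (Omega : Cpx -> Prop) (p q : Cpx) (gamma lambda : R -> Cpx) : Prop :=
  exists h : R -> R -> Cpx, continuous_01x01 h /\
    (forall s, I01 s -> h s 0 = gamma s) /\
    (forall s, I01 s -> h s 1 = lambda s) /\
    (forall t, 0 <= t < 1 -> path_epe Omega p q (fun s => h s t)).

(* Main.v *)
(* A continuum on which a bounded analytic function [f] is close to [w] forces [f] to be close to [w]
   at every point whose boundary distance is comparable to its distance from the continuum and to the
   size of the continuum; parts of the continuum may lie on the circle, where [f] is read through its
   radial limits. This is a form of Hall's lemma on harmonic measure: the condition "some point of the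
   fibre over the parameter [t] has a small value" is open in [t], so compactness replaces the
   continuum by finitely many interior points, and [f] is compared with the Blaschke product over
   these points by the maximum principle. The lemma yields that paths in the disk along which [phi]
   stays near one value are short (Koebe), that limits along paths are radial limits (Lindelof), and
   that [phi] converges nontangentially along any lift.

   For the first half of the theorem the homotopy is lifted over [(0,1) x [0,1)], and shortness of
   paths makes the lift converge as the homotopy parameter tends to 1 and fixes its endpoints. For the
   second half the two lifts are joined by segments bent into the disk, which are nontangential to the
   nearer endpoint, so the image homotopy is continuous up to the boundary. *)

Require Import Defs.
From Stdlib Require Import Reals Lra Lia Psatz ZArith Wf_nat Classical ClassicalEpsilon.
From Coquelicot Require Import Coquelicot.
Open Scope R_scope.

(** * Goursat's theorem on rectangles *)

(** The obstacle is that [lambda] may run along the boundary of [Omega]: its lift may then lie on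
    the circle, where [phi] has only radial limits. The estimates must accept such continua and must
    not depend on how finely they are sampled. Harmonic measure is replaced by a Riemann sum. The
    parameter advances by [tau] times the boundary distance of the point just chosen, and the Green
    function with this pole is at most a multiple of [1 / tau] times the increment of one bounded
    function. The sum telescopes to order [1 / tau]; at [z0] it also has at least this order, and
    [tau] cancels. Two parameters suffice: a path that has moved by a definite amount has changed
    its modulus or its slope. Slope suits radial limits, since pulling a point of the circle inwards
    along its radius does not change it. The covering property enters in three ways: paths and
    homotopies lift; local injectivity gives a quantitative nonconstancy; and no radial limit lies
    in [Omega], so [ghat] stays inside the disk over [(0,1)]. *)

Definition rect_integral (U V : R -> R -> R) (a b c d : R) : R :=
  RInt (fun x => V x c) a b + RInt (fun y => U b y) c d
  - RInt (fun x => V x d) a b - RInt (fun y => U a y) c d.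

Lemma pow_half_small (eps : R) : 0 < eps -> exists n : nat, / 2 ^ n < eps.
Proof.
  intros He.
  destruct (pow_lt_1_zero (/ 2)) with (y := eps) as [N HN].
  - rewrite Rabs_pos_eq; lra.
  - lra.
  - exists N. specialize (HN N (le_n _)).
    rewrite pow_inv in HN. rewrite Rabs_pos_eq in HN; auto.
    left. apply Rinv_0_lt_compat, pow_lt; lra.
Qed.

(** If [P] failed, gluing would provide a failing quarter and so a nested sequence of failing
    rectangles. They shrink to a point [(x, y)] common to all of them, where the local hypothesis
    applies. *)
Lemma rect_subdivision (P : R -> R -> R -> R -> Prop) (a b c d : R) :
  a <= b -> c <= d ->
  (forall a b c d, a <= b -> c <= d ->
     P a ((a + b) / 2) c ((c + d) / 2) -> P ((a + b) / 2) b c ((c + d) / 2) ->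
     P a ((a + b) / 2) ((c + d) / 2) d -> P ((a + b) / 2) b ((c + d) / 2) d ->
     P a b c d) ->
  (forall x y, a <= x <= b -> c <= y <= d -> exists delta, 0 < delta /\
     forall a' b' c' d', a <= a' <= x -> x <= b' <= b -> c <= c' <= y -> y <= d' <= d ->
       b' - a' < delta -> d' - c' < delta -> P a' b' c' d') ->
  P a b c d.
Proof.
  intros Hab Hcd Hglue Hloc. apply NNPP. intros HP.
  (* A failing quarter is selected. The last branch needs no test: if the first three quarters
     satisfy [P], gluing makes the fourth one fail. *)
  set (step := fun r : R * R * (R * R) =>
    let '((a, b), (c, d)) := r in
    let m := (a + b) / 2 in let n := (c + d) / 2 in
    if excluded_middle_informative (~ P a m c n) then ((a, m), (c, n)) else
    if excluded_middle_informative (~ P m b c n) then ((m, b), (c, n)) else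
    if excluded_middle_informative (~ P a m n d) then ((a, m), (n, d)) else
    ((m, b), (n, d))).
  set (q := fun n => Nat.iter n step ((a, b), (c, d))).
  assert (Hq : forall n,
    let '((a0, b0), (c0, d0)) := q n in let '((a1, b1), (c1, d1)) := q (S n) in
    ~ P a0 b0 c0 d0 /\ a <= a0 <= b0 /\ b0 <= b /\ c <= c0 <= d0 /\ d0 <= d /\
    b0 - a0 = (b - a) / 2 ^ n /\ d0 - c0 = (d - c) / 2 ^ n /\
    a0 <= a1 /\ b1 <= b0 /\ c0 <= c1 /\ d1 <= d0).
  { assert (Hs : forall r, let '((a0, b0), (c0, d0)) := r in
      let '((a1, b1), (c1, d1)) := step r in
      ~ P a0 b0 c0 d0 -> a0 <= b0 -> c0 <= d0 ->
      ~ P a1 b1 c1 d1 /\ a0 <= a1 <= b1 /\ b1 <= b0 /\ c0 <= c1 <= d1 /\ d1 <= d0 /\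
      b1 - a1 = (b0 - a0) / 2 /\ d1 - c1 = (d0 - c0) / 2).
    { intros [[a0 b0] [c0 d0]]. unfold step.
      destruct (excluded_middle_informative _) as [H1|H1].
      { intros H0 H2 H3. repeat split; auto; lra. }
      destruct (excluded_middle_informative _) as [H2|H2].
      { intros H0 H3 H4. repeat split; auto; lra. }
      destruct (excluded_middle_informative _) as [H3|H3].
      { intros H0 H4 H5. repeat split; auto; lra. }
      intros H0 H4 H5. split; [|repeat split; lra].
      intros H6. apply H0. apply Hglue; auto; apply NNPP; auto. }
    assert (Hi : forall n, let '((a0, b0), (c0, d0)) := q n in
      ~ P a0 b0 c0 d0 /\ a <= a0 <= b0 /\ b0 <= b /\ c <= c0 <= d0 /\ d0 <= d /\
      b0 - a0 = (b - a) / 2 ^ n /\ d0 - c0 = (d - c) / 2 ^ n).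
    { induction n as [|n IH].
      - simpl. repeat split; auto; lra.
      - change (q (S n)) with (step (q n)). specialize (Hs (q n)).
        destruct (q n) as [[a0 b0] [c0 d0]]. destruct (step _) as [[a1 b1] [c1 d1]].
        destruct IH as (I1 & I2 & I3 & I4 & I5 & I6 & I7).
        destruct Hs as (J1 & J2 & J3 & J4 & J5 & J6 & J7); auto; try lra.
        assert (0 < 2 ^ n) by (apply pow_lt; lra).
        repeat split; auto; try lra.
        + rewrite J6, I6. simpl. field. lra.
        + rewrite J7, I7. simpl. field. lra. }
    intros n. generalize (Hi n). specialize (Hs (q n)).
    change (q (S n)) with (step (q n)).
    destruct (q n) as [[a0 b0] [c0 d0]]. destruct (step _) as [[a1 b1] [c1 d1]].
    intros (I1 & I2 & I3 & I4 & I5 & I6 & I7).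
    destruct Hs as (J1 & J2 & J3 & J4 & J5 & J6 & J7); auto; try lra.
    repeat split; auto; lra. }
  assert (Hmono : forall n k,
    fst (fst (q n)) <= fst (fst (q (n + k)%nat)) /\ snd (fst (q (n + k)%nat)) <= snd (fst (q n)) /\
    fst (snd (q n)) <= fst (snd (q (n + k)%nat)) /\ snd (snd (q (n + k)%nat)) <= snd (snd (q n))).
  { intros n. induction k as [|k IH].
    - rewrite Nat.add_0_r. lra.
    - rewrite Nat.add_succ_r. specialize (Hq (n + k)%nat).
      destruct (q (n + k)%nat) as [[a0 b0] [c0 d0]]. destruct (q (S _)) as [[a1 b1] [c1 d1]].
      simpl in *. lra. }
  assert (Hcross : forall n m, fst (fst (q n)) <= snd (fst (q m)) /\ fst (snd (q n)) <= snd (snd (q m))).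
  { intros n m. pose proof (Hmono n m) as H1. pose proof (Hmono m n) as H2.
    rewrite (Nat.add_comm m n) in H2. specialize (Hq (n + m)%nat).
    destruct (q (n + m)%nat) as [[a0 b0] [c0 d0]]. destruct (q (S _)) as [[a1 b1] [c1 d1]].
    simpl in *. lra. }
  destruct (completeness (fun x => exists n, x = fst (fst (q n)))) as [x [Hx1 Hx2]].
  { exists b. intros x [n ->]. destruct (Hcross n O) as [H _]. exact H. }
  { exists a, O. reflexivity. }
  destruct (completeness (fun x => exists n, x = fst (snd (q n)))) as [y [Hy1 Hy2]].
  { exists d. intros y [n ->]. destruct (Hcross n O) as [_ H]. exact H. }
  { exists c, O. reflexivity. }
  assert (Hx : forall n, fst (fst (q n)) <= x <= snd (fst (q n))).
  { intros n. split. { apply Hx1. exists n; auto. }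
    apply Hx2. intros z [m ->]. apply Hcross. }
  assert (Hy : forall n, fst (snd (q n)) <= y <= snd (snd (q n))).
  { intros n. split. { apply Hy1. exists n; auto. }
    apply Hy2. intros z [m ->]. apply Hcross. }
  destruct (Hloc x y) as (delta & Hdelta & HH).
  { apply (Hx O). } { apply (Hy O). }
  (* Both sides of the [n]-th rectangle are at most [(b - a) + (d - c)] divided by [2 ^ n]; the
     added 1 covers a degenerate starting rectangle. *)
  destruct (pow_half_small (delta / ((b - a) + (d - c) + 1))) as [n Hn].
  { apply Rdiv_lt_0_compat; lra. }
  specialize (Hq n). specialize (Hx n). specialize (Hy n).
  destruct (q n) as [[a0 b0] [c0 d0]]. destruct (q (S _)) as [[a1 b1] [c1 d1]].
  simpl in *. destruct Hq as (I1 & I2 & I3 & I4 & I5 & I6 & I7 & _).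
  assert (0 < / 2 ^ n) by (apply Rinv_0_lt_compat, pow_lt; lra).
  apply (Rmult_lt_compat_r ((b - a) + (d - c) + 1)) in Hn; [|lra].
  replace (delta / (b - a + (d - c) + 1) * (b - a + (d - c) + 1)) with delta in Hn by (field; lra).
  apply I1, HH; try lra; unfold Rdiv in *; nra.
Qed.

Lemma RInt_split (f : R -> R) (a b c : R) :
  ex_RInt f a b -> ex_RInt f b c -> RInt f a c = RInt f a b + RInt f b c.
Proof. intros H1 H2. rewrite <- (RInt_Chasles f a b c H1 H2). reflexivity. Qed.

Lemma RInt_close (f g : R -> R) (a b M : R) : a <= b -> ex_RInt f a b -> ex_RInt g a b ->
  (forall x, a <= x <= b -> Rabs (f x - g x) <= M) ->
  Rabs (RInt f a b - RInt g a b) <= (b - a) * M.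
Proof.
  intros Hab Hf Hg H.
  change (RInt f a b - RInt g a b) with (minus (RInt f a b) (RInt g a b)).
  rewrite <- (RInt_minus f g a b Hf Hg).
  apply abs_RInt_le_const; auto.
  apply (ex_RInt_minus f g); auto.
Qed.

Section Goursat.

(** Cauchy-Riemann equations for [U + i V] on a half plane, because logarithmic coordinates turn a
    punctured disk into one. *)
Variables (U V : R -> R -> R) (X : R).
Hypothesis HUV : forall x y, x < X -> exists l m,
  differentiable_pt_lim U x y l (- m) /\ differentiable_pt_lim V x y m l.

Lemma cr_continuous x y : x < X ->
  continuous (fun x => U x y) x /\ continuous (fun y => U x y) y /\
  continuous (fun x => V x y) x /\ continuous (fun y => V x y) y.
Proof.
  intros Hx. destruct (HUV x y Hx) as (l & m & H1 & H2).
  assert (D : forall W l m, differentiable_pt_lim W x y l m ->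
    continuous (fun x => W x y) x /\ continuous (fun y => W x y) y).
  { intros W l' m' HW.
    split; apply continuity_pt_filterlim, derivable_continuous_pt.
    - exists (l' * 1 + m' * 0).
      apply (derivable_pt_lim_comp_2d W (fun x => x) (fun _ => y)); auto.
      apply derivable_pt_lim_id. apply derivable_pt_lim_const.
    - exists (l' * 0 + m' * 1).
      apply (derivable_pt_lim_comp_2d W (fun _ => x) (fun y => y)); auto.
      apply derivable_pt_lim_const. apply derivable_pt_lim_id. }
  destruct (D _ _ _ H1). destruct (D _ _ _ H2). tauto.
Qed.

Lemma ex_RInt_side a b y : a < X -> b < X -> ex_RInt (fun x => V x y) a b.
Proof.
  intros Ha Hb. apply (ex_RInt_continuous (V := R_CompleteNormedModule)).
  intros z [_ Hz].
  destruct (cr_continuous z y) as (_ & _ & H & _); [|exact H].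
  apply (Rle_lt_trans _ _ _ Hz), Rmax_lub_lt; auto.
Qed.

Lemma ex_RInt_front x c d : x < X -> ex_RInt (fun y => U x y) c d.
Proof.
  intros Hx. apply (ex_RInt_continuous (V := R_CompleteNormedModule)).
  intros z _. destruct (cr_continuous x z Hx) as (_ & H & _). exact H.
Qed.

Lemma rect_integral_quarters a b c d : a <= b -> b < X ->
  rect_integral U V a b c d =
  rect_integral U V a ((a + b) / 2) c ((c + d) / 2) +
  rect_integral U V ((a + b) / 2) b c ((c + d) / 2) +
  rect_integral U V a ((a + b) / 2) ((c + d) / 2) d +
  rect_integral U V ((a + b) / 2) b ((c + d) / 2) d.
Proof.
  intros Hab Hb. set (m := (a + b) / 2). set (n := (c + d) / 2).
  assert (Hm : a <= m <= b) by (unfold m; lra).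
  unfold rect_integral.
  assert (E1 : forall y, RInt (fun x => V x y) a b =
    RInt (fun x => V x y) a m + RInt (fun x => V x y) m b).
  { intros y. apply RInt_split; apply ex_RInt_side; lra. }
  assert (E2 : forall x, x < X -> RInt (fun y => U x y) c d =
    RInt (fun y => U x y) c n + RInt (fun y => U x y) n d).
  { intros x Hx. apply RInt_split; apply ex_RInt_front; lra. }
  rewrite !E1, !E2 by lra. ring.
Qed.

(** The part removed exactly in Goursat's argument: a first-order Taylor polynomial whose
    coefficients satisfy the Cauchy-Riemann equations. *)
Lemma rect_integral_linear l m u v x0 y0 a b c d :
  rect_integral (fun x y => u + l * (x - x0) - m * (y - y0))
                (fun x y => v + m * (x - x0) + l * (y - y0)) a b c d = 0.
Proof.
  assert (E : forall p q z s t, RInt (fun x => p + q * (x - z)) s t =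
     p * (t - s) + q * ((t - z) ^ 2 - (s - z) ^ 2) / 2).
  { intros p q z s t. apply is_RInt_unique.
    replace (p * (t - s) + q * ((t - z) ^ 2 - (s - z) ^ 2) / 2) with
      ((p * t + q * (t - z) ^ 2 / 2) - (p * s + q * (s - z) ^ 2 / 2))
      by (simpl; field).
    apply (is_RInt_derive (fun x => p * x + q * (x - z) ^ 2 / 2)).
    - intros x _. auto_derive; auto. field.
    - intros x _. apply continuity_pt_filterlim. reg. }
  unfold rect_integral.
  rewrite (RInt_ext (fun x => v + m * (x - x0) + l * (c - y0))
    (fun x => (v + l * (c - y0)) + m * (x - x0))) by (intros; simpl; ring).
  rewrite (RInt_ext (fun x => v + m * (x - x0) + l * (d - y0))
    (fun x => (v + l * (d - y0)) + m * (x - x0))) by (intros; simpl; ring).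
  rewrite (RInt_ext (fun y => u + l * (b - x0) - m * (y - y0))
    (fun y => (u + l * (b - x0)) + (- m) * (y - y0))) by (intros; simpl; ring).
  rewrite (RInt_ext (fun y => u + l * (a - x0) - m * (y - y0))
    (fun y => (u + l * (a - x0)) + (- m) * (y - y0))) by (intros; simpl; ring).
  rewrite !E. field.
Qed.

(** On each side the error against the first-order expansion is at most [eps / 2] times the half
    perimeter [s], and the sides have total length [2 s]. *)
Lemma rect_integral_small eps x y : 0 < eps -> x < X -> exists delta, 0 < delta /\
  forall a b c d, a <= x <= b -> b < X -> c <= y <= d -> b - a < delta -> d - c < delta ->
    Rabs (rect_integral U V a b c d) <= eps * ((b - a) + (d - c)) ^ 2.
Proof.
  intros He Hx. destruct (HUV x y Hx) as (l & m & HU & HV).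
  assert (He2 : 0 < eps / 2) by lra.
  destruct (HU (mkposreal _ He2)) as [d1 H1]. destruct (HV (mkposreal _ He2)) as [d2 H2].
  simpl in H1, H2.
  exists (Rmin d1 d2). split. { apply Rmin_pos; [apply d1|apply d2]. }
  intros a b c d Hab HbX Hcd Hba Hdc.
  assert (Hd1 := Rmin_l d1 d2). assert (Hd2 := Rmin_r d1 d2).
  set (s := (b - a) + (d - c)).
  set (lU := fun p q => U x y + l * (p - x) - m * (q - y)).
  set (lV := fun p q => V x y + m * (p - x) + l * (q - y)).
  assert (B : forall p q, a <= p <= b -> c <= q <= d ->
    Rabs (U p q - lU p q) <= eps / 2 * s /\ Rabs (V p q - lV p q) <= eps / 2 * s).
  { intros p q Hp Hq.
    assert (Rabs (p - x) <= b - a) by (apply Rabs_le; lra).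
    assert (Rabs (q - y) <= d - c) by (apply Rabs_le; lra).
    assert (HM : Rmax (Rabs (p - x)) (Rabs (q - y)) <= s).
    { unfold s. apply Rmax_lub; lra. }
    split.
    - eapply Rle_trans; [|apply Rmult_le_compat_l, HM; lra].
      eapply Rle_trans; [|apply H1; lra].
      right. f_equal. unfold lU. ring.
    - eapply Rle_trans; [|apply Rmult_le_compat_l, HM; lra].
      eapply Rle_trans; [|apply H2; lra].
      right. f_equal. unfold lV. ring. }
  assert (Cl : forall f p q z, f = (fun x => p + q * (x - z)) ->
    forall s t, ex_RInt f s t).
  { intros f p q z -> s' t'. apply (ex_RInt_continuous (V := R_CompleteNormedModule)).
    intros. apply continuity_pt_filterlim. reg. }
  assert (EV : forall q, ex_RInt (fun p => lV p q) a b).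
  { intros q. apply (ex_RInt_ext (fun p => (V x y + l * (q - y)) + m * (p - x))).
    { intros; unfold lV; simpl; ring. }
    eapply Cl; reflexivity. }
  assert (EU : forall p, ex_RInt (fun q => lU p q) c d).
  { intros p. apply (ex_RInt_ext (fun q => (U x y + l * (p - x)) + (- m) * (q - y))).
    { intros; unfold lU; simpl; ring. }
    eapply Cl; reflexivity. }
  assert (IV : forall q, c <= q <= d ->
    Rabs (RInt (fun p => V p q) a b - RInt (fun p => lV p q) a b) <= (b - a) * (eps / 2 * s)).
  { intros q Hq.
    assert (G1 : ex_RInt (fun p => V p q) a b) by (apply ex_RInt_side; lra).
    apply RInt_close; auto; [lra|]. intros p Hp. apply B; lra. }
  assert (IU : forall p, a <= p <= b ->
    Rabs (RInt (fun q => U p q) c d - RInt (fun q => lU p q) c d) <= (d - c) * (eps / 2 * s)).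
  { intros p Hp.
    assert (G1 : ex_RInt (fun q => U p q) c d) by (apply ex_RInt_front; lra).
    apply RInt_close; auto; [lra|]. intros q Hq. apply B; lra. }
  pose proof (rect_integral_linear l m (U x y) (V x y) x y a b c d) as L.
  fold lU lV in L. unfold rect_integral in *.
  change (RInt (fun y0 => lU b y0) c d) with (RInt (fun q => lU b q) c d) in L.
  assert (K1 := IV c ltac:(lra)). assert (K2 := IV d ltac:(lra)).
  assert (K3 := IU a ltac:(lra)). assert (K4 := IU b ltac:(lra)).
  apply Rabs_le_between in K1. apply Rabs_le_between in K2.
  apply Rabs_le_between in K3. apply Rabs_le_between in K4.
  unfold lU, lV in *. cbv beta in *.
  replace (eps * s ^ 2) with
    ((b - a) * (eps / 2 * s) + (b - a) * (eps / 2 * s) + (d - c) * (eps / 2 * s) + (d - c) * (eps / 2 * s))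
    by (unfold s; field).
  apply Rabs_le. lra.
Qed.

(** [rect_integral] is the imaginary part of the contour integral of [U + i V]. The bound by [eps]
    times the squared half perimeter passes from the four quarters to the whole, since each quarter
    has half the half perimeter; hence it holds for the given rectangle as soon as it holds
    locally. *)
Theorem goursat_rect a b c d : a <= b -> b < X -> c <= d -> rect_integral U V a b c d = 0.
Proof.
  intros Hab HbX Hcd.
  assert (H : forall eps, 0 < eps ->
    Rabs (rect_integral U V a b c d) <= eps * ((b - a) + (d - c)) ^ 2).
  { intros eps He.
    apply (rect_subdivision (fun a b c d => b < X ->
      Rabs (rect_integral U V a b c d) <= eps * ((b - a) + (d - c)) ^ 2)); auto.
    - intros a0 b0 c0 d0 H1 H2 P1 P2 P3 P4 HX.
      rewrite rect_integral_quarters by lra.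
      specialize (P1 ltac:(lra)). specialize (P2 ltac:(lra)).
      specialize (P3 ltac:(lra)). specialize (P4 ltac:(lra)).
      apply Rabs_le_between in P1. apply Rabs_le_between in P2.
      apply Rabs_le_between in P3. apply Rabs_le_between in P4.
      apply Rabs_le. nra.
    - intros x y Hx Hy. destruct (rect_integral_small eps x y He) as (delta & Hd & HH); [lra|].
      exists delta. split; auto. intros. apply HH; lra. }
  apply NNPP. intros HN. apply Rabs_pos_lt in HN.
  set (s := ((b - a) + (d - c)) ^ 2) in *.
  assert (0 <= s) by (unfold s; nra).
  specialize (H (Rabs (rect_integral U V a b c d) / (2 * (s + 1)))
    ltac:(apply Rdiv_lt_0_compat; lra)).
  assert (E : Rabs (rect_integral U V a b c d) / (2 * (s + 1)) * s
    <= Rabs (rect_integral U V a b c d) / 2).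
  { apply (Rmult_le_reg_r (2 * (s + 1))); [lra|]. field_simplify; [|lra]. nra. }
  lra.
Qed.

End Goursat.

(** * The maximum principle *)

Definition ccont (f : C -> C) (z : C) : Prop :=
  forall eps, 0 < eps -> exists delta, 0 < delta /\
    forall w, Cmod (w - z) < delta -> Cmod (f w - f z) < eps.

(* Caratheodory's form of complex differentiability: the difference quotient extends
   continuously to the point. *)
Definition cdiff (f : C -> C) (z : C) : Prop :=
  exists q : C -> C, ccont q z /\ forall w, (f w - f z = q w * (w - z))%C.

Lemma Cmod_sub_sym (z w : C) : Cmod (z - w) = Cmod (w - z).
Proof. rewrite <- Cmod_opp. f_equal. ring. Qed.

Lemma Cmod_sub_trans (x y z : C) : Cmod (x - z) <= Cmod (x - y) + Cmod (y - z).
Proof. replace (x - z)%C with ((x - y) + (y - z))%C by ring. apply Cmod_triangle. Qed.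

Lemma Cmod_sub_lower (z w : C) : Cmod z - Cmod w <= Cmod (z - w).
Proof.
  pose proof (Cmod_triangle (z - w) w) as H.
  replace (z - w + w)%C with z in H by ring. lra.
Qed.

Lemma Cmod_sub_self (z : C) : Cmod (z - z) = 0.
Proof. replace (z - z)%C with (RtoC 0) by ring. apply Cmod_0. Qed.

Lemma Cmod_sqr (z : C) : Cmod z * Cmod z = fst z * fst z + snd z * snd z.
Proof. pose proof (Cmod2_alt z) as H. unfold Re, Im in H. simpl in H. nra. Qed.

Lemma Cmod_le_abs (z : C) : Cmod z <= Rabs (fst z) + Rabs (snd z).
Proof.
  pose proof (Cmod_sqr z). pose proof (Cmod_ge_0 z).
  pose proof (Rabs_pos (fst z)). pose proof (Rabs_pos (snd z)).
  assert (fst z * fst z = Rabs (fst z) * Rabs (fst z)) by (rewrite <- Rabs_mult, Rabs_pos_eq; nra).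
  assert (snd z * snd z = Rabs (snd z) * Rabs (snd z)) by (rewrite <- Rabs_mult, Rabs_pos_eq; nra).
  nra.
Qed.

Lemma fst_le_Cmod (z : C) : Rabs (fst z) <= Cmod z.
Proof. eapply Rle_trans; [apply Rmax_l|apply Rmax_Cmod]. Qed.

Lemma snd_le_Cmod (z : C) : Rabs (snd z) <= Cmod z.
Proof. eapply Rle_trans; [apply Rmax_r|apply Rmax_Cmod]. Qed.

Lemma ccont_const (c z : C) : ccont (fun _ => c) z.
Proof. intros eps He. exists 1. split; [lra|]. intros. rewrite Cmod_sub_self. auto. Qed.

Lemma ccont_id (z : C) : ccont (fun w => w) z.
Proof. intros eps He. exists eps. auto. Qed.

Lemma ccont_plus f g z : ccont f z -> ccont g z -> ccont (fun w => f w + g w)%C z.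
Proof.
  intros Hf Hg eps He.
  destruct (Hf (eps / 2)) as (d1 & D1 & H1); [lra|].
  destruct (Hg (eps / 2)) as (d2 & D2 & H2); [lra|].
  exists (Rmin d1 d2). split; [apply Rmin_pos; auto|]. intros w Hw.
  pose proof (Rmin_l d1 d2). pose proof (Rmin_r d1 d2).
  specialize (H1 w ltac:(lra)). specialize (H2 w ltac:(lra)).
  replace (f w + g w - (f z + g z))%C with ((f w - f z) + (g w - g z))%C by ring.
  eapply Rle_lt_trans; [apply Cmod_triangle|]. lra.
Qed.

Lemma ccont_mult f g z : ccont f z -> ccont g z -> ccont (fun w => f w * g w)%C z.
Proof.
  intros Hf Hg eps He.
  pose proof (Cmod_ge_0 (f z)). pose proof (Cmod_ge_0 (g z)).
  set (A := 2 * (Cmod (g z) + Cmod (f z) + 2)).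
  assert (HA : 0 < eps / A) by (apply Rdiv_lt_0_compat; unfold A; lra).
  destruct (Hf (eps / A)) as (d1 & D1 & H1); [auto|].
  destruct (Hg (Rmin 1 (eps / A))) as (d2 & D2 & H2); [apply Rmin_pos; lra|].
  exists (Rmin d1 d2). split; [apply Rmin_pos; auto|]. intros w Hw.
  pose proof (Rmin_l d1 d2). pose proof (Rmin_r d1 d2).
  specialize (H1 w ltac:(lra)). specialize (H2 w ltac:(lra)).
  pose proof (Rmin_l 1 (eps / A)). pose proof (Rmin_r 1 (eps / A)).
  replace (f w * g w - f z * g z)%C with ((f w - f z) * g w + f z * (g w - g z))%C by ring.
  eapply Rle_lt_trans; [apply Cmod_triangle|]. rewrite !Cmod_mult.
  assert (Cmod (g w) <= Cmod (g z) + 1).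
  { pose proof (Cmod_sub_lower (g w) (g z)). lra. }
  assert (eps = eps / A * A) as E by (field; unfold A; lra).
  set (x := eps / A) in *. rewrite E. unfold A.
  pose proof (Cmod_ge_0 (f w - f z)). pose proof (Cmod_ge_0 (g w - g z)).
  pose proof (Cmod_ge_0 (g w)). nra.
Qed.

Lemma ccont_inv (f : C -> C) (z : C) : f z <> 0 -> ccont f z -> ccont (fun w => / f w)%C z.
Proof.
  intros Hz Hf eps He.
  assert (Hm : 0 < Cmod (f z)) by (apply Cmod_gt_0; auto).
  set (m := Cmod (f z)) in *.
  destruct (Hf (Rmin (m / 2) (eps * m * m / 2))) as (d & D & H).
  { apply Rmin_pos; [lra|]. apply Rdiv_lt_0_compat; [|lra].
    apply Rmult_lt_0_compat; auto. apply Rmult_lt_0_compat; auto. }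
  exists d. split; auto. intros w Hw. specialize (H w Hw).
  pose proof (Rmin_l (m / 2) (eps * m * m / 2)). pose proof (Rmin_r (m / 2) (eps * m * m / 2)).
  assert (Hw2 : m / 2 < Cmod (f w)).
  { pose proof (Cmod_sub_lower (f z) (f w)). rewrite Cmod_sub_sym in H2. fold m in H2. lra. }
  assert (f w <> 0) by (apply Cmod_gt_0; lra).
  replace (/ f w - / f z)%C with ((f z - f w) / (f w * f z))%C by (field; auto).
  rewrite Cmod_div, Cmod_mult by (apply Cmult_neq_0; auto). fold m.
  rewrite Cmod_sub_sym.
  apply (Rmult_lt_reg_r (Cmod (f w) * m)); [nra|].
  unfold Rdiv. rewrite Rmult_assoc, Rinv_l, Rmult_1_r by nra.
  assert (0 < eps * m) by nra. nra.
Qed.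

Lemma cdiff_cont f z : cdiff f z -> ccont f z.
Proof.
  intros (q & Hq & E).
  assert (H : ccont (fun w => f z + q w * (w - z))%C z).
  { apply ccont_plus; [apply ccont_const|]. apply ccont_mult; auto.
    apply (ccont_plus (fun w => w) (fun _ => - z)%C); [apply ccont_id|apply ccont_const]. }
  intros eps He. destruct (H eps He) as (d & D & HH). exists d. split; auto.
  intros w Hw. specialize (HH w Hw).
  replace (f w) with (f z + q w * (w - z))%C by (rewrite <- E; ring).
  replace (f z + q z * (z - z))%C with (f z) in HH by ring. exact HH.
Qed.

Lemma cdiff_const c z : cdiff (fun _ => c) z.
Proof. exists (fun _ => RtoC 0). split; [apply ccont_const|]. intros. ring. Qed.

Lemma cdiff_id z : cdiff (fun w => w) z.
Proof. exists (fun _ => RtoC 1). split; [apply ccont_const|]. intros. ring. Qed.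

Lemma cdiff_plus f g z : cdiff f z -> cdiff g z -> cdiff (fun w => f w + g w)%C z.
Proof.
  intros (p & Hp & E1) (q & Hq & E2). exists (fun w => p w + q w)%C.
  split; [apply ccont_plus; auto|]. intros w.
  replace (f w + g w - (f z + g z))%C with ((f w - f z) + (g w - g z))%C by ring.
  rewrite E1, E2. ring.
Qed.

Lemma cdiff_mult f g z : cdiff f z -> cdiff g z -> cdiff (fun w => f w * g w)%C z.
Proof.
  intros Hf Hg. pose proof (cdiff_cont _ _ Hg) as Cg.
  destruct Hf as (p & Hp & E1). destruct Hg as (q & Hq & E2).
  exists (fun w => p w * g w + f z * q w)%C. split.
  - apply ccont_plus; apply ccont_mult; auto. apply ccont_const.
  - intros w.
    replace (f w * g w - f z * g z)%C with ((f w - f z) * g w + f z * (g w - g z))%C by ring.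
    rewrite E1, E2. ring.
Qed.

Lemma ccont_ext_loc f g z r : 0 < r -> (forall w, Cmod (w - z) < r -> f w = g w) ->
  ccont f z -> ccont g z.
Proof.
  intros Hr E Hf eps He. destruct (Hf eps He) as (d & D & H).
  exists (Rmin d r). split; [apply Rmin_pos; auto|]. intros w Hw.
  pose proof (Rmin_l d r). pose proof (Rmin_r d r).
  rewrite <- !E; [apply H|rewrite Cmod_sub_self|]; lra.
Qed.

Lemma cdiff_inv (f : C -> C) (z : C) : f z <> 0 -> cdiff f z -> cdiff (fun w => / f w)%C z.
Proof.
  intros Hz Hf. pose proof (cdiff_cont _ _ Hf) as Cf. destruct Hf as (p & Hp & E1).
  assert (Hm : 0 < Cmod (f z)) by (apply Cmod_gt_0; auto).
  destruct (Cf _ Hm) as (r & Hr & Hnz).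
  assert (NZ : forall w, Cmod (w - z) < r -> f w <> 0).
  { intros w Hw E. specialize (Hnz w Hw). rewrite E in Hnz.
    replace (0 - f z)%C with (- f z)%C in Hnz by ring. rewrite Cmod_opp in Hnz. lra. }
  (* Away from [z] the difference quotient itself is taken, because [cdiff] asks for the
     factorization at every [w], even where [f] vanishes. *)
  exists (fun w => if Rlt_dec (Cmod (w - z)) r then (RtoC (-1) * p w) * / f w * / f z
                   else (/ f w - / f z) / (w - z))%C. split.
  - apply (ccont_ext_loc (fun w => (RtoC (-1) * p w) * / f w * / f z)%C _ _ r); auto.
    + intros w Hw. destruct (Rlt_dec _ _); [reflexivity|lra].
    + apply ccont_mult; [|apply ccont_const]. apply ccont_mult.
      * apply (ccont_mult (fun _ => RtoC (-1)) p); auto. apply ccont_const.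
      * apply ccont_inv; auto.
  - intros w. destruct (Rlt_dec _ _) as [H|H].
    + replace (/ f w - / f z)%C with (- (f w - f z) * / f w * / f z)%C by (field; auto).
      rewrite E1. replace (RtoC (-1)) with (- RtoC 1)%C by (rewrite <- RtoC_opp; f_equal; lra). ring.
    + generalize (/ f w - / f z)%C. intros A. field. intros H0. rewrite H0, Cmod_0 in H. lra.
Qed.

Lemma cdiff_pow f z n : cdiff f z -> cdiff (fun w => f w ^ n)%C z.
Proof.
  intros Hf. induction n as [|n IH]; simpl.
  - apply cdiff_const.
  - apply cdiff_mult; auto.
Qed.

Lemma cdiff_ext_loc f g z r : 0 < r -> (forall w, Cmod (w - z) < r -> f w = g w) ->
  cdiff f z -> cdiff g z.
Proof.
  intros Hr E (q & Hq & Eq).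
  exists (fun w => if Rlt_dec (Cmod (w - z)) r then q w else (g w - g z) / (w - z))%C. split.
  - intros eps He. destruct (Hq eps He) as (d & D & H).
    exists (Rmin d r). split; [apply Rmin_pos; auto|]. intros w Hw.
    pose proof (Rmin_l d r). pose proof (Rmin_r d r).
    destruct (Rlt_dec (Cmod (w - z)) r); [|lra].
    destruct (Rlt_dec (Cmod (z - z)) r) as [|n]; [|rewrite Cmod_sub_self in n; lra].
    apply H; lra.
  - intros w. destruct (Rlt_dec (Cmod (w - z)) r) as [H|H].
    + rewrite <- !E; auto. rewrite Cmod_sub_self; auto.
    + field. intros H0. rewrite H0, Cmod_0 in H. lra.
Qed.

(** * Cauchy-Riemann equations in polar coordinates and the mean value property *)

Lemma differentiable_pt_lim_proj2 x y : differentiable_pt_lim (fun _ v => v) x y 0 1.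
Proof.
  intros eps. exists (mkposreal 1 Rlt_0_1). intros u v _ _.
  replace (v - y - (0 * (u - x) + 1 * (v - y))) with 0 by ring. rewrite Rabs_R0.
  apply Rmult_le_pos; [left; apply eps|]. eapply Rle_trans; [apply Rabs_pos|apply Rmax_l].
Qed.

Lemma differentiable_pt_lim_proj1 x y : differentiable_pt_lim (fun u _ => u) x y 1 0.
Proof. apply (differentiable_pt_lim_proj1_0 (fun u => u)). apply derivable_pt_lim_id. Qed.

Lemma differentiable_pt_lim_affine_mult k x y :
  differentiable_pt_lim (fun u v => k + u * v) x y y x.
Proof.
  intros eps. exists eps. intros u v Hu Hv.
  replace (k + u * v - (k + x * y) - (y * (u - x) + x * (v - y))) with ((u - x) * (v - y)) by ring.
  rewrite Rabs_mult. apply Rmult_le_compat; try apply Rabs_pos; [lra|apply Rmax_r].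
Qed.

Lemma differentiable_pt_lim_exp_mult (k : R) (g : R -> R) x y l : derivable_pt_lim g y l ->
  differentiable_pt_lim (fun u v => k + exp u * g v) x y (exp x * g y) (exp x * l).
Proof.
  intros Hg.
  assert (D : differentiable_pt_lim (fun _ v => g v) x y (l * 0 + 0 * 1) (l * 1 + 0 * 0)).
  { apply (differentiable_pt_lim_comp (fun u _ => g u) (fun _ v => v) (fun u _ => u)).
    - apply differentiable_pt_lim_proj1_0; auto.
    - apply differentiable_pt_lim_proj2.
    - apply differentiable_pt_lim_proj1. }
  pose proof (differentiable_pt_lim_comp (fun u v => k + u * v) (fun u _ => exp u)
    (fun _ v => g v) x y _ _ _ _ _ _ (differentiable_pt_lim_affine_mult k _ _)
    (differentiable_pt_lim_proj1_0 exp x y _ (derivable_pt_lim_exp x)) D) as H.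
  simpl in H.
  replace (exp x * g y) with (g y * exp x + exp x * (l * 0 + 0 * 1)) by ring.
  replace (exp x * l) with (g y * 0 + exp x * (l * 1 + 0 * 0)) by ring. exact H.
Qed.

Lemma cdiff_real_diff (H : C -> C) (p q : R) : cdiff H (p, q) -> exists l m,
  differentiable_pt_lim (fun u v => fst (H (u, v))) p q l (- m) /\
  differentiable_pt_lim (fun u v => snd (H (u, v))) p q m l.
Proof.
  intros (k & Hk & E). exists (fst (k (p, q))), (snd (k (p, q))).
  assert (B : forall eps : posreal, exists delta : posreal, forall u v,
    Rabs (u - p) < delta -> Rabs (v - q) < delta ->
    Cmod (H (u, v) - H (p, q) - k (p, q) * ((u, v) - (p, q)))%C
    <= eps * Rmax (Rabs (u - p)) (Rabs (v - q))).
  { intros eps. destruct (Hk (eps / 2)) as (d & D & HH). { destruct eps; simpl; lra. }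
    assert (D2 : 0 < d / 2) by lra. exists (mkposreal _ D2). simpl. intros u v Hu Hv.
    replace (H (u, v) - H (p, q) - k (p, q) * ((u, v) - (p, q)))%C
      with ((k (u, v) - k (p, q)) * ((u, v) - (p, q)))%C by (rewrite E; ring).
    rewrite Cmod_mult.
    assert (M : Cmod ((u, v) - (p, q)) <= Rabs (u - p) + Rabs (v - q)).
    { apply (Cmod_le_abs ((u, v) - (p, q))%C). }
    pose proof (Rmax_l (Rabs (u - p)) (Rabs (v - q))).
    pose proof (Rmax_r (Rabs (u - p)) (Rabs (v - q))).
    specialize (HH (u, v) ltac:(lra)).
    pose proof (Cmod_ge_0 (k (u, v) - k (p, q))). pose proof (Cmod_ge_0 ((u, v) - (p, q))).
    nra. }
  split; intros eps; destruct (B eps) as [delta Hd]; exists delta; intros u v Hu Hv;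
    (eapply Rle_trans; [|apply (Hd u v Hu Hv)]).
  - eapply Rle_trans; [|apply fst_le_Cmod]. right. f_equal. simpl. ring.
  - eapply Rle_trans; [|apply snd_le_Cmod]. right. f_equal. simpl. ring.
Qed.

Definition cpolar (a : C) (x y : R) : C := (fst a + exp x * cos y, snd a + exp x * sin y).

Lemma cpolar_dist a x y : Cmod (cpolar a x y - a) = exp x.
Proof.
  assert (E : Cmod (cpolar a x y - a) * Cmod (cpolar a x y - a) = exp x * exp x).
  { rewrite Cmod_sqr. simpl. pose proof (sin2_cos2 y) as T. unfold Rsqr in T.
    transitivity (exp x * exp x * (sin y * sin y + cos y * cos y)); [ring|rewrite T; ring]. }
  pose proof (Cmod_ge_0 (cpolar a x y - a)). pose proof (exp_pos x). nra.
Qed.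

(* In the coordinates [a + exp (x + i y)] a circle around [a] becomes a vertical segment, and by
   periodicity Goursat's theorem makes the mean over the circle independent of its radius. *)
Lemma re_mean_value (H : C -> C) (a : C) (r r0 kappa : R) :
  0 < r < r0 -> 0 < kappa -> (forall z, Cmod (z - a) < r0 -> cdiff H z) ->
  ~ (forall z, Cmod (z - a) = r -> fst (H z) <= fst (H a) - kappa).
Proof.
  intros Hr Hk HD Hc.
  set (U := fun x y => fst (H (cpolar a x y))). set (V := fun x y => snd (H (cpolar a x y))).
  assert (CR : forall x y, x < ln r0 -> exists l m,
    differentiable_pt_lim U x y l (- m) /\ differentiable_pt_lim V x y m l).
  { intros x y Hx.
    destruct (cdiff_real_diff H (fst a + exp x * cos y) (snd a + exp x * sin y)) as (l & m & H1 & H2).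
    { apply HD. change (Cmod (cpolar a x y - a) < r0).
      rewrite cpolar_dist. rewrite <- (exp_ln r0) by lra. apply exp_increasing; auto. }
    pose proof (differentiable_pt_lim_exp_mult (fst a) cos x y _ (derivable_pt_lim_cos y)) as G1.
    pose proof (differentiable_pt_lim_exp_mult (snd a) sin x y _ (derivable_pt_lim_sin y)) as G2.
    pose proof (differentiable_pt_lim_comp _ _ _ x y _ _ _ _ _ _ H1 G1 G2) as K1.
    pose proof (differentiable_pt_lim_comp _ _ _ x y _ _ _ _ _ _ H2 G1 G2) as K2.
    simpl in K1, K2.
    exists (l * (exp x * cos y) + - m * (exp x * sin y)), (m * (exp x * cos y) + l * (exp x * sin y)).
    split.
    - replace (- (m * (exp x * cos y) + l * (exp x * sin y)))
        with (l * (exp x * - sin y) + - m * (exp x * cos y)) by ring. exact K1.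
    - replace (l * (exp x * cos y) + - m * (exp x * sin y))
        with (m * (exp x * - sin y) + l * (exp x * cos y)) by ring. exact K2. }
  assert (HP : 0 < 2 * PI) by (pose proof PI_RGT_0; lra).
  destruct (cdiff_cont H a (HD a ltac:(rewrite Cmod_sub_self; lra)) (kappa / 2)) as (d & Dd & Hd); [lra|].
  (* On the inner circle, of radius [Rmin r (d / 2)], continuity at [a] keeps the real part above
     [fst (H a) - kappa / 2], while on the outer one it is assumed to be at most
     [fst (H a) - kappa]. *)
  set (x0 := ln r). set (x1 := ln (Rmin r (d / 2))).
  assert (Hm : 0 < Rmin r (d / 2)) by (apply Rmin_pos; lra).
  assert (Hx1 : x1 <= x0).
  { apply ln_le; auto. apply Rmin_l. }
  assert (Hx0 : x0 < ln r0) by (apply ln_increasing; lra).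
  pose proof (goursat_rect U V (ln r0) CR x1 x0 0 (2 * PI) Hx1 Hx0 ltac:(lra)) as G.
  unfold rect_integral in G.
  rewrite (RInt_ext (fun x => V x (2 * PI)) (fun x => V x 0)) in G.
  2: { intros x _. unfold V, cpolar. rewrite cos_2PI, sin_2PI, cos_0, sin_0. reflexivity. }
  assert (EX : forall x, x < ln r0 -> ex_RInt (fun y => U x y) 0 (2 * PI)).
  { intros x Hx. apply (ex_RInt_front U V (ln r0) CR); auto. }
  assert (I0 : RInt (fun y => U x0 y) 0 (2 * PI) <= RInt (fun _ => fst (H a) - kappa) 0 (2 * PI)).
  { apply RInt_le; [lra|apply EX; auto|apply ex_RInt_const|]. intros y _. apply Hc.
    rewrite cpolar_dist. apply exp_ln. lra. }
  assert (I1 : RInt (fun _ => fst (H a) - kappa / 2) 0 (2 * PI) <= RInt (fun y => U x1 y) 0 (2 * PI)).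
  { apply RInt_le; [lra|apply ex_RInt_const|apply EX; lra|]. intros y _.
    specialize (Hd (cpolar a x1 y)). rewrite cpolar_dist in Hd. unfold x1 in Hd.
    rewrite exp_ln in Hd by auto. pose proof (Rmin_r r (d / 2)).
    specialize (Hd ltac:(lra)).
    pose proof (fst_le_Cmod (H (cpolar a x1 y) - H a)) as F. fold x1 in Hd.
    apply Rabs_le_between in F. simpl in F. unfold U. lra. }
  rewrite !RInt_const in *. unfold scal in *; simpl in *. unfold mult in *; simpl in *.
  assert (2 * PI * kappa > 0) by nra. lra.
Qed.

(** * Compactness of bounded sets in the plane *)

Lemma plane_gauge (delta : C -> R) (B : R) : (forall z, 0 < delta z) ->
  exists d, 0 < d /\ forall z, Cmod z <= B -> exists u, Cmod (z - u) < delta u /\ d <= delta u.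
Proof.
  intros Hd.
  (* Halving turns a bound on each coordinate into a bound on the modulus. *)
  assert (Hd2 : forall z, 0 < delta z / 2) by (intros z; specialize (Hd z); lra).
  destruct (compactness_value_2d (- B) B (- B) B (fun u v => mkposreal _ (Hd2 (u, v)))) as [d HH].
  exists d. split; [apply d|]. intros z Hz.
  pose proof (fst_le_Cmod z) as F. pose proof (snd_le_Cmod z) as G.
  apply Rabs_le_between in F. apply Rabs_le_between in G.
  specialize (HH (fst z) (snd z) ltac:(lra) ltac:(lra)).
  apply NNPP in HH. destruct HH as (u & v & _ & _ & H1 & H2 & H3). simpl in *.
  exists (u, v). split; [|specialize (Hd (u, v)); lra].
  eapply Rle_lt_trans; [apply Cmod_le_abs|]. simpl.
  change (Rabs (fst z - u) + Rabs (snd z - v) < delta (u, v)). lra.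
Qed.

(** The form in which most compactness arguments below are run: a statement that holds near each
    point with a radius of its own becomes available near every point of a bounded set with radii
    bounded below. As [delta] is an argument of [P], it can also be the constant in the
    statement. *)
Lemma plane_gauge_choice (P : C -> R -> Prop) (B : R) :
  (forall z, exists delta, 0 < delta /\ P z delta) ->
  exists d, 0 < d /\ forall z, Cmod z <= B -> exists u delta, P u delta /\ Cmod (z - u) < delta /\ d <= delta.
Proof.
  intros H. set (g := fun z => proj1_sig (constructive_indefinite_description _ (H z))).
  assert (Hg : forall z, 0 < g z /\ P z (g z)).
  { intros z. unfold g. destruct (constructive_indefinite_description _ (H z)); auto. }
  destruct (plane_gauge g B) as (d & D & HH). { apply Hg. }
  exists d. split; auto. intros z Hz. destruct (HH z Hz) as (u & H1 & H2).
  exists u, (g u). split; [apply Hg|]. auto.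
Qed.

Lemma plane_max (K : C -> Prop) (Phi : C -> R) (B : R) :
  (exists z, K z) -> (forall z, K z -> Cmod z <= B) ->
  (forall z, ~ K z -> exists d, 0 < d /\ forall w, Cmod (w - z) < d -> ~ K w) ->
  (forall z, K z -> forall eps, 0 < eps -> exists d, 0 < d /\
     forall w, Cmod (w - z) < d -> Rabs (Phi w - Phi z) < eps) ->
  exists a, K a /\ forall z, K z -> Phi z <= Phi a.
Proof.
  intros [k0 Hk0] HB Hcl Hc.
  assert (bd : exists M, forall z, K z -> Phi z <= M).
  (* One number is both the radius and, inverted, the local upper bound of [Phi]. *)
  { destruct (plane_gauge_choice (fun u d => forall w, K w -> Cmod (w - u) < d -> Phi w <= / d) B)
      as (d & D & HH).
    - intros z. destruct (classic (K z)) as [Hz|Hz].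
      + destruct (Hc z Hz 1) as (d & D & H); [lra|].
        pose proof (Rabs_pos (Phi z)).
        exists (Rmin d (/ (Rabs (Phi z) + 1))). split.
        { apply Rmin_pos; auto. apply Rinv_0_lt_compat. lra. }
        intros w _ Hw. pose proof (Rmin_l d (/ (Rabs (Phi z) + 1))) as L.
        pose proof (Rmin_r d (/ (Rabs (Phi z) + 1))) as R0.
        specialize (H w ltac:(lra)). apply Rabs_lt_between in H.
        pose proof (Rle_abs (Phi z)).
        apply Rle_trans with (Rabs (Phi z) + 1); [lra|].
        assert (Hk : 0 < / (Rabs (Phi z) + 1)) by (apply Rinv_0_lt_compat; lra).
        assert (E : Rabs (Phi z) + 1 = / / (Rabs (Phi z) + 1)) by (rewrite Rinv_inv; auto).
        set (k := / (Rabs (Phi z) + 1)) in *. rewrite E. apply Rinv_le_contravar; auto.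
        apply Rmin_pos; auto.
      + destruct (Hcl z Hz) as (d & D & H). exists d. split; auto.
        intros w Hw Hd. exfalso. apply (H w); auto.
    - exists (/ d). intros z Hz. destruct (HH z (HB z Hz)) as (u & e & H1 & H2 & H3).
      apply Rle_trans with (/ e); [apply H1; auto|]. apply Rinv_le_contravar; auto. }
  destruct (completeness (fun x => exists z, K z /\ x = Phi z)) as [S [HS1 HS2]].
  { destruct bd as [M HM]. exists M. intros x (z & Hz & ->). auto. }
  { exists (Phi k0), k0. auto. }
  apply NNPP. intros HN.
  assert (lt : forall z, K z -> Phi z < S).
  { intros z Hz. assert (Phi z <= S) by (apply HS1; exists z; auto).
    destruct (Req_dec (Phi z) S) as [E|E]; [|lra]. exfalso. apply HN. exists z. split; auto.
    intros w Hw. rewrite E. apply HS1. exists w; auto. }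
  (* If the supremum [S] is not attained, [Phi] stays below it by a local margin, and by compactness
     by a uniform one. *)
  destruct (plane_gauge_choice (fun u d => forall w, K w -> Cmod (w - u) < d -> Phi w <= S - d) B)
    as (d & D & HH).
  - intros z. destruct (classic (K z)) as [Hz|Hz].
    + specialize (lt z Hz). destruct (Hc z Hz ((S - Phi z) / 2)) as (d & D & H); [lra|].
      exists (Rmin d ((S - Phi z) / 2)). split; [apply Rmin_pos; lra|].
      intros w _ Hw. pose proof (Rmin_l d ((S - Phi z) / 2)). pose proof (Rmin_r d ((S - Phi z) / 2)).
      specialize (H w ltac:(lra)). apply Rabs_lt_between in H. lra.
    + destruct (Hcl z Hz) as (d & D & H). exists d. split; auto.
      intros w Hw Hd. exfalso. apply (H w); auto.
  - assert (S <= S - d); [|lra]. apply HS2. intros x (z & Hz & ->).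
    destruct (HH z (HB z Hz)) as (u & e & H1 & H2 & H3). specialize (H1 z Hz H2). lra.
Qed.

(* A maximum of [|F|^2 + delta |z|^2] at an interior point [a] contradicts the mean value property
   of [2 conj(F a) F + 2 delta conj(a) z]. *)
Theorem max_principle (K W : C -> Prop) (F : C -> C) (B M : R) :
  (forall z, K z -> Cmod z <= B) ->
  (forall z, ~ K z -> exists d, 0 < d /\ forall w, Cmod (w - z) < d -> ~ K w) ->
  (forall z, W z -> exists d, 0 < d /\ forall w, Cmod (w - z) < d -> K w) ->
  (forall z, K z -> cdiff F z) ->
  (forall z, K z -> ~ W z -> Cmod (F z) <= M) ->
  forall z, K z -> Cmod (F z) <= M.
Proof.
  intros HB Hcl HW HD HM.
  intros z1 Hz1. destruct (Rle_dec (Cmod (F z1)) M) as [|n]; auto. exfalso.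
  pose proof (Cmod_ge_0 (F z1)).
  set (gap := Cmod (F z1) * Cmod (F z1) - M * M).
  destruct (Rle_lt_dec 0 M) as [HM0|HM0].
  (* With [M < 0] no point of [K] can lie outside [W], so [K] would be open; its rightmost point
     contradicts this. *)
  2: { destruct (plane_max K (fun z => fst z) B) as (a & Ha & Hmax); auto.
       - exists z1; auto.
       - intros z _ eps He. exists eps. split; auto. intros w Hw.
         eapply Rle_lt_trans; [|exact Hw]. apply (fst_le_Cmod (w - z)).
       - destruct (classic (W a)) as [Wa|Wa].
         + destruct (HW a Wa) as (d & D & Hd).
           assert (K (a + RtoC (d / 2))%C).
           { apply Hd. replace (a + RtoC (d / 2) - a)%C with (RtoC (d / 2)) by ring.
             rewrite Cmod_R, Rabs_pos_eq; lra. }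
           specialize (Hmax _ H0). simpl in Hmax. lra.
         + specialize (HM a Ha Wa). pose proof (Cmod_ge_0 (F a)). lra. }
  assert (Hgap : 0 < gap) by (unfold gap; nra).
  pose proof (Cmod_ge_0 z1). pose proof (HB z1 Hz1).
  (* The perturbation adds at most [gap / 2] on [K], so the maximum cannot be at a point with
     [Cmod (F a) <= M]. *)
  set (delta := gap / (2 * (B * B + 1))).
  assert (Hdel : 0 < delta) by (apply Rdiv_lt_0_compat; nra).
  destruct (plane_max K (fun z => Cmod (F z) * Cmod (F z) + delta * (Cmod z * Cmod z)) B)
    as (a & Ha & Hmax); auto.
  { exists z1; auto. }
  { intros z Hz eps He. pose proof (cdiff_cont F z (HD z Hz)) as Cf.
    assert (Cs : forall g, ccont g z -> forall eps, 0 < eps -> exists d, 0 < d /\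
      forall w, Cmod (w - z) < d -> Rabs (Cmod (g w) * Cmod (g w) - Cmod (g z) * Cmod (g z)) < eps).
    { intros g Cg e0 He0. destruct (ccont_mult g g z Cg Cg e0 He0) as (d & D & Hd).
      exists d. split; auto. intros w Hw. specialize (Hd w Hw). rewrite <- !Cmod_mult.
      pose proof (Cmod_sub_lower (g w * g w) (g z * g z)).
      pose proof (Cmod_sub_lower (g z * g z) (g w * g w)). rewrite Cmod_sub_sym in H3.
      apply Rabs_lt_between. lra. }
    destruct (Cs F Cf (eps / 2)) as (d1 & D1 & H1'); [lra|].
    destruct (Cs (fun w => w) (ccont_id z) (eps / (2 * delta))) as (d2 & D2 & H2').
    { apply Rdiv_lt_0_compat; lra. }
    exists (Rmin d1 d2). split; [apply Rmin_pos; auto|]. intros w Hw.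
    pose proof (Rmin_l d1 d2). pose proof (Rmin_r d1 d2).
    specialize (H1' w ltac:(lra)). specialize (H2' w ltac:(lra)).
    apply Rabs_lt_between in H1'. apply Rabs_lt_between in H2'.
    assert (delta * (eps / (2 * delta)) = eps / 2) by (field; lra).
    apply Rabs_lt_between. nra. }
  pose proof (Hmax z1 Hz1) as Hm1. simpl in Hm1.
  assert (Ba : delta * (Cmod a * Cmod a) <= gap / 2).
  { pose proof (HB a Ha). pose proof (Cmod_ge_0 a).
    apply Rle_trans with (delta * (B * B)); [apply Rmult_le_compat_l; nra|].
    assert (E : gap / 2 = delta * (B * B + 1)) by (unfold delta; field; nra).
    rewrite E. nra. }
  destruct (classic (W a)) as [Wa|Wa].
  2: { specialize (HM a Ha Wa). pose proof (Cmod_ge_0 (F a)).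
       assert (Cmod (F a) * Cmod (F a) <= M * M) by nra.
       pose proof (Cmod_ge_0 z1). unfold gap in *. nra. }
  destruct (HW a Wa) as (d & D & Hd).
  (* Expanding the squares around [a] leaves the squared moduli of [F z - F a] and of [z - a], the
     latter with factor [delta]. Both have the favourable sign, and on the circle the latter alone
     gives the loss [kappa]. *)
  apply (re_mean_value (fun z => RtoC 2 * (Cconj (F a) * F z) + RtoC (2 * delta) * (Cconj a * (z + - a)))%C
    a (d / 2) d (delta * (d / 2 * (d / 2)))); [lra| | |].
  { clearbody delta. assert (0 < d / 2) by lra.
    apply Rmult_lt_0_compat; auto. apply Rmult_lt_0_compat; auto. }
  - intros z Hz. apply cdiff_plus; repeat apply cdiff_mult; try apply cdiff_const; auto.
    apply cdiff_plus; [apply cdiff_id|apply cdiff_const].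
  - intros z Hz. assert (Kz : K z) by (apply Hd; lra).
    specialize (Hmax z Kz). simpl in Hmax.
    pose proof (Cmod_sqr (F z)) as S1. pose proof (Cmod_sqr (F a)) as S2.
    pose proof (Cmod_sqr z) as S3. pose proof (Cmod_sqr a) as S4.
    pose proof (Cmod_sqr (z - a)) as S5. rewrite Hz in S5. rewrite S1, S2, S3, S4 in Hmax.
    rewrite S5. simpl.
    set (f1 := fst (F z)) in *. set (f2 := snd (F z)) in *.
    set (g1 := fst (F a)) in *. set (g2 := snd (F a)) in *.
    set (x := fst z) in *. set (y := snd z) in *. set (p := fst a) in *. set (q := snd a) in *.
    pose proof (Rplus_le_le_0_compat _ _ (Rle_0_sqr (f1 - g1)) (Rle_0_sqr (f2 - g2))) as S6.
    unfold Rsqr in S6.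
    clearbody delta f1 f2 g1 g2 x y p q. clear - S6 Hmax.
    match goal with |- ?l <= ?r => cut (0 <= r - l); [lra|] end.
    match type of Hmax with ?l <= ?r =>
      replace (_ - _) with ((r - l) + ((f1 - g1) * (f1 - g1) + (f2 - g2) * (f2 - g2))) by ring end.
    lra.
Qed.

(** * Estimates for Blaschke factors *)

Ltac rpos := repeat match goal with |- 0 < _ * _ => apply Rmult_lt_0_compat end; try lra.

Lemma le_div_of_mul_le a b c : 0 < c -> a * c <= b -> a <= b / c.
Proof. intros Hc H. apply (Rle_div_r a b c Hc). exact H. Qed.

Lemma div_le_of_le_mul a b c : 0 < c -> a <= b * c -> a / c <= b.
Proof. intros Hc H. apply (Rle_div_l a b c Hc). exact H. Qed.

Lemma exp_ge_1_plus x : 1 + x <= exp x.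
Proof. destruct (Req_dec x 0) as [->|H]; [rewrite exp_0; lra|]. left. apply exp_ineq1; auto. Qed.

Lemma exp_le x y : x <= y -> exp x <= exp y.
Proof. intros [H| ->]; [left; apply exp_increasing; auto|lra]. Qed.

(* The logarithm of the left-hand side is twice the Green function of the disk, up to constants:
   [eta] and [delta] are the boundary distance of the pole and the distance to the pole, measured
   in units of the boundary distance of the evaluation point. *)
Lemma green_kernel_bound eta delta S kappa :
  0 < eta -> 0 < delta -> 0 < S -> 0 < kappa <= 1 -> kappa * (S * S) <= 2 * delta ->
  1 - eta <= delta -> 
  1 + 4 * eta / (delta * delta) <= exp (64 * eta / (kappa * kappa * (S * ((1 + S) * (1 + S))))).
Proof.
  intros He Hd HS Hk HkS H1.
  set (s := 4 * eta / (delta * delta)).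
  set (E := 64 * eta / (kappa * kappa * (S * ((1 + S) * (1 + S))))).
  assert (Hkk : 0 < kappa * kappa) by nra.
  assert (Hkk1 : kappa * kappa <= 1) by nra.
  assert (HdS : kappa * kappa * (S * S * (S * S)) <= 4 * (delta * delta)).
  { replace (kappa * kappa * (S * S * (S * S))) with ((kappa * (S * S)) * (kappa * (S * S))) by ring.
    replace (4 * (delta * delta)) with ((2 * delta) * (2 * delta)) by ring.
    assert (0 <= kappa * (S * S)) by nra. nra. }
  assert (Hdd : 0 < delta * delta) by nra.
  assert (HSS : 0 < S * S * (S * S)) by (assert (0 < S * S) by nra; nra).
  assert (Hs : s <= 16 * eta / (kappa * kappa * (S * S * (S * S)))).
  { unfold s. apply div_le_of_le_mul; [nra|].
    replace (16 * eta / (kappa * kappa * (S * S * (S * S))) * (delta * delta))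
      with (4 * eta * (4 * (delta * delta) / (kappa * kappa * (S * S * (S * S))))) by (field; nra).
    assert (1 <= 4 * (delta * delta) / (kappa * kappa * (S * S * (S * S)))).
    { apply le_div_of_mul_le; [apply Rmult_lt_0_compat; auto|]. lra. }
    nra. }
  assert (small : s <= E -> 1 + s <= exp E).
  { intros H. eapply Rle_trans; [apply exp_ge_1_plus|]. apply exp_le; auto. }
  destruct (Rle_lt_dec 1 S) as [S1|S1].
  - apply small. eapply Rle_trans; [exact Hs|]. unfold E.
    apply div_le_of_le_mul; [apply Rmult_lt_0_compat; auto|].
    apply Rle_trans with (16 * eta * (4 * S * S * S / ((1 + S) * (1 + S)))).
    + assert (1 <= 4 * S * S * S / ((1 + S) * (1 + S))); [|nra].
      apply le_div_of_mul_le; [nra|]. assert ((1 + S) * (1 + S) <= 4 * (S * S)) by nra. assert (0 <= (S * S) * (S - 1)) by nra. nra.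
    + right. field. split; nra.
  - assert (HE : 16 * eta / (kappa * kappa * S) <= E).
    { unfold E. apply le_div_of_mul_le; [rpos|].
      replace (16 * eta / (kappa * kappa * S) * (kappa * kappa * (S * ((1 + S) * (1 + S)))))
        with (16 * eta * ((1 + S) * (1 + S))) by (field; lra).
      assert ((1 + S) * (1 + S) <= 4) by nra.
      replace (64 * eta) with (16 * eta * 4) by ring. apply Rmult_le_compat_l; lra. }
    destruct (Rle_lt_dec eta (1 / 2)) as [H2|H2].
    + apply small. eapply Rle_trans; [|exact HE].
      apply Rle_trans with (16 * eta).
      * unfold s. apply div_le_of_le_mul; [nra|]. assert (1 / 2 * (1 / 2) <= delta * delta) by nra. nra.
      * apply le_div_of_mul_le; [nra|]. assert (kappa * kappa * S <= 1) by nra. nra.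
    + assert (Hs0 : 0 <= s) by (unfold s; left; apply Rdiv_lt_0_compat; nra).
      (* The pole may be arbitrarily near. In [S], the bound for [s] is then of order [S ^ -4], but
         the exponent on the right only of order [1 / S]; so the fourth root of [s] is compared, by
         [1 + r ^ 4 <= exp (4 r)]. *)
      set (r := sqrt (sqrt s)).
      assert (Hr0 : 0 <= r) by apply sqrt_pos.
      assert (Hr : r * r * (r * r) = s).
      { unfold r. rewrite sqrt_sqrt by apply sqrt_pos. apply sqrt_sqrt; auto. }
      apply Rle_trans with (exp (4 * r)).
      { replace (4 * r) with ((r + r) + (r + r)) by ring. rewrite !exp_plus.
        pose proof (exp_ge_1_plus r).
        assert (1 + r * r <= exp r * exp r) by nra.
        assert (0 <= r * r) by nra. nra. }
      apply exp_le. eapply Rle_trans; [|exact HE].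
      set (b := 4 * eta / (kappa * kappa * S)).
      replace (16 * eta / (kappa * kappa * S)) with (4 * b) by (unfold b; field; lra).
      assert (Hb : 0 <= b) by (unfold b; left; apply Rdiv_lt_0_compat; nra).
      assert (s <= b * b * (b * b)).
      { eapply Rle_trans; [exact Hs|]. unfold b.
        apply div_le_of_le_mul; [apply Rmult_lt_0_compat; auto|].
        replace (4 * eta / (kappa * kappa * S) * (4 * eta / (kappa * kappa * S)) *
          (4 * eta / (kappa * kappa * S) * (4 * eta / (kappa * kappa * S))) *
          (kappa * kappa * (S * S * (S * S))))
          with (16 * eta * (16 * (eta * eta * eta)) / ((kappa * kappa) * (kappa * kappa) * (kappa * kappa)))
          by (field; lra).
        assert (K3 : 0 < (kappa * kappa) * (kappa * kappa) * (kappa * kappa))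
          by (rpos).
        assert (K4 : (kappa * kappa) * (kappa * kappa) * (kappa * kappa) <= 1).
        { assert ((kappa * kappa) * (kappa * kappa) <= 1) by nra. nra. }
        apply le_div_of_mul_le; auto.
        assert (1 / 4 <= eta * eta) by nra. assert (1 / 8 <= eta * eta * eta) by nra.
        assert ((kappa * kappa) * (kappa * kappa) * (kappa * kappa) <= 16 * (eta * eta * eta)) by lra.
        apply Rmult_le_compat_l; [lra|]. exact H3. }
      assert (r <= b); [|lra]. apply Rnot_lt_le. intros Hlt.
      assert (b * b < r * r) by nra. nra.
Qed.

(** The odd primitive of the kernel [1 / (S (1 + S) ^ 2)] of [green_kernel_bound], with [S] the
    square root of [|x|]. The kernel is integrable at 0 and at infinity, so the primitive is
    bounded, and sums of its increments over consecutive intervals are bounded whatever their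
    number. *)
Definition odd_profile (x : R) : R :=
  if Rle_dec 0 x then 2 * sqrt x / (1 + sqrt x) else - (2 * sqrt (- x) / (1 + sqrt (- x))).

Lemma profile_bounds s : 0 <= s -> 0 <= 2 * s / (1 + s) <= 2.
Proof.
  intros Hs. split.
  - apply le_div_of_mul_le; lra.
  - apply div_le_of_le_mul; lra.
Qed.

Lemma odd_profile_bounds x : -2 <= odd_profile x <= 2.
Proof.
  unfold odd_profile. destruct (Rle_dec 0 x).
  - pose proof (profile_bounds (sqrt x) (sqrt_pos x)). lra.
  - pose proof (profile_bounds (sqrt (- x)) (sqrt_pos (- x))). lra.
Qed.

Lemma profile_incr s1 s2 : 0 <= s1 <= s2 -> 0 < s2 ->
  (s2 * s2 - s1 * s1) / (2 * (s2 * ((1 + s2) * (1 + s2)))) <= 2 * s2 / (1 + s2) - 2 * s1 / (1 + s1).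
Proof.
  intros H H2.
  replace (2 * s2 / (1 + s2) - 2 * s1 / (1 + s1)) with (2 * (s2 - s1) / ((1 + s1) * (1 + s2)))
    by (field; lra).
  assert (0 < s2 * ((1 + s2) * (1 + s2))) by (apply Rmult_lt_0_compat; nra).
  apply div_le_of_le_mul; [lra|].
  replace (2 * (s2 - s1) / ((1 + s1) * (1 + s2)) * (2 * (s2 * ((1 + s2) * (1 + s2)))))
    with ((s2 - s1) * (4 * s2) * ((1 + s2) / (1 + s1))) by (field; lra).
  replace (s2 * s2 - s1 * s1) with ((s2 - s1) * (s2 + s1) * 1) by ring.
  apply Rmult_le_compat; try nra.
  apply le_div_of_mul_le; lra.
Qed.

(** The kernel decreases in [|x|], so an increment is at least the length of the interval times the
    kernel at the endpoint of larger modulus. The 2 in the denominator pays for intervals around 0: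
    one half of such an interval reaches [m], and [b - a] is at most [2 m]. *)
Lemma odd_profile_incr a b m : a < b -> m = Rmax (Rabs a) (Rabs b) ->
  0 < sqrt m /\
  (b - a) / (2 * (sqrt m * ((1 + sqrt m) * (1 + sqrt m)))) <= odd_profile b - odd_profile a.
Proof.
  intros Hab Hm.
  assert (Ha := Rmax_l (Rabs a) (Rabs b)). assert (Hb := Rmax_r (Rabs a) (Rabs b)).
  rewrite <- Hm in Ha, Hb.
  apply Rabs_le_between in Ha. apply Rabs_le_between in Hb.
  assert (Hm0 : 0 < m) by (destruct (Rle_lt_dec m 0); [exfalso; lra|auto]).
  assert (HS : 0 < sqrt m) by (apply sqrt_lt_R0; auto).
  split; auto.
  assert (Em : sqrt m * sqrt m = m) by (apply sqrt_sqrt; lra).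
  unfold odd_profile. destruct (Rle_dec 0 a) as [a0|a0]; destruct (Rle_dec 0 b) as [b0|b0]; try lra.
  - assert (m = b). { rewrite Hm, !Rabs_pos_eq by lra. apply Rmax_right. lra. }
    clear Hm. subst m. rewrite <- Em at 1. rewrite <- (sqrt_sqrt a a0) at 1.
    apply profile_incr; auto. split; [apply sqrt_pos|apply sqrt_le_1; lra].
  - pose proof (profile_bounds (sqrt b) (sqrt_pos b)).
    pose proof (profile_bounds (sqrt (- a)) (sqrt_pos (- a))).
    assert (Hmm : 2 * sqrt m / (1 + sqrt m) <= 
      2 * sqrt b / (1 + sqrt b) - - (2 * sqrt (- a) / (1 + sqrt (- a)))).
    { assert (E : m = b \/ m = - a).
      { rewrite Hm. rewrite (Rabs_pos_eq b), (Rabs_left a) by lra. unfold Rmax.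
        destruct (Rle_dec _ _); auto. }
      destruct E as [-> | ->]; lra. }
    eapply Rle_trans; [|exact Hmm].
    apply div_le_of_le_mul. { rpos. }
    replace (2 * sqrt m / (1 + sqrt m) * (2 * (sqrt m * ((1 + sqrt m) * (1 + sqrt m)))))
      with (4 * (sqrt m * sqrt m) * (1 + sqrt m)) by (field; lra).
    rewrite Em. nra.
  - assert (m = - a). { rewrite Hm, !Rabs_left by lra. apply Rmax_left. lra. }
    clear Hm. subst m. 
    replace (b - a) with (sqrt (- a) * sqrt (- a) - sqrt (- b) * sqrt (- b))
      by (rewrite !sqrt_sqrt by lra; ring).
    replace (- (2 * sqrt (- b) / (1 + sqrt (- b))) - - (2 * sqrt (- a) / (1 + sqrt (- a))))
      with (2 * sqrt (- a) / (1 + sqrt (- a)) - 2 * sqrt (- b) / (1 + sqrt (- b))) by ring.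
    apply profile_incr; auto. split; [apply sqrt_pos|apply sqrt_le_1; lra].
Qed.

(** The reciprocal of a Blaschke factor: the logarithm of its modulus is the Green function of the
    disk with pole [zeta]. *)
Definition binv (zeta z : C) : C := ((1 - Cconj zeta * z) / (z - zeta))%C.

Lemma Csub_neq_0 (z w : C) : 0 < Cmod (z - w) -> (z - w)%C <> 0.
Proof. intros H. apply Cmod_gt_0; auto. Qed.

Lemma binv_sqr zeta z : 0 < Cmod (z - zeta) ->
  Cmod (binv zeta z) * Cmod (binv zeta z) =
  1 + (1 - Cmod z * Cmod z) * (1 - Cmod zeta * Cmod zeta) / (Cmod (z - zeta) * Cmod (z - zeta)).
Proof.
  intros H. unfold binv. rewrite Cmod_div by (apply Csub_neq_0; auto).
  assert (E : Cmod (1 - Cconj zeta * z) * Cmod (1 - Cconj zeta * z) =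
    Cmod (z - zeta) * Cmod (z - zeta) + (1 - Cmod z * Cmod z) * (1 - Cmod zeta * Cmod zeta)).
  { rewrite !Cmod_sqr. simpl. ring. }
  transitivity ((Cmod (1 - Cconj zeta * z) * Cmod (1 - Cconj zeta * z)) /
     (Cmod (z - zeta) * Cmod (z - zeta))); [field; lra|]. rewrite E. field. lra.
Qed.

(** The exponent is an increment over the step from [t] to [t + tau * (1 - Cmod zeta)], hence
    telescopes over poles whose parameters follow one another by such steps. [P] is the parameter of
    [z]. The two lower bounds on [Cmod (z - zeta)] control the distance from [P] to both ends of the
    step. *)
Lemma binv_upper zeta z P t kappa tau :
  Cmod z < 1 -> Cmod zeta < 1 -> 0 < kappa <= 1 -> 0 < tau ->
  kappa * Rabs (P - t) <= Cmod (z - zeta) -> tau * (1 - Cmod zeta) <= Cmod (z - zeta) ->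
  Cmod (binv zeta z) * Cmod (binv zeta z) <=
  exp (128 / (kappa * kappa) / tau *
    (odd_profile ((t + tau * (1 - Cmod zeta) - P) / (1 - Cmod z)) - odd_profile ((t - P) / (1 - Cmod z)))).
Proof.
  intros Hz Hzeta Hk Ht H1 H2.
  pose proof (Cmod_ge_0 z). pose proof (Cmod_ge_0 zeta).
  set (y := 1 - Cmod z) in *. set (h := 1 - Cmod zeta) in *. set (D := Cmod (z - zeta)) in *.
  assert (Hy : 0 < y) by (unfold y; lra). assert (Hh : 0 < h) by (unfold h; lra).
  assert (Hth : 0 < tau * h) by (apply Rmult_lt_0_compat; auto).
  assert (HD : 0 < D) by lra.
  rewrite binv_sqr by auto. fold D.
  set (a := (t - P) / y). set (b := (t + tau * h - P) / y).
  set (m := Rmax (Rabs a) (Rabs b)).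
  assert (Eab : b - a = tau * h / y) by (unfold a, b; field; lra).
  assert (Hab : a < b) by (assert (0 < tau * h / y) by (apply Rdiv_lt_0_compat; auto); lra).
  destruct (odd_profile_incr a b m Hab eq_refl) as [HS HI].
  assert (Ya : Rabs a * y = Rabs (P - t)).
  { unfold a. rewrite Rabs_div by lra. rewrite (Rabs_pos_eq y) by lra. rewrite Rabs_minus_sym. field. lra. }
  assert (Yb : Rabs b * y <= Rabs (P - t) + tau * h).
  { unfold b. rewrite Rabs_div by lra. rewrite (Rabs_pos_eq y) by lra.
    replace (Rabs (t + tau * h - P) / y * y) with (Rabs (t + tau * h - P)) by (field; lra).
    replace (t + tau * h - P) with (- (P - t) + tau * h) by ring.
    eapply Rle_trans; [apply Rabs_triang|]. rewrite Rabs_Ropp, (Rabs_pos_eq (tau * h)); lra. }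
  assert (Hm0 : 0 <= m).
  { unfold m. eapply Rle_trans; [apply (Rabs_pos a)|apply Rmax_l]. }
  assert (Hm : kappa * (sqrt m * sqrt m) <= 2 * (D / y)).
  { rewrite sqrt_sqrt by auto.
    replace (2 * (D / y)) with ((2 * D) / y) by (field; lra).
    apply le_div_of_mul_le; auto. rewrite Rmult_assoc.
    assert (m * y <= Rabs (P - t) + tau * h).
    { unfold m, Rmax. destruct (Rle_dec _ _); lra. }
    nra. }
  assert (HDy : y - h <= D).
  { unfold y, h, D. pose proof (Cmod_sub_lower zeta z). rewrite Cmod_sub_sym in H3. lra. }
  eapply Rle_trans.
  2: { eapply Rle_trans; [apply (green_kernel_bound (h / y) (D / y) (sqrt m) kappa)|]; auto.
       - apply Rdiv_lt_0_compat; auto.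
       - apply Rdiv_lt_0_compat; auto.
       - replace 1 with (y / y) by (field; lra). unfold Rdiv. rewrite <- Rmult_minus_distr_r.
         apply Rmult_le_compat_r; auto. left; apply Rinv_0_lt_compat; auto.
       - apply exp_le. fold a b.
         apply Rle_trans with (128 / (kappa * kappa) / tau *
           ((b - a) / (2 * (sqrt m * ((1 + sqrt m) * (1 + sqrt m)))))).
         + right. rewrite Eab. field. repeat split; lra.
         + apply Rmult_le_compat_l; auto. apply Rlt_le, Rdiv_lt_0_compat; auto.
           apply Rdiv_lt_0_compat; nra. }
  apply Rplus_le_compat_l.
  replace (4 * (h / y) / (D / y * (D / y))) with (4 * y * h / (D * D)) by (field; lra).
  unfold Rdiv. apply Rmult_le_compat_r. { left. apply Rinv_0_lt_compat. nra. }
  replace (1 - Cmod z * Cmod z) with (y * (1 + Cmod z)) by (unfold y; ring).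
  replace (1 - Cmod zeta * Cmod zeta) with (h * (1 + Cmod zeta)) by (unfold h; ring).
  assert (0 < y * h) by nra.
  assert ((1 + Cmod z) * (1 + Cmod zeta) <= 4) by (unfold y, h in *; nra).
  replace (y * (1 + Cmod z) * (h * (1 + Cmod zeta))) with (y * h * ((1 + Cmod z) * (1 + Cmod zeta))) by ring.
  nra.
Qed.

(** From [exp (x / (1 + x)) <= 1 + x], where [x] is bounded because the pole is at most [1 + C1]
    times as deep in the disk as [z]. The exponent is linear in [1 - Cmod zeta], so it telescopes
    over the same steps as the upper bound. *)
Lemma binv_lower zeta z C1 :
  Cmod z < 1 -> Cmod zeta < 1 -> 0 < C1 -> 0 < Cmod (z - zeta) ->
  Cmod (zeta - z) <= C1 * (1 - Cmod z) ->
  exp ((1 - Cmod zeta) / (1 - Cmod z) / (C1 * C1 + C1 + 1)) <= Cmod (binv zeta z) * Cmod (binv zeta z).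
Proof.
  intros Hz Hzeta HC HD HCD.
  pose proof (Cmod_ge_0 z). pose proof (Cmod_ge_0 zeta).
  rewrite binv_sqr by auto. rewrite (Cmod_sub_sym zeta z) in HCD.
  set (D := Cmod (z - zeta)) in *. set (y := 1 - Cmod z) in *. set (h := 1 - Cmod zeta) in *.
  assert (Hy : 0 < y) by (unfold y; lra). assert (Hh : 0 < h) by (unfold h; lra).
  assert (Hhy : h <= (1 + C1) * y).
  { pose proof (Cmod_sub_lower z zeta). fold D in H1. unfold y, h in *. lra. }
  set (x := h / y / (C1 * C1)).
  assert (Hx : 0 < x).
  { unfold x. apply Rdiv_lt_0_compat; [apply Rdiv_lt_0_compat; auto|nra]. }
  apply Rle_trans with (1 + x).
  - apply Rle_trans with (exp (x / (1 + x))).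
    + apply exp_le. apply div_le_of_le_mul; [nra|].
      assert (E : x * (C1 * C1) = h / y) by (unfold x; field; split; nra).
      rewrite <- E.
      replace (x / (1 + x) * (C1 * C1 + C1 + 1)) with (x * ((C1 * C1 + C1 + 1) / (1 + x))) by (field; lra).
      apply Rmult_le_compat_l; [lra|]. apply le_div_of_mul_le; [lra|].
      assert (x * (C1 * C1) <= 1 + C1). { rewrite E. apply div_le_of_le_mul; lra. }
      lra.
    + apply (Rmult_le_reg_r (exp (- (x / (1 + x))))); [apply exp_pos|].
      rewrite <- exp_plus, Rplus_opp_r, exp_0.
      pose proof (exp_ge_1_plus (- (x / (1 + x)))) as H2.
      apply Rle_trans with ((1 + x) * (1 + - (x / (1 + x)))).
      * right. field. lra.
      * apply Rmult_le_compat_l; lra.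
  - apply Rplus_le_compat_l. unfold x.
    replace (1 - Cmod z * Cmod z) with (y * (1 + Cmod z)) by (unfold y; ring).
    replace (1 - Cmod zeta * Cmod zeta) with (h * (1 + Cmod zeta)) by (unfold h; ring).
    apply le_div_of_mul_le; [nra|].
    assert (DD : D * D <= C1 * C1 * (y * y)) by nra.
    apply Rle_trans with (h / y / (C1 * C1) * (C1 * C1 * (y * y))).
    + apply Rmult_le_compat_l; auto. left. exact Hx.
    + replace (h / y / (C1 * C1) * (C1 * C1 * (y * y))) with (h * y) by (field; split; nra).
      assert (0 < h * y) by nra.
      assert (1 <= (1 + Cmod z) * (1 + Cmod zeta)) by (clear - H H0; nra).
      replace (y * (1 + Cmod z) * (h * (1 + Cmod zeta)))
        with (h * y * ((1 + Cmod z) * (1 + Cmod zeta))) by ring.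
      rewrite <- (Rmult_1_r (h * y)) at 1. apply Rmult_le_compat_l; lra.
Qed.

Fixpoint cprod (g : nat -> C) (n : nat) : C :=
  match n with O => RtoC 1 | S k => (cprod g k * g k)%C end.

Lemma cprod_upper (g : nat -> C) (e : nat -> R) n :
  (forall i, (i < n)%nat -> Cmod (g i) * Cmod (g i) <= exp (e (S i) - e i)) ->
  Cmod (cprod g n) * Cmod (cprod g n) <= exp (e n - e O).
Proof.
  induction n as [|n IH]; intros H; simpl.
  - rewrite Cmod_1. replace (e O - e O) with 0 by ring. rewrite exp_0. lra.
  - rewrite Cmod_mult.
    replace (e (S n) - e O) with ((e n - e O) + (e (S n) - e n)) by ring. rewrite exp_plus.
    replace (Cmod (cprod g n) * Cmod (g n) * (Cmod (cprod g n) * Cmod (g n)))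
      with ((Cmod (cprod g n) * Cmod (cprod g n)) * (Cmod (g n) * Cmod (g n))) by ring.
    apply Rmult_le_compat; try apply Rmult_le_pos; try apply Cmod_ge_0; [apply IH|apply H]; auto.
Qed.

Lemma cprod_lower (g : nat -> C) (e : nat -> R) n :
  (forall i, (i < n)%nat -> exp (e (S i) - e i) <= Cmod (g i) * Cmod (g i)) ->
  exp (e n - e O) <= Cmod (cprod g n) * Cmod (cprod g n).
Proof.
  induction n as [|n IH]; intros H; simpl.
  - rewrite Cmod_1. replace (e O - e O) with 0 by ring. rewrite exp_0. lra.
  - rewrite Cmod_mult.
    replace (e (S n) - e O) with ((e n - e O) + (e (S n) - e n)) by ring. rewrite exp_plus.
    replace (Cmod (cprod g n) * Cmod (g n) * (Cmod (cprod g n) * Cmod (g n)))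
      with ((Cmod (cprod g n) * Cmod (cprod g n)) * (Cmod (g n) * Cmod (g n))) by ring.
    apply Rmult_le_compat; try (left; apply exp_pos); [apply IH|apply H]; auto.
Qed.

Lemma cdiff_cprod (g : nat -> C -> C) n z : (forall i, (i < n)%nat -> cdiff (g i) z) ->
  cdiff (fun w => cprod (fun i => g i w) n) z.
Proof.
  induction n as [|n IH]; intros H; simpl.
  - apply cdiff_const.
  - apply cdiff_mult; auto.
Qed.

Lemma cdiff_binv zeta z : 0 < Cmod (z - zeta) -> cdiff (binv zeta) z.
Proof.
  intros H. unfold binv, Cdiv. apply cdiff_mult.
  - apply (cdiff_plus (fun _ => RtoC 1) (fun w => - (Cconj zeta * w))%C); [apply cdiff_const|].
    apply (cdiff_ext_loc (fun w => (- Cconj zeta) * w)%C _ z 1); [lra|intros; ring|].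
    apply cdiff_mult; [apply cdiff_const|apply cdiff_id].
  - apply (cdiff_inv (fun w => (w - zeta)%C)); [apply Csub_neq_0; auto|].
    apply (cdiff_plus (fun w => w) (fun _ => - zeta)%C); [apply cdiff_id|apply cdiff_const].
Qed.

Lemma finite_min (g : nat -> R) n : (forall i, (i < n)%nat -> 0 < g i) ->
  exists d, 0 < d /\ forall i, (i < n)%nat -> d <= g i.
Proof.
  induction n as [|n IH]; intros H.
  - exists 1. split; [lra|]. intros i Hi. lia.
  - destruct IH as (d & D & Hd); [auto|]. exists (Rmin d (g n)). split.
    + apply Rmin_pos; auto.
    + intros i Hi. destruct (Nat.eq_dec i n) as [->|Hn]; [apply Rmin_r|].
      eapply Rle_trans; [apply Rmin_l|]. apply Hd. lia.
Qed.

Lemma disk_unif_cont (f : C -> C) (r eps : R) : r < 1 -> 0 < eps ->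
  (forall z, Cmod z < 1 -> ccont f z) ->
  exists rho, 0 < rho /\ forall z w, Cmod z <= r -> Cmod (w - z) < rho -> Cmod (f w - f z) < eps.
Proof.
  intros Hr He Hc.
  destruct (plane_gauge_choice (fun u d => forall z, Cmod z <= r -> Cmod (z - u) < d ->
    forall w, Cmod (w - z) < d -> Cmod (f w - f z) < eps) r) as (d & D & HH).
  - intros u. destruct (Rlt_dec (Cmod u) 1) as [Hu|Hu].
    + destruct (Hc u Hu (eps / 2)) as (d & D & H); [lra|].
      exists (d / 2). split; [lra|]. intros z _ Hz w Hw.
      pose proof (Cmod_sub_trans w z u). pose proof (H z ltac:(lra)). pose proof (H w ltac:(lra)).
      pose proof (Cmod_sub_trans (f w) (f u) (f z)). rewrite (Cmod_sub_sym (f u)) in H3. lra.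
    + exists (1 - r). split; [lra|]. intros z Hz Hzu. exfalso.
      pose proof (Cmod_sub_lower u z). rewrite Cmod_sub_sym in H. lra.
  - exists d. split; auto. intros z w Hz Hw.
    destruct (HH z Hz) as (u & e & H1 & H2 & H3). apply (H1 z); auto. lra.
Qed.

(** * Hall's lemma *)

Lemma least_nat (P : nat -> Prop) : (exists n, P n) -> exists n, P n /\ forall i, (i < n)%nat -> ~ P i.
Proof.
  intros [n Hn]. revert Hn. induction n as [n IH] using (well_founded_induction Wf_nat.lt_wf). intros Hn.
  destruct (classic (exists i, (i < n)%nat /\ P i)) as [(i & Hi & Pi)|H].
  - apply (IH i); auto.
  - exists n. split; auto. intros i Hi Pi. apply H. exists i; auto.
Qed.

(** The step is [tau] times the boundary distance of the point just chosen: the step for which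
    [binv_upper] telescopes, and also the radius of the disk to be removed around that point. The
    depth [hm] bounds the steps from below, so [B] is passed after finitely many. *)
Lemma greedy_points (G : R -> C -> Prop) (A B tau hm : R) :
  0 < tau -> 0 < hm -> A <= B ->
  (forall t, A <= t <= B -> exists zeta, G t zeta /\ Cmod zeta <= 1 - hm) ->
  exists (n : nat) (T : nat -> R) (Z : nat -> C), T O = A /\ B < T n /\
    forall i, (i < n)%nat -> A <= T i <= B /\ G (T i) (Z i) /\ Cmod (Z i) <= 1 - hm /\
      T (S i) = T i + tau * (1 - Cmod (Z i)).
Proof.
  intros Ht Hh HAB H.
  set (pick := fun t => epsilon (inhabits (RtoC 0)) (fun zeta => G t zeta /\ Cmod zeta <= 1 - hm)).
  assert (Hp : forall t, A <= t <= B -> G t (pick t) /\ Cmod (pick t) <= 1 - hm).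
  { intros t Htt. unfold pick. apply epsilon_spec. auto. }
  set (T := fix T (i : nat) : R := match i with O => A | S k => T k + tau * (1 - Cmod (pick (T k))) end).
  assert (Ex : exists n, B < T n).
  { apply NNPP. intros HN.
    assert (le : forall n, T n <= B).
    { intros n. apply Rnot_lt_le. intros Hl. apply HN. exists n; auto. }
    assert (ge : forall n, A + INR n * (tau * hm) <= T n).
    { induction n as [|n IH]; [simpl; lra|]. rewrite S_INR.
      change (T (S n)) with (T n + tau * (1 - Cmod (pick (T n)))).
      assert (A <= T n). { pose proof (pos_INR n). assert (0 < tau * hm) by rpos. nra. }
      destruct (Hp (T n)) as [_ Hc]; [split; auto|]. nra. }
    assert (Hth : 0 < tau * hm) by rpos.
    destruct (archimed ((B - A) / (tau * hm))) as [Ha _].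
    assert (Hpos : 0 <= (B - A) / (tau * hm)) by (apply le_div_of_mul_le; lra).
    set (k := Z.to_nat (up ((B - A) / (tau * hm)))).
    assert (Hk : (B - A) / (tau * hm) < INR k).
    { unfold k. rewrite INR_IZR_INZ, Z2Nat.id; auto. apply le_IZR. lra. }
    specialize (ge k). specialize (le k).
    assert (B - A < INR k * (tau * hm)).
    { replace (B - A) with ((B - A) / (tau * hm) * (tau * hm)) by (field; lra).
      apply Rmult_lt_compat_r; auto. }
    lra. }
  destruct (least_nat _ Ex) as (n & Hn & Hlt).
  exists n, T, (fun i => pick (T i)). split; [reflexivity|]. split; auto.
  assert (lo : forall i, (i <= n)%nat -> A <= T i).
  { induction i as [|i IH]; intros Hi; [simpl; lra|].
    assert (T i <= B) by (apply Rnot_lt_le, Hlt; lia).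
    destruct (Hp (T i)) as [_ Hc]; [split; auto; apply IH; lia|].
    specialize (IH ltac:(lia)).
    change (T (S i)) with (T i + tau * (1 - Cmod (pick (T i)))). nra. }
  intros i Hi.
  assert (Hr : A <= T i <= B) by (split; [apply lo; lia|apply Rnot_lt_le, Hlt; lia]).
  destruct (Hp (T i) Hr). repeat split; auto; lra.
Qed.

Lemma pow_le_1 (x : R) (n : nat) : 0 <= x <= 1 -> 0 <= x ^ n <= 1.
Proof. intros H. induction n as [|n IH]; simpl; [lra|]. nra. Qed.

Lemma pow_exp (x : R) (n : nat) : exp x ^ n = exp (INR n * x).
Proof.
  induction n as [|n IH]; [simpl; rewrite Rmult_0_l, exp_0; auto|].
  rewrite S_INR. simpl. rewrite IH, <- exp_plus. f_equal. ring.
Qed.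

Lemma pow_lt_pow (a b : R) (n : nat) : 0 <= a < b -> (0 < n)%nat -> a ^ n < b ^ n.
Proof.
  intros Hab Hn. destruct n as [|n]; [lia|]. simpl.
  assert (a ^ n <= b ^ n) by (apply pow_incr; lra).
  assert (0 < b ^ n) by (apply pow_lt; lra). assert (0 <= a ^ n) by (apply pow_le; lra). nra.
Qed.

Lemma le_1_of_le_exp (Q : R) : (forall nu, 0 < nu -> Q <= exp nu) -> Q <= 1.
Proof.
  intros H. apply Rnot_lt_le. intros HQ.
  assert (0 < ln Q) by (rewrite <- ln_1; apply ln_increasing; lra).
  specialize (H (ln Q / 2) ltac:(lra)).
  assert (exp (ln Q / 2) < exp (ln Q)) by (apply exp_increasing; lra).
  rewrite exp_ln in H1 by lra. lra.
Qed.

(* The comparison function [f ^ N * prod (binv zeta_i)]: outside the small disks around the points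
   [zeta_i] the product is at most [exp] of a bounded multiple of [1 / tau], inside them [f] is
   small, and near the unit circle all factors of the product are close to [1]. *)
Lemma blaschke_comparison (f : C -> C) (Z : nat -> C) (rho : nat -> R) (n N : nat) (hm Q : R) (z0 : C) :
  (forall z, Cmod z < 1 -> cdiff f z) -> (forall z, Cmod z < 1 -> Cmod (f z) <= 1) ->
  0 < hm -> (forall i, (i < n)%nat -> Cmod (Z i) <= 1 - hm /\ 0 < rho i) ->
  (forall z, Cmod z < 1 -> (forall i, (i < n)%nat -> rho i <= Cmod (z - Z i)) ->
     Cmod (cprod (fun i => binv (Z i) z) n) * Cmod (cprod (fun i => binv (Z i) z) n) <= Q) ->
  (forall z i, (i < n)%nat -> Cmod z < 1 -> Cmod (z - Z i) <= rho i ->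
     Cmod (f z) ^ N * Cmod (f z) ^ N * Q <= 1) ->
  Cmod z0 < 1 -> (forall i, (i < n)%nat -> rho i <= Cmod (z0 - Z i)) ->
  Cmod (f z0) ^ N * Cmod (f z0) ^ N *
  (Cmod (cprod (fun i => binv (Z i) z0) n) * Cmod (cprod (fun i => binv (Z i) z0) n)) <= 1.
Proof.
  intros HD Hb Hhm HZ HQ Hf Hz0 Hout.
  set (F := fun z => (f z ^ N * cprod (fun i => binv (Z i) z) n)%C).
  assert (EF : forall z, Cmod (F z) * Cmod (F z) = Cmod (f z) ^ N * Cmod (f z) ^ N *
    (Cmod (cprod (fun i => binv (Z i) z) n) * Cmod (cprod (fun i => binv (Z i) z) n))).
  { intros z. unfold F. rewrite Cmod_mult, Cmod_pow. ring. }
  rewrite <- EF. apply le_1_of_le_exp. intros nu Hnu.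
  assert (Hn1 : 0 < INR n + 1) by (pose proof (pos_INR n); lra).
  (* The circle of radius [1 - x] has to enclose the poles and [z0], and to be so close to the unit
     circle that the squared modulus of the product of all [n] factors is at most [exp nu] on it. *)
  set (x := Rmin (hm / 2) (Rmin ((1 - Cmod z0) / 2) (nu * (hm * hm) / (8 * (INR n + 1))))).
  assert (Hx0 : 0 < x).
  { unfold x. repeat apply Rmin_pos; try lra. apply Rdiv_lt_0_compat; [|lra]. rpos. }
  assert (Hx1 : x <= hm / 2) by apply Rmin_l.
  assert (Hx2 : x <= (1 - Cmod z0) / 2).
  { unfold x. eapply Rle_trans; [apply Rmin_r|apply Rmin_l]. }
  assert (Hx3 : x <= nu * (hm * hm) / (8 * (INR n + 1))).
  { unfold x. eapply Rle_trans; [apply Rmin_r|apply Rmin_r]. }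
  set (r := 1 - x).
  set (K := fun z => Cmod z <= r /\ forall i, (i < n)%nat -> rho i <= Cmod (z - Z i)).
  set (W := fun z => Cmod z < r /\ forall i, (i < n)%nat -> rho i < Cmod (z - Z i)).
  assert (Hfin : Cmod (F z0) <= exp (nu / 2)).
  { apply (max_principle K W F r (exp (nu / 2))).
    - intros z [Hz _]; auto.
    - intros z Hz. destruct (Rle_lt_dec (Cmod z) r) as [H1|H1].
      + assert (Hi : exists i, (i < n)%nat /\ Cmod (z - Z i) < rho i).
        { apply NNPP. intros HN. apply Hz. split; auto. intros i Hi.
          apply Rnot_lt_le. intros Hl. apply HN. exists i; auto. }
        destruct Hi as (i & Hi & Hl). exists (rho i - Cmod (z - Z i)). split; [lra|].
        intros w Hw [_ Hk]. specialize (Hk i Hi).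
        pose proof (Cmod_sub_trans w z (Z i)). lra.
      + exists (Cmod z - r). split; [lra|]. intros w Hw [Hk _].
        pose proof (Cmod_sub_lower z w). rewrite Cmod_sub_sym in H. lra.
    - intros z [Hz1 Hz2].
      destruct (finite_min (fun i => Cmod (z - Z i) - rho i) n) as (d & D & Hd).
      { intros i Hi. specialize (Hz2 i Hi). lra. }
      exists (Rmin d (r - Cmod z)). split; [apply Rmin_pos; lra|].
      intros w Hw. pose proof (Rmin_l d (r - Cmod z)). pose proof (Rmin_r d (r - Cmod z)). split.
      + pose proof (Cmod_sub_lower w z). lra.
      + intros i Hi. specialize (Hd i Hi). simpl in Hd.
        pose proof (Cmod_sub_trans z w (Z i)). rewrite (Cmod_sub_sym z w) in H1. lra.
    - intros z [Hz1 Hz2]. unfold F. apply cdiff_mult.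
      + apply cdiff_pow, HD. unfold r in Hz1. lra.
      + apply (cdiff_cprod (fun i => binv (Z i))). intros i Hi. apply cdiff_binv.
        specialize (Hz2 i Hi). destruct (HZ i Hi). lra.
    - intros z [Hz1 Hz2] HnW.
      assert (Hz : Cmod z < 1) by (unfold r in Hz1; lra).
      assert (S : Cmod (F z) * Cmod (F z) <= exp (nu / 2) * exp (nu / 2)).
      2: { pose proof (Cmod_ge_0 (F z)). pose proof (exp_pos (nu / 2)).
           apply Rnot_lt_le. intros Hl. nra. }
      rewrite <- exp_plus. replace (nu / 2 + nu / 2) with nu by field. rewrite EF.
      assert (P0 : forall c : C, 0 <= Cmod c * Cmod c) by (intros c; pose proof (Cmod_ge_0 c); nra).
      assert (F0 := Cmod_ge_0 (f z)).
      destruct (Rlt_dec (Cmod z) r) as [Hlt|Hge].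
      + assert (Hi : exists i, (i < n)%nat /\ Cmod (z - Z i) <= rho i).
        { apply NNPP. intros HN. apply HnW. split; auto. intros i Hi.
          apply Rnot_le_lt. intros Hl. apply HN. exists i; auto. }
        destruct Hi as (i & Hi & Hl).
        eapply Rle_trans; [apply Rmult_le_compat_l; [|apply HQ; auto]|].
        { apply Rmult_le_pos; apply pow_le; auto. }
        eapply Rle_trans; [apply (Hf z i); auto|].
        rewrite <- exp_0. apply exp_le. lra.
      + assert (Er : Cmod z = r) by lra.
        assert (G : forall i, (i < n)%nat -> Cmod (binv (Z i) z) * Cmod (binv (Z i) z) <=
          exp (INR (S i) * (8 * x / (hm * hm)) - INR i * (8 * x / (hm * hm)))).
        { intros i Hi. destruct (HZ i Hi) as [Hzi _].
          pose proof (Cmod_sub_lower z (Z i)) as L. rewrite Er in L. unfold r in L.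
          pose proof (Cmod_ge_0 (Z i)). pose proof (Cmod_ge_0 z).
          rewrite binv_sqr by lra. rewrite S_INR.
          eapply Rle_trans; [|apply exp_ge_1_plus].
          apply Rplus_le_compat_l.
          replace ((INR i + 1) * (8 * x / (hm * hm)) - INR i * (8 * x / (hm * hm)))
            with (8 * x / (hm * hm)) by ring.
          set (D := Cmod (z - Z i)) in *. assert (HD2 : hm / 2 <= D) by lra.
          assert (HDD : hm * hm / 4 <= D * D) by nra.
          assert (Hm2 : 0 < hm * hm) by rpos.
          apply div_le_of_le_mul; [nra|].
          apply Rle_trans with (2 * x).
          - rewrite Er. unfold r. assert (0 <= 1 - Cmod (Z i) * Cmod (Z i) <= 1) by nra. 
            assert (0 <= 1 - (1 - x) * (1 - x) <= 2 * x) by (unfold r in Er; nra). nra.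
          - apply Rle_trans with (8 * x / (hm * hm) * (hm * hm / 4)); [right; field; lra|].
            apply Rmult_le_compat_l; auto. left. apply Rdiv_lt_0_compat; lra. }
        apply (cprod_upper (fun i => binv (Z i) z) (fun i => INR i * (8 * x / (hm * hm)))) in G.
        assert (Hp : 0 <= Cmod (f z) ^ N * Cmod (f z) ^ N <= 1).
        { pose proof (pow_le_1 (Cmod (f z)) N (conj F0 (Hb z Hz))). nra. }
        apply Rle_trans with (1 * exp (INR n * (8 * x / (hm * hm)) - INR 0 * (8 * x / (hm * hm)))).
        { apply Rmult_le_compat; try apply P0; auto; lra. }
        rewrite Rmult_1_l. apply exp_le. simpl (INR 0).
        assert (Hm2 : 0 < hm * hm) by rpos.
        replace (INR n * (8 * x / (hm * hm)) - 0 * (8 * x / (hm * hm))) with (INR n * 8 * x / (hm * hm))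
          by (field; lra).
        apply div_le_of_le_mul; auto.
        apply (Rmult_le_compat_r (8 * (INR n + 1))) in Hx3; [|lra].
        replace (nu * (hm * hm) / (8 * (INR n + 1)) * (8 * (INR n + 1))) with (nu * (hm * hm)) in Hx3
          by (field; lra).
        nra.
    - split; auto. unfold r. lra. }
  pose proof (Cmod_ge_0 (F z0)).
  replace nu with (nu / 2 + nu / 2) by field. rewrite exp_plus. nra.
Qed.

(** The squared Blaschke product is at most [exp (4 * CC / tau)] off the small disks and at least
    [exp (c5 * c3 / tau)] at [z0]. A power [N] of order [CC / (tau * L)] makes [f ^ N] small enough
    on the disks, and [tau] cancels in the bound for [f z0]. The depth [hm] may be tiny: it only
    makes the sampling finite and does not enter [c]. [Fib t] is the fibre over the parameter [t], a
    circle or a ray in the applications. *)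
Theorem hall_bound (kappa C1 c3 : R) : 0 < kappa <= 1 -> 0 < C1 -> 0 < c3 ->
  exists c, 0 < c /\ forall (f : C -> C) (Fib : R -> C -> Prop) (z0 : C) (A B L hm : R),
    (forall z, Cmod z < 1 -> cdiff f z) -> (forall z, Cmod z < 1 -> Cmod (f z) <= 1) ->
    Cmod z0 < 1 -> c3 * (1 - Cmod z0) <= B - A -> 0 < L -> 0 < hm ->
    (forall z, Cmod z < 1 -> exists P, forall t zeta, A <= t <= B -> Fib t zeta -> Cmod zeta < 1 ->
       kappa * Rabs (P - t) <= Cmod (z - zeta)) ->
    (forall t, A <= t <= B -> exists zeta, Fib t zeta /\ Cmod zeta <= 1 - hm /\
       Cmod (zeta - z0) <= C1 * (1 - Cmod z0) /\ Cmod (f zeta) < exp (- L)) ->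
    Cmod (f z0) <= exp (- (c * L)).
Proof.
  intros Hk HC1 Hc3.
  set (CC := 128 / (kappa * kappa)).
  assert (HCC : 0 < CC) by (apply Rdiv_lt_0_compat; nra).
  set (c5 := / (C1 * C1 + C1 + 1)).
  assert (Hc5 : 0 < c5) by (apply Rinv_0_lt_compat; nra).
  (* The value [1 / 2] serves the case that [z0] lies in one of the small disks; the other one gives
     [2 * c * (INR N * L) <= c5 * c3 / tau]. *)
  set (c := Rmin (1 / 2) (c5 * c3 / (16 * CC))).
  assert (Hc : 0 < c).
  { apply Rmin_pos; [lra|]. apply Rdiv_lt_0_compat; rpos. }
  exists c. split; auto.
  intros f Fib z0 A B L hm HD Hb Hz0 HAB HL Hhm Hsep Hcov.
  set (d := 1 - Cmod z0) in *. assert (Hd : 0 < d) by (unfold d; lra).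
  assert (HABp : 0 < B - A) by (assert (0 < c3 * d) by rpos; lra).
  (* Within [rho0] of a sample point, where [f] is below [exp (- L)], it stays below
     [exp (- (L / 2))]. *)
  destruct (disk_unif_cont f (1 - hm) (exp (- (L / 2)) - exp (- L))) as (rho0 & Hrho & Hunif).
  { lra. }
  { assert (exp (- L) < exp (- (L / 2))) by (apply exp_increasing; lra). lra. }
  { intros z Hz. apply cdiff_cont, HD; auto. }
  (* The second bound gives [1 <= x] below, so that rounding [x] up to [N] at most doubles it. *)
  set (tau := Rmin (rho0 / 2) (4 * CC / L)).
  assert (Ht : 0 < tau).
  { apply Rmin_pos; [lra|]. apply Rdiv_lt_0_compat; lra. }
  assert (Ht1 : tau <= rho0 / 2) by apply Rmin_l.
  assert (Ht2 : tau * L <= 4 * CC).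
  { assert (E : tau <= 4 * CC / L) by apply Rmin_r.
    apply (Rmult_le_compat_r L) in E; [|lra].
    replace (4 * CC / L * L) with (4 * CC) in E by (field; lra). auto. }
  destruct (greedy_points (fun t zeta => Fib t zeta /\ Cmod (zeta - z0) <= C1 * d /\ Cmod (f zeta) < exp (- L))
    A B tau hm) as (n & T & Z & HT0 & HTn & HT); auto; try lra.
  { intros t Htt. destruct (Hcov t Htt) as (zeta & H1 & H2 & H3 & H4). exists zeta. tauto. }
  set (rho := fun i => tau * (1 - Cmod (Z i))).
  assert (HZ : forall i, (i < n)%nat -> Cmod (Z i) <= 1 - hm /\ 0 < rho i).
  { intros i Hi. destruct (HT i Hi) as (_ & _ & H & _). split; auto. unfold rho.
    apply Rmult_lt_0_compat; lra. }
  assert (Hin : forall z i, (i < n)%nat -> Cmod (z - Z i) <= rho i -> Cmod (f z) <= exp (- (L / 2))).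
  { intros z i Hi Hzi. destruct (HT i Hi) as (_ & (_ & _ & H4) & H3 & _).
    specialize (Hunif (Z i) z H3). pose proof (Cmod_ge_0 (Z i)).
    assert (rho i <= rho0 / 2) by (unfold rho; nra).
    specialize (Hunif ltac:(lra)).
    pose proof (Cmod_sub_lower (f z) (f (Z i))). lra. }
  destruct (classic (exists i, (i < n)%nat /\ Cmod (z0 - Z i) < rho i)) as [(i & Hi & Hl)|Hfar].
  { eapply Rle_trans; [apply (Hin z0 i); auto; lra|]. apply exp_le.
    assert (c <= 1 / 2) by apply Rmin_l. nra. }
  assert (Hout : forall i, (i < n)%nat -> rho i <= Cmod (z0 - Z i)).
  { intros i Hi. apply Rnot_lt_le. intros Hl. apply Hfar. exists i; auto. }
  set (x := 4 * CC / (tau * L)).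
  assert (HtL : 0 < tau * L) by rpos.
  assert (Hx : 1 <= x) by (apply le_div_of_mul_le; lra).
  destruct (archimed x) as [Ha1 Ha2].
  set (N := Z.to_nat (up x)).
  assert (HN : INR N = IZR (up x)).
  { unfold N. rewrite INR_IZR_INZ, Z2Nat.id; auto. apply le_IZR. lra. }
  assert (HN1 : x <= INR N) by lra. assert (HN2 : INR N <= 2 * x) by lra.
  assert (Hxt : x * L = 4 * CC / tau) by (unfold x; field; lra).
  pose proof (blaschke_comparison f Z rho n N hm (exp (4 * CC / tau)) z0 HD Hb Hhm HZ) as BC.
  assert (Key : Cmod (f z0) ^ N * Cmod (f z0) ^ N *
    (Cmod (cprod (fun i => binv (Z i) z0) n) * Cmod (cprod (fun i => binv (Z i) z0) n)) <= 1).
  { apply BC; auto.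
    - intros z Hz Hzo. destruct (Hsep z Hz) as [P HP].
      eapply Rle_trans.
      + apply (cprod_upper _ (fun i => CC / tau * odd_profile ((T i - P) / (1 - Cmod z)))).
        intros i Hi. destruct (HT i Hi) as (H1 & (H2 & _) & H3 & H4). rewrite H4.
        rewrite <- Rmult_minus_distr_l. apply binv_upper; auto; try lra.
        * apply HP; auto. lra.
        * apply (Hzo i Hi).
      + apply exp_le. rewrite <- Rmult_minus_distr_l.
        pose proof (odd_profile_bounds ((T n - P) / (1 - Cmod z))).
        pose proof (odd_profile_bounds ((T O - P) / (1 - Cmod z))).
        replace (4 * CC / tau) with (CC / tau * 4) by (field; lra).
        apply Rmult_le_compat_l; [left; apply Rdiv_lt_0_compat; auto|lra].
    - intros z i Hi Hz Hzi. specialize (Hin z i Hi Hzi).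
      pose proof (Cmod_ge_0 (f z)).
      assert (Cmod (f z) ^ N <= exp (- (L / 2)) ^ N) by (apply pow_incr; lra).
      rewrite pow_exp in H0. pose proof (pow_le (Cmod (f z)) N H).
      apply Rle_trans with (exp (INR N * - (L / 2)) * exp (INR N * - (L / 2)) * exp (4 * CC / tau)).
      + apply Rmult_le_compat_r; [left; apply exp_pos|]. apply Rmult_le_compat; auto.
      + rewrite <- !exp_plus, <- exp_0. apply exp_le. nra. }
  assert (Low : exp (c5 * c3 / tau) <=
    Cmod (cprod (fun i => binv (Z i) z0) n) * Cmod (cprod (fun i => binv (Z i) z0) n)).
  { eapply Rle_trans.
    2: { apply (cprod_lower _ (fun i => T i / tau / d * c5)).
         intros i Hi. destruct (HT i Hi) as (H1 & (H2 & H5 & _) & H3 & H4). rewrite H4.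
         replace ((T i + tau * (1 - Cmod (Z i))) / tau / d * c5 - T i / tau / d * c5)
           with ((1 - Cmod (Z i)) / d / (C1 * C1 + C1 + 1)) by (unfold c5; field; repeat split; nra).
         apply binv_lower; auto; try lra.
         specialize (Hout i Hi). destruct (HZ i Hi). lra. }
    apply exp_le. rewrite HT0.
    replace (T n / tau / d * c5 - A / tau / d * c5) with (c5 * ((T n - A) / d) / tau) by (field; lra).
    unfold Rdiv at 1. apply Rmult_le_compat_r; [left; apply Rinv_0_lt_compat; auto|].
    apply Rmult_le_compat_l; [lra|]. apply le_div_of_mul_le; lra. }
  destruct (Rle_lt_dec (Cmod (f z0)) (exp (- (c * L)))) as [|Hgt]; auto. exfalso.
  pose proof (Cmod_ge_0 (f z0)).
  assert (E1 : exp (- (c * L)) ^ N <= Cmod (f z0) ^ N).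
  { apply pow_incr. split; [left; apply exp_pos|lra]. }
  rewrite pow_exp in E1.
  assert (Strict : exp (- (c * L)) ^ N < Cmod (f z0) ^ N).
  { apply pow_lt_pow. { split; [left; apply exp_pos|auto]. }
    destruct N; [|lia]. simpl in HN1. lra. }
  rewrite pow_exp in Strict.
  assert (E2 : 1 <= exp (INR N * - (c * L)) * exp (INR N * - (c * L)) * exp (c5 * c3 / tau)).
  { rewrite <- !exp_plus, <- exp_0. apply exp_le.
    assert (Hcc : c <= c5 * c3 / (16 * CC)) by apply Rmin_r.
    assert (INR N * L <= 8 * CC / tau).
    { apply Rle_trans with (2 * x * L); [nra|]. replace (2 * x * L) with (2 * (x * L)) by ring.
      rewrite Hxt. right. field. lra. }
    assert (2 * c * (INR N * L) <= 2 * (c5 * c3 / (16 * CC)) * (8 * CC / tau)).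
    { apply Rmult_le_compat; try lra. apply Rmult_le_pos; [apply pos_INR|lra]. }
    replace (2 * (c5 * c3 / (16 * CC)) * (8 * CC / tau)) with (c5 * c3 / tau) in H1 by (field; lra).
    nra. }
  set (u := exp (INR N * - (c * L))) in *. set (v := Cmod (f z0) ^ N) in *.
  set (w := Cmod (cprod (fun i => binv (Z i) z0) n) * Cmod (cprod (fun i => binv (Z i) z0) n)) in *.
  assert (0 < u) by apply exp_pos.
  assert (0 < exp (c5 * c3 / tau)) by apply exp_pos.
  assert (u * u < v * v) by nra.
  assert (u * u * exp (c5 * c3 / tau) <= u * u * w) by (apply Rmult_le_compat_l; [nra|auto]).
  assert (u * u * w < v * v * w) by (apply Rmult_lt_compat_r; lra).
  lra.
Qed.

(** * Paths on which a bounded analytic function is small *)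

Definition rcont_on (a b : R) (g : R -> R) : Prop :=
  forall t, a <= t <= b -> forall eps, 0 < eps -> exists delta, 0 < delta /\
    forall s, a <= s <= b -> Rabs (s - t) < delta -> Rabs (g s - g t) < eps.

Definition pcont_on (a b : R) (e : R -> C) : Prop :=
  forall t, a <= t <= b -> forall eps, 0 < eps -> exists delta, 0 < delta /\
    forall s, a <= s <= b -> Rabs (s - t) < delta -> Cmod (e s - e t) < eps.

Lemma first_hit (g : R -> R) (a b c : R) : a <= b -> rcont_on a b g -> g a < c <= g b ->
  exists u, a <= u <= b /\ g u = c /\ forall v, a <= v < u -> g v < c.
Proof.
  intros Hab Hg Hc.
  destruct (completeness (fun x => a <= x <= b /\ forall v, a <= v <= x -> g v < c)) as [u [Hu1 Hu2]].
  { exists b. intros x [Hx _]. lra. }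
  { exists a. split; [lra|]. intros v Hv. replace v with a by lra. lra. }
  assert (Hau : a <= u).
  { apply Hu1. split; [lra|]. intros v Hv. replace v with a by lra. lra. }
  assert (Hub : u <= b) by (apply Hu2; intros x [Hx _]; lra).
  assert (Hlt : forall v, a <= v < u -> g v < c).
  { intros v Hv. apply NNPP. intros HN.
    assert (u <= v); [|lra]. apply Hu2. intros x [Hx Hx2].
    apply Rnot_lt_le. intros Hl. apply HN, Hx2. lra. }
  exists u. split; [lra|]. split; auto.
  destruct (Rtotal_order (g u) c) as [H|[H|H]]; auto; exfalso.
  - destruct (Hg u ltac:(lra) (c - g u)) as (d & D & Hd); [lra|].
    assert (Hne : u < b) by (destruct (Req_dec u b) as [->|]; lra).
    set (x := Rmin b (u + d / 2)).
    assert (Hx : u < x) by (unfold x; apply Rmin_glb_lt; lra).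
    assert (Hxb : x <= b) by apply Rmin_l. assert (Hxd : x <= u + d / 2) by apply Rmin_r.
    assert (x <= u); [|lra]. apply Hu1. split; [lra|]. intros v Hv.
    destruct (Rlt_dec v u); [apply Hlt; lra|].
    specialize (Hd v ltac:(lra)). rewrite Rabs_pos_eq in Hd by lra.
    specialize (Hd ltac:(lra)). apply Rabs_lt_between in Hd. lra.
  - destruct (Hg u ltac:(lra) (g u - c)) as (d & D & Hd); [lra|].
    assert (Hne : a < u) by (destruct (Req_dec a u) as [<-|]; lra).
    set (v := Rmax a (u - d / 2)).
    assert (Hv : v < u) by (unfold v; apply Rmax_lub_lt; lra).
    assert (Hva : a <= v) by apply Rmax_l. assert (Hvd : u - d / 2 <= v) by apply Rmax_r.
    specialize (Hd v ltac:(lra)). rewrite Rabs_left in Hd by lra.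
    specialize (Hd ltac:(lra)). apply Rabs_lt_between in Hd. specialize (Hlt v ltac:(lra)). lra.
Qed.

Lemma ivt_on (g : R -> R) (a b c : R) : a <= b -> rcont_on a b g ->
  g a <= c <= g b \/ g b <= c <= g a -> exists u, a <= u <= b /\ g u = c.
Proof.
  intros Hab Hg [Hc|Hc].
  - destruct (Req_dec (g a) c) as [E|E]; [exists a; split; auto; lra|].
    destruct (first_hit g a b c) as (u & H1 & H2 & _); auto; [lra|]. exists u; auto.
  - destruct (Req_dec (g a) c) as [E|E]; [exists a; split; auto; lra|].
    destruct (first_hit (fun x => - g x) a b (- c)) as (u & H1 & H2 & _); auto.
    + intros t Ht eps He. destruct (Hg t Ht eps He) as (d & D & H). exists d. split; auto.
      intros s Hs Hst. specialize (H s Hs Hst).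
      replace (- g s - - g t) with (- (g s - g t)) by ring. rewrite Rabs_Ropp; auto.
    + lra.
    + exists u. split; auto. lra.
Qed.

Lemma rcont_sub g a b a' b' : rcont_on a b g -> a <= a' -> b' <= b -> rcont_on a' b' g.
Proof.
  intros H Ha Hb t Ht eps He. destruct (H t ltac:(lra) eps He) as (d & D & Hd).
  exists d. split; auto. intros s Hs. apply Hd. lra.
Qed.

Lemma pcont_lip (F : C -> R) (e : R -> C) a b : (forall z w, Rabs (F z - F w) <= Cmod (z - w)) ->
  pcont_on a b e -> rcont_on a b (fun t => F (e t)).
Proof.
  intros HF He t Ht eps Hep. destruct (He t Ht eps Hep) as (d & D & H). exists d. split; auto.
  intros s Hs Hst. eapply Rle_lt_trans; [apply HF|]. auto.
Qed.

Lemma Cmod_lip (z w : C) : Rabs (Cmod z - Cmod w) <= Cmod (z - w).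
Proof.
  apply Rabs_le. pose proof (Cmod_sub_lower z w). pose proof (Cmod_sub_lower w z).
  rewrite (Cmod_sub_sym w z) in H0. lra.
Qed.

Lemma Cmod_dist_lip (c z w : C) : Rabs (Cmod (z - c) - Cmod (w - c)) <= Cmod (z - w).
Proof.
  eapply Rle_trans; [apply Cmod_lip|]. right. f_equal. ring.
Qed.

Lemma rcont_div g h a b m : 0 < m -> rcont_on a b g -> rcont_on a b h ->
  (forall t, a <= t <= b -> m <= h t) -> rcont_on a b (fun t => g t / h t).
Proof.
  intros Hm Hg Hh Hhm t Ht eps He. pose proof (Rabs_pos (g t)) as Hg0.
  set (A := eps * (m * m) / (2 * (h t + Rabs (g t) + 1))).
  pose proof (Hhm t Ht) as Hht.
  assert (HA : 0 < A).
  { unfold A. apply Rdiv_lt_0_compat; [rpos|lra]. }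
  destruct (Hg t Ht A HA) as (d1 & D1 & H1). destruct (Hh t Ht A HA) as (d2 & D2 & H2).
  exists (Rmin d1 d2). split; [apply Rmin_pos; auto|]. intros s Hs Hst.
  pose proof (Rmin_l d1 d2). pose proof (Rmin_r d1 d2).
  specialize (H1 s Hs ltac:(lra)). specialize (H2 s Hs ltac:(lra)). pose proof (Hhm s Hs) as Hhs.
  replace (g s / h s - g t / h t) with (((g s - g t) * h t - g t * (h s - h t)) / (h s * h t))
    by (field; lra).
  assert (Hpos : 0 < h s * h t) by (apply Rmult_lt_0_compat; lra).
  rewrite Rabs_div by lra. rewrite (Rabs_pos_eq (h s * h t)) by lra.
  apply (Rmult_lt_reg_r (h s * h t)); auto.
  replace (Rabs ((g s - g t) * h t - g t * (h s - h t)) / (h s * h t) * (h s * h t))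
    with (Rabs ((g s - g t) * h t - g t * (h s - h t))) by (field; lra).
  eapply Rle_lt_trans; [apply Rabs_triang|]. rewrite Rabs_Ropp, !Rabs_mult, (Rabs_pos_eq (h t)) by lra.
  assert (E : A * (h t + Rabs (g t) + 1) = eps * (m * m) / 2) by (unfold A; field; lra).
  assert (m * m <= h s * h t) by nra.
  assert (eps * (m * m) <= eps * (h s * h t)) by (apply Rmult_le_compat_l; lra).
  assert (0 < eps * (m * m)) by rpos.
  pose proof (Rabs_pos (g s - g t)). pose proof (Rabs_pos (h s - h t)).
  assert (Rabs (g s - g t) * h t <= A * h t) by (apply Rmult_le_compat_r; lra).
  assert (Rabs (g t) * Rabs (h s - h t) <= Rabs (g t) * A) by (apply Rmult_le_compat_l; lra).
  nra.
Qed.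

(** On the circle, smallness is asked only at some radii arbitrarily close to 1. A radial limit of
    modulus below [eps] implies it, and it is enough for replacing the point by one inside the disk
    on the same ray. *)
Definition unit_small (f : C -> C) (eps : R) (zeta : C) : Prop :=
  (Cmod zeta < 1 /\ Cmod (f zeta) < eps) \/
  (Cmod zeta = 1 /\ forall delta, 0 < delta -> exists r, 1 - delta < r < 1 /\ Cmod (f (RtoC r * zeta)%C) < eps).

Lemma unit_small_le f eps zeta : unit_small f eps zeta -> Cmod zeta <= 1.
Proof. intros [[H _]|[H _]]; lra. Qed.

Lemma unit_conj (u : C) : Cmod u = 1 -> (u * Cconj u = 1)%C.
Proof.
  intros H. pose proof (Cmod_sqr u) as S. rewrite H in S.
  unfold Cmult, Cconj, RtoC; simpl. f_equal; lra.
Qed.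

Lemma abs_le_of_sqr x m : 0 <= m -> x * x <= m * m -> Rabs x <= m.
Proof.
  intros Hm H. apply Rnot_lt_le. intros Hl.
  assert (E : x * x = Rabs x * Rabs x) by (rewrite <- Rabs_mult; symmetry; apply Rabs_pos_eq; nra).
  nra.
Qed.

(** The fibre over [t] lies on the ray from the origin of slope [t] relative to the direction [u],
    and [P] is the slope of [z]. If [z] is not well inside the half plane around [u], its distance
    to all fibres is at least [s0 / 2], and 0 will do for [P]. *)
Lemma slope_separation (u : C) (s0 : R) : Cmod u = 1 -> 0 < s0 ->
  forall z, exists P, forall t zeta, -1 <= t <= 1 ->
    (exists s, s0 <= s /\ zeta = (RtoC s * u * (1, t))%C) ->
    s0 / 4 * Rabs (P - t) <= Cmod (z - zeta).
Proof.
  intros Hu Hs0 z. set (w := (Cconj u * z)%C).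
  exists (if Rle_dec (s0 / 2) (fst w) then snd w / fst w else 0).
  intros t zeta Ht (s & Hs & ->).
  assert (E : Cmod (z - RtoC s * u * (1, t)) = Cmod (w - RtoC s * (1, t))).
  { replace (z - RtoC s * u * (1, t))%C with (u * (w - RtoC s * (1, t)))%C.
    - rewrite Cmod_mult, Hu. ring.
    - unfold w. replace (u * (Cconj u * z - RtoC s * (1, t)))%C
        with ((u * Cconj u) * z - RtoC s * u * (1, t))%C by ring.
      rewrite unit_conj by auto. ring. }
  rewrite E. clear E. clearbody w. set (D := Cmod (w - RtoC s * (1, t))).
  pose proof (Cmod_ge_0 (w - RtoC s * (1, t))) as HD. fold D in HD.
  pose proof (Cmod_sqr (w - RtoC s * (1, t))) as S. fold D in S. simpl in S.
  set (x := fst w) in *. set (y := snd w) in *.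
  set (a := x - s) in *. set (b := y - s * t) in *.
  replace (x + - (s * 1 - 0 * t)) with a in S by (unfold a; ring).
  replace (y + - (s * t + 0 * 1)) with b in S by (unfold b; ring).
  destruct (Rle_dec (s0 / 2) x) as [Hx|Hx].
  - assert (Hb : Rabs (y - t * x) <= 2 * D).
    { replace (y - t * x) with (b - t * a) by (unfold a, b; ring).
      clearbody a b D. apply abs_le_of_sqr; [lra|].
      assert (T1 : t * t <= 1) by nra.
      assert (T2 : 0 <= (b + t * a) * (b + t * a)) by apply Rle_0_sqr.
      assert (T3 : t * t * (a * a) <= 1 * (a * a)) by (apply Rmult_le_compat_r; [apply Rle_0_sqr|auto]).
      assert (T4 : 0 <= a * a) by apply Rle_0_sqr. assert (T5 : 0 <= b * b) by apply Rle_0_sqr.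
      replace (2 * D * (2 * D)) with (4 * (D * D)) by ring. rewrite S.
      replace ((b - t * a) * (b - t * a))
        with (2 * (b * b) + 2 * (t * t * (a * a)) - (b + t * a) * (b + t * a)) by ring.
      lra. }
    replace (y / x - t) with ((y - t * x) / x) by (field; lra).
    rewrite Rabs_div, (Rabs_pos_eq x) by lra.
    apply (Rmult_le_reg_r x); [lra|].
    replace (s0 / 4 * (Rabs (y - t * x) / x) * x) with (s0 / 4 * Rabs (y - t * x)) by (field; lra).
    pose proof (Rabs_pos (y - t * x)). nra.
  - assert (Ha : s0 / 2 <= D).
    { assert (s0 / 2 <= - a) by (unfold a; lra). nra. }
    assert (Rabs (0 - t) <= 1) by (apply Rabs_le; lra).
    pose proof (Rabs_pos (0 - t)). nra.
Qed.

(** Until it first reaches distance [c0 * (1 - Cmod z0)] from [e 0], the path changes its modulus or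
    its slope by a comparable amount, and [hall_bound] applies with that quantity as the parameter.
    Keeping away from the origin makes the slope a good coordinate. *)
Theorem small_path_bound (r0 C0 c0 : R) : 0 < r0 <= 1 -> 0 < C0 -> 0 < c0 <= r0 / 2 ->
  exists c, 0 < c /\ forall (f : C -> C) (e : R -> C) (z0 : C) (L : R),
    (forall z, Cmod z < 1 -> cdiff f z) -> (forall z, Cmod z < 1 -> Cmod (f z) <= 1) ->
    Cmod z0 < 1 -> 0 < L -> pcont_on 0 1 e ->
    (forall t, 0 <= t <= 1 -> r0 <= Cmod (e t)) ->
    (forall t, 0 <= t <= 1 -> unit_small f (exp (- L)) (e t)) ->
    Cmod (e 0 - z0) <= C0 * (1 - Cmod z0) ->
    c0 * (1 - Cmod z0) <= Cmod (e 1 - e 0) ->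
    Cmod (f z0) <= exp (- (c * L)).
Proof.
  intros Hr0 HC0 Hc0.
  destruct (hall_bound 1 (C0 + c0) (c0 / 4)) as (ca & Hca & HA); try lra.
  (* [C0 + c0] covers the points of the path; the additional 2 allows [d] for pulling a point of the
     circle into the disk and [d] for tilting its ray. *)
  destruct (hall_bound (r0 / 16) (C0 + c0 + 2) (c0 / 2)) as (cb & Hcb & HB); try lra.
  exists (Rmin ca cb). split; [apply Rmin_pos; auto|].
  intros f e z0 L HD Hb Hz0 HL He Her Hsm Hstart Hfar.
  set (d := 1 - Cmod z0) in *. pose proof (Cmod_ge_0 z0).
  assert (Hd : 0 < d <= 1) by (unfold d; lra).
  assert (Hcd : 0 < c0 * d) by rpos.
  assert (weak : forall c', Rmin ca cb <= c' -> Cmod (f z0) <= exp (- (c' * L)) ->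
    Cmod (f z0) <= exp (- (Rmin ca cb * L))).
  { intros c' Hc' Hf. eapply Rle_trans; [exact Hf|]. apply exp_le. nra. }
  destruct (first_hit (fun t => Cmod (e t - e 0)) 0 1 (c0 * d)) as (us & Hus & Eus & Hlt).
  { lra. }
  { apply (pcont_lip (fun z => Cmod (z - e 0))); auto. apply Cmod_dist_lip. }
  { rewrite Cmod_sub_self. lra. }
  assert (Hle : forall t, 0 <= t <= us -> Cmod (e t - e 0) <= c0 * d).
  { intros t Ht. destruct (Req_dec t us) as [->|]; [lra|]. left. apply Hlt. lra. }
  assert (Hnear : forall t, 0 <= t <= us -> Cmod (e t - z0) <= (C0 + c0) * d).
  { intros t Ht. pose proof (Cmod_sub_trans (e t) (e 0) z0). specialize (Hle t Ht). lra. }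
  assert (Hmod : rcont_on 0 1 (fun t => Cmod (e t))) by (apply (pcont_lip Cmod); auto; apply Cmod_lip).
  destruct (classic (exists v, 0 <= v <= us /\ c0 / 2 * d <= Rabs (Cmod (e v) - Cmod (e 0))))
    as [(v & Hv & Hvr)|Hrad].
  - apply (weak ca); [apply Rmin_l|].
    (* Only the lower part of the range of moduli is used, so that its points keep the distance
       [c0 / 4 * d] from the circle and are all in the open disk. *)
    set (A := Rmin (Cmod (e v)) (Cmod (e 0))). set (B := A + c0 / 4 * d).
    assert (HAB : c0 / 2 * d <= Rmax (Cmod (e v)) (Cmod (e 0)) - A).
    { unfold A, Rmin, Rmax. unfold Rabs in Hvr. destruct (Rcase_abs _); destruct (Rle_dec _ _); lra. }
    assert (Htop : Rmax (Cmod (e v)) (Cmod (e 0)) <= 1).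
    { apply Rmax_lub; eapply unit_small_le; apply Hsm; lra. }
    apply (HA f (fun t zeta => Cmod zeta = t) z0 A B L (c0 / 4 * d)); auto; fold d.
    + unfold B. lra.
    + apply Rmult_lt_0_compat; lra.
    + intros z Hz. exists (Cmod z). intros t zeta _ <- _. rewrite Rmult_1_l. apply Cmod_lip.
    + intros t Ht.
      destruct (ivt_on (fun t => Cmod (e t)) 0 v t) as (w & Hw & Ew).
      { lra. }
      { apply (rcont_sub _ 0 1); auto; lra. }
      { assert (0 < c0 / 4 * d) by (apply Rmult_lt_0_compat; lra).
        unfold B in Ht. clear - Ht HAB H0. revert Ht HAB. unfold A, Rmin, Rmax.
        destruct (Rle_dec _ _); intros; lra. }
      assert (Htm : t <= 1 - c0 / 4 * d) by (unfold B in Ht; lra).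
      exists (e w). repeat split; auto.
      * rewrite Ew. auto.
      * apply Hnear. lra.
      * destruct (Hsm w ltac:(lra)) as [[_ Hf]|[E1 _]]; auto.
        exfalso. assert (0 < c0 / 4 * d) by (apply Rmult_lt_0_compat; lra). lra.
  - apply (weak cb); [apply Rmin_r|].
    set (m := Cmod (e 0)). assert (Hm : r0 <= m) by (apply Her; lra).
    set (u := (RtoC (/ m) * e 0)%C).
    assert (Hu : Cmod u = 1).
    { unfold u. rewrite Cmod_mult, Cmod_R, Rabs_pos_eq by (left; apply Rinv_0_lt_compat; lra).
      fold m. field. lra. }
    set (g := fun t => (Cconj u * e t)%C).
    assert (Eg : forall t, e t = (u * g t)%C).
    { intros t. unfold g. rewrite Cmult_assoc, unit_conj by auto. ring. }
    assert (Eg0 : g 0 = RtoC m).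
    { assert (E : (u * g 0 = u * RtoC m)%C).
      { rewrite <- Eg. unfold u. replace (RtoC (/ m) * e 0 * RtoC m)%C with (RtoC (/ m) * RtoC m * e 0)%C by ring.
        rewrite <- RtoC_mult, Rinv_l by lra. ring. }
      assert (E2 : (Cconj u * (u * g 0) = Cconj u * (u * RtoC m))%C) by (rewrite E; auto).
      rewrite !Cmult_assoc, (Cmult_comm (Cconj u) u), unit_conj, !Cmult_1_l in E2 by auto. auto. }
    assert (Hgd : forall t s, Cmod (g t - g s) = Cmod (e t - e s)).
    { intros t s. rewrite (Eg t), (Eg s). replace (u * g t - u * g s)%C with (u * (g t - g s))%C by ring.
      rewrite Cmod_mult, Hu. ring. }
    assert (Hgm : forall t, Cmod (g t) = Cmod (e t)).
    { intros t. rewrite (Eg t), Cmod_mult, Hu. ring. }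
    clearbody g. clearbody u.
    assert (HX : forall t, 0 <= t <= us -> r0 / 2 <= fst (g t) /\ Rabs (snd (g t)) <= c0 * d).
    { intros t Ht. specialize (Hle t Ht). rewrite <- Hgd, Eg0 in Hle.
      pose proof (fst_le_Cmod (g t - RtoC m)) as F1. pose proof (snd_le_Cmod (g t - RtoC m)) as F2.
      simpl in F1, F2. replace (snd (g t) + - 0) with (snd (g t)) in F2 by ring.
      split; [|lra]. apply Rabs_le_between in F1. nra. }
    assert (Hgc : pcont_on 0 us g).
    { intros t Ht eps Hep. destruct (He t ltac:(lra) eps Hep) as (dl & Dl & Hdl).
      exists dl. split; auto. intros s Hs Hst. rewrite Hgd. apply Hdl; auto. lra. }
    set (sl := fun t => snd (g t) / fst (g t)).
    assert (Hsl : rcont_on 0 us sl).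
    { apply (rcont_div _ _ _ _ (r0 / 2)); [lra| | |].
      - apply (pcont_lip snd); auto. intros z w. apply (snd_le_Cmod (z - w)).
      - apply (pcont_lip fst); auto. intros z w. apply (fst_le_Cmod (z - w)).
      - intros t Ht. apply HX; auto. }
    assert (Hsl0 : sl 0 = 0) by (unfold sl; rewrite Eg0; simpl; field; lra).
    (* Otherwise the real part would account for most of the displacement. As [c0 <= r0 / 2],
       modulus and real part differ too little to prevent a change of the modulus by [c0 / 2 * d],
       which [Hrad] excludes. *)
    assert (HYs : c0 / 2 * d <= Rabs (snd (g us))).
    { apply Rnot_lt_le. intros HY. apply Hrad. exists us. split; [lra|].
      rewrite <- (Hgm us). fold m.
      destruct (HX us ltac:(lra)) as [X1 _]. simpl in Eus. rewrite <- Hgd, Eg0 in Eus.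
      pose proof (Cmod_sqr (g us - RtoC m)) as S1. rewrite Eus in S1. simpl in S1.
      pose proof (Cmod_sqr (g us)) as S2. set (X := fst (g us)) in *. set (Y := snd (g us)) in *.
      set (M := Cmod (g us)) in *. assert (HM : 0 <= M) by apply Cmod_ge_0.
      assert (HY2 : Y * Y <= (c0 / 2 * d) * (c0 / 2 * d)).
      { replace (Y * Y) with (Rabs Y * Rabs Y) by (rewrite <- Rabs_mult; apply Rabs_pos_eq; nra).
        pose proof (Rabs_pos Y). nra. }
      replace (Y + - 0) with Y in S1 by ring.
      assert (HXm : (3 / 4) * (c0 * d) * ((3 / 4) * (c0 * d)) <= (X - m) * (X - m)) by nra.
      assert (HMX : X <= M) by nra.
      destruct (Rle_lt_dec m X) as [Hmx|Hmx].
      - rewrite Rabs_pos_eq by lra. nra.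
      - assert (HXM : 3 / 4 * (c0 * d) <= m - X) by nra.
        assert (HMX2 : M - X <= c0 * d / 8).
        { assert ((M - X) * r0 <= Y * Y).
          { replace (Y * Y) with ((M - X) * (M + X)) by lra.
            apply Rmult_le_compat_l; [lra|]. lra. }
          assert ((c0 / 2 * d) * (c0 / 2 * d) <= r0 * (c0 * d / 8)).
          { replace ((c0 / 2 * d) * (c0 / 2 * d)) with (c0 * d / 4 * (c0 * d)) by field.
            assert (c0 * d <= r0 / 2) by nra. nra. }
          apply (Rmult_le_reg_r r0); [lra|]. lra. }
        rewrite Rabs_left by lra. lra. }
    assert (HX1 : fst (g us) <= 1).
    { pose proof (fst_le_Cmod (g us)) as F. rewrite Hgm in F.
      pose proof (unit_small_le _ _ _ (Hsm us ltac:(lra))). apply Rabs_le_between in F. lra. }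
    destruct (HX us ltac:(lra)) as [HXu _].
    assert (Hslu : c0 / 2 * d <= Rabs (sl us)).
    { unfold sl. rewrite Rabs_div, (Rabs_pos_eq (fst (g us))) by lra.
      apply le_div_of_mul_le; [lra|]. nra. }
    set (A := Rmin 0 (if Rle_dec 0 (sl us) then 0 else - (c0 / 2 * d))).
    set (B := A + c0 / 2 * d).
    assert (Hh : 0 < c0 / 2 * d) by (apply Rmult_lt_0_compat; lra).
    assert (HABt : forall t, A <= t <= B -> sl 0 <= t <= sl us \/ sl us <= t <= sl 0).
    { intros t Ht. rewrite Hsl0. unfold A, B in Ht. unfold A in Ht. unfold Rabs in Hslu.
      destruct (Rle_dec 0 (sl us)); destruct (Rcase_abs (sl us)); try lra.
      - left. rewrite Rmin_left in Ht by lra. lra.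
      - right. rewrite Rmin_right in Ht by lra. lra. }
    assert (HAB1 : -1 <= A /\ B <= 1).
    { assert (c0 / 2 * d <= 1) by nra. unfold B, A.
      destruct (Rle_dec 0 (sl us)); [rewrite Rmin_left by lra|rewrite Rmin_right by lra]; lra. }
    set (Fib := fun t zeta => exists s, r0 / 4 <= s /\ zeta = (RtoC s * u * (1, t))%C).
    (* For each [t] some interior point of its ray has a small value, and by continuity so do the
       points with the same [s] on neighbouring rays. Compactness gives one depth [hm] for all [t];
       parameters enter as first coordinates of points of the plane. *)
    destruct (plane_gauge_choice (fun p dl => forall t, A <= t <= B -> Rabs (t - fst p) < dl ->
      exists zeta, Fib t zeta /\ Cmod zeta <= 1 - dl /\ Cmod (zeta - z0) <= (C0 + c0 + 2) * d /\
        Cmod (f zeta) < exp (- L)) 1) as (hm & Hhm & Hcov).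
    { intros [t y0]. simpl.
      destruct (Rle_dec A t) as [At|At].
      2: { exists (A - t). split; [lra|]. intros t' Ht' Hl. exfalso. rewrite Rabs_pos_eq in Hl; lra. }
      destruct (Rle_dec t B) as [Bt|Bt].
      2: { exists (t - B). split; [lra|]. intros t' Ht' Hl. exfalso. rewrite Rabs_left1 in Hl; lra. }
      destruct (ivt_on sl 0 us t) as (w & Hw & Ew); [lra|auto|apply HABt; lra|].
      destruct (HX w Hw) as [HXw _].
      assert (Efib : e w = (RtoC (fst (g w)) * u * (1, t))%C).
      { rewrite (Eg w) at 1. rewrite <- Ew. unfold sl.
        transitivity (u * (RtoC (fst (g w)) * (1, (snd (g w) / fst (g w))%R)))%C; [|ring].
        f_equal. unfold Cmult, RtoC; simpl. destruct (g w) as [gx gy]; simpl in *. f_equal; field; lra. }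
      assert (Hs : exists s, r0 / 4 <= s <= 1 /\ Cmod (RtoC s * u * (1, t)) < 1 /\
        Cmod (RtoC s * u * (1, t) - z0) <= (C0 + c0 + 1) * d /\ Cmod (f (RtoC s * u * (1, t))%C) < exp (- L)).
      { assert (F1 : fst (g w) <= 1).
        { pose proof (fst_le_Cmod (g w)) as F. rewrite Hgm in F.
          pose proof (unit_small_le _ _ _ (Hsm w ltac:(lra))). apply Rabs_le_between in F. lra. }
        specialize (Hnear w Hw).
        destruct (Hsm w ltac:(lra)) as [[H1 H2]|[H1 H2]].
        - exists (fst (g w)). rewrite <- Efib. repeat split; auto; lra.
        (* A point of the circle is pulled towards the origin, which keeps its slope and hence its
           fibre. *)
        - destruct (H2 (Rmin (1 / 2) d)) as (r & Hr & Hfr); [apply Rmin_pos; lra|].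
          pose proof (Rmin_l (1 / 2) d). pose proof (Rmin_r (1 / 2) d).
          exists (r * fst (g w)).
          assert (E : (RtoC (r * fst (g w)) * u * (1, t) = RtoC r * e w)%C).
          { rewrite Efib, RtoC_mult. ring. }
          rewrite !E. repeat split; auto; try nra.
          + rewrite Cmod_mult, H1, Cmod_R, Rabs_pos_eq; lra.
          + pose proof (Cmod_sub_trans (RtoC r * e w) (e w) z0) as T.
            replace (RtoC r * e w - e w)%C with (RtoC (r - 1) * e w)%C in T
              by (rewrite RtoC_minus; ring).
            rewrite Cmod_mult, H1, Cmod_R, Rabs_left in T by lra. nra. }
      destruct Hs as (s & Hs & Hs1 & Hs2 & Hs3).
      set (zeta := (RtoC s * u * (1, t))%C) in *.
      destruct (cdiff_cont f zeta (HD zeta Hs1) (exp (- L) - Cmod (f zeta))) as (dl & Dl & Hdl); [lra|].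
      set (mn := Rmin dl (Rmin d ((1 - Cmod zeta) / 2))).
      assert (M1 : mn <= dl) by apply Rmin_l.
      assert (M2 : mn <= d) by (eapply Rle_trans; [apply Rmin_r|apply Rmin_l]).
      assert (M3 : mn <= (1 - Cmod zeta) / 2) by (eapply Rle_trans; [apply Rmin_r|apply Rmin_r]).
      exists mn. split. { repeat apply Rmin_pos; lra. }
      intros t' Ht' Htt'. exists (RtoC s * u * (1, t'))%C.
      assert (Edist : Cmod (RtoC s * u * (1, t') - zeta) <= Rabs (t' - t)).
      { unfold zeta. replace (RtoC s * u * (1, t') - RtoC s * u * (1, t))%C
          with (RtoC s * u * (Ci * RtoC (t' - t)))%C.
        - rewrite !Cmod_mult, Hu, Cmod_Ci, !Cmod_R, (Rabs_pos_eq s) by lra.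
          pose proof (Rabs_pos (t' - t)). nra.
        - transitivity (RtoC s * u * ((1, t') - (1, t)))%C; [|ring]. f_equal.
          unfold Cminus, Cplus, Copp, Cmult, Ci, RtoC; simpl. f_equal; ring. }
      repeat split.
      - exists s. split; [lra|reflexivity].
      - pose proof (Cmod_sub_lower (RtoC s * u * (1, t')) zeta). lra.
      - pose proof (Cmod_sub_trans (RtoC s * u * (1, t')) zeta z0). nra.
      - specialize (Hdl (RtoC s * u * (1, t'))%C ltac:(lra)).
        pose proof (Cmod_sub_lower (f (RtoC s * u * (1, t'))%C) (f zeta)). lra. }
    apply (HB f Fib z0 A B L hm); auto; fold d.
    + unfold B. lra.
    + intros z Hz. destruct (slope_separation u (r0 / 4) Hu ltac:(lra) z) as [P HP].
      exists P. intros t zeta Ht HF _. replace (r0 / 16) with (r0 / 4 / 4) by field.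
      apply HP; auto. lra.
    + intros t Ht. destruct (Hcov (RtoC t)) as (p & dl & H1 & H2 & H3).
      { rewrite Cmod_R. apply Rabs_le. lra. }
      destruct (H1 t Ht) as (zeta & Z1 & Z2 & Z3 & Z4).
      { eapply Rle_lt_trans; [|exact H2]. apply (fst_le_Cmod (RtoC t - p)). }
      exists zeta. repeat split; auto. lra.
Qed.

(** * Boundary behaviour of bounded analytic functions *)

Definition near_value (phi : C -> C) (w : C) (eps : R) (zeta : C) : Prop :=
  (Cmod zeta < 1 /\ Cmod (phi zeta - w) < eps) \/
  (Cmod zeta = 1 /\ forall delta, 0 < delta ->
     exists r, 1 - delta < r < 1 /\ Cmod (phi (RtoC r * zeta)%C - w) < eps).

Lemma pcont_reparam (e : R -> C) (lo hi a b : R) : lo <= a <= hi -> lo <= b <= hi ->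
  pcont_on lo hi e -> pcont_on 0 1 (fun t => e (a + t * (b - a))).
Proof.
  intros Ha Hb He.
  assert (Hin : forall t, 0 <= t <= 1 -> lo <= a + t * (b - a) <= hi) by (intros t Ht; nra).
  intros t Ht eps Hep. destruct (He _ (Hin t Ht) eps Hep) as (d & D & Hd).
  pose proof (Rabs_pos (b - a)).
  exists (d / (Rabs (b - a) + 1)). split; [apply Rdiv_lt_0_compat; lra|].
  intros s Hs Hst. apply Hd; auto.
  replace (a + s * (b - a) - (a + t * (b - a))) with ((s - t) * (b - a)) by ring.
  rewrite Rabs_mult. pose proof (Rabs_pos (s - t)).
  apply (Rmult_lt_compat_r (Rabs (b - a) + 1)) in Hst; [|lra].
  replace (d / (Rabs (b - a) + 1) * (Rabs (b - a) + 1)) with d in Hst by (field; lra). nra.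
Qed.

Section BoundedAnalytic.

Variables (phi : C -> C) (M0 : R).
Hypothesis phi_diff : forall z, Cmod z < 1 -> cdiff phi z.
Hypothesis phi_bound : forall z, Cmod z < 1 -> Cmod (phi z) <= M0.

(** [small_path_bound] for [phi - w] scaled into the unit disk, read backwards: [L] is so large that
    [exp (- (c * L))] is below the scaled [eta], and [eps] is what this [L] demands on the path. The
    uniformity in [e] and [z0] is what the boundary results rest on. *)
Lemma near_path_value (r0 C0 c0 : R) (w : C) (eta : R) :
  0 < r0 <= 1 -> 0 < C0 -> 0 < c0 <= r0 / 2 -> 0 < eta ->
  exists eps, 0 < eps /\ forall (e : R -> C) (z0 : C),
    Cmod z0 < 1 -> pcont_on 0 1 e -> (forall t, 0 <= t <= 1 -> r0 <= Cmod (e t)) ->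
    (forall t, 0 <= t <= 1 -> near_value phi w eps (e t)) ->
    Cmod (e 0 - z0) <= C0 * (1 - Cmod z0) -> c0 * (1 - Cmod z0) <= Cmod (e 1 - e 0) ->
    Cmod (phi z0 - w) < eta.
Proof.
  intros Hr0 HC0 Hc0 Heta.
  destruct (small_path_bound r0 C0 c0 Hr0 HC0 Hc0) as (c & Hc & HH).
  assert (HM0 : 0 <= M0).
  { eapply Rle_trans; [apply Cmod_ge_0|apply (phi_bound 0)]. rewrite Cmod_0. lra. }
  pose proof (Cmod_ge_0 w). set (M := M0 + Cmod w + 1). assert (HM : 0 < M) by (unfold M; lra).
  set (L := Rmax 1 ((1 - ln (eta / M)) / c)).
  assert (HL : 1 <= L) by apply Rmax_l.
  assert (HL2 : exp (- (c * L)) < eta / M).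
  { assert (E : (1 - ln (eta / M)) / c <= L) by apply Rmax_r.
    apply (Rmult_le_compat_r c) in E; [|lra].
    replace ((1 - ln (eta / M)) / c * c) with (1 - ln (eta / M)) in E by (field; lra).
    rewrite <- (exp_ln (eta / M)) by (apply Rdiv_lt_0_compat; lra).
    apply exp_increasing. lra. }
  exists (M * exp (- L)). split; [apply Rmult_lt_0_compat; auto; apply exp_pos|].
  intros e z0 Hz0 He Her Hsm Hst Hfar.
  set (f := fun z => (RtoC (/ M) * (phi z + - w))%C).
  assert (Ef : forall z, Cmod (f z) = Cmod (phi z - w) / M).
  { intros z. unfold f. rewrite Cmod_mult, Cmod_R, Rabs_pos_eq by (left; apply Rinv_0_lt_compat; auto).
    unfold Rdiv, Cminus. ring. }
  assert (Hlt : forall z x, Cmod (phi z - w) < M * x -> Cmod (f z) < x).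
  { intros z x Hx. rewrite Ef. apply (Rmult_lt_reg_r M); auto.
    replace (Cmod (phi z - w) / M * M) with (Cmod (phi z - w)) by (field; lra). lra. }
  assert (Hf : Cmod (f z0) <= exp (- (c * L))).
  { apply (HH f e z0 L); auto; try lra.
    - intros z Hz. apply cdiff_mult; [apply cdiff_const|].
      apply cdiff_plus; [auto|apply cdiff_const].
    - intros z Hz. rewrite Ef. apply div_le_of_le_mul; auto.
      pose proof (Cmod_triangle (phi z) (- w)). rewrite Cmod_opp in H0.
      specialize (phi_bound z Hz). unfold M, Cminus. lra.
    - intros t Ht. destruct (Hsm t Ht) as [[H1 H2]|[H1 H2]].
      + left. split; auto.
      + right. split; auto. intros delta Hd. destruct (H2 delta Hd) as (r & Hr & Hr2). exists r; auto. }
  rewrite Ef in Hf.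
  assert (Hq : Cmod (phi z0 - w) / M < eta / M) by lra.
  apply (Rmult_lt_compat_r M) in Hq; auto.
  replace (Cmod (phi z0 - w) / M * M) with (Cmod (phi z0 - w)) in Hq by (field; lra).
  replace (eta / M * M) with eta in Hq by (field; lra). auto.
Qed.

Hypothesis phi_loc_inj : forall z, Cmod z < 1 -> exists r, 0 < r /\
  forall x y, Cmod (x - z) < r -> Cmod (y - z) < r -> phi x = phi y -> x = y.

(** By local injectivity [phi] cannot equal [w] on a whole piece of the radius through [b], and
    compactness makes the deviation uniform. The range of [x] puts the point at a depth of at least
    [1 / 4], however close [b] is to the circle. *)
Lemma value_gap (w : C) (r1 : R) : 0 < r1 -> exists eta, 0 < eta /\
  forall b, r1 <= Cmod b <= 1 -> exists x, 1 / 4 <= x <= 1 / 2 /\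
    eta <= Cmod (phi (RtoC (1 - x) * b)%C - w).
Proof.
  intros Hr1.
  destruct (plane_gauge_choice (fun b d => forall b', r1 <= Cmod b' <= 1 -> Cmod (b' - b) < d ->
    exists x, 1 / 4 <= x <= 1 / 2 /\ d <= Cmod (phi (RtoC (1 - x) * b')%C - w)) 1)
    as (d & D & HH).
  - intros b. destruct (Rlt_dec (Cmod b) r1) as [H1|H1].
    { exists (r1 - Cmod b). split; [lra|]. intros b' Hb' Hd. exfalso.
      pose proof (Cmod_sub_lower b' b). lra. }
    destruct (Rlt_dec 1 (Cmod b)) as [H2|H2].
    { exists (Cmod b - 1). split; [lra|]. intros b' Hb' Hd. exfalso.
      pose proof (Cmod_sub_lower b b'). rewrite Cmod_sub_sym in H. lra. }
    assert (Hin : forall x b', 1 / 4 <= x <= 1 / 2 -> Cmod b' <= 1 -> Cmod (RtoC (1 - x) * b') < 1).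
    { intros x b' Hx Hb'. rewrite Cmod_mult, Cmod_R, Rabs_pos_eq by lra.
      pose proof (Cmod_ge_0 b'). nra. }
    assert (Hx : exists x, 1 / 4 <= x <= 1 / 2 /\ phi (RtoC (1 - x) * b)%C <> w).
    { destruct (classic (phi (RtoC (1 - 1 / 4) * b)%C = w)) as [E|E].
      2: { exists (1 / 4). split; [lra|auto]. }
      destruct (phi_loc_inj (RtoC (1 - 1 / 4) * b)%C) as (r & Hr & Hinj).
      { apply Hin; lra. }
      set (x := 1 / 4 + Rmin (1 / 4) (r / 2)).
      assert (M1 := Rmin_l (1 / 4) (r / 2)). assert (M2 := Rmin_r (1 / 4) (r / 2)).
      assert (M3 : 0 < Rmin (1 / 4) (r / 2)) by (apply Rmin_pos; lra).
      exists x. split; [unfold x; lra|]. intros E2.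
      assert (Ed : (RtoC (1 - x) * b - RtoC (1 - 1 / 4) * b = RtoC (1 / 4 - x) * b)%C).
      { rewrite !RtoC_minus. ring. }
      assert (Em : Cmod (RtoC (1 / 4 - x) * b) = Rmin (1 / 4) (r / 2) * Cmod b).
      { rewrite Cmod_mult, Cmod_R. f_equal. unfold x. rewrite Rabs_left; lra. }
      assert (E3 : (RtoC (1 - x) * b)%C = (RtoC (1 - 1 / 4) * b)%C).
      { apply Hinj; [|rewrite Cmod_sub_self; auto|rewrite E, E2; auto].
        rewrite Ed, Em. nra. }
      assert (Z : Cmod (RtoC (1 - x) * b - RtoC (1 - 1 / 4) * b) = 0) by (rewrite E3; apply Cmod_sub_self).
      rewrite Ed, Em in Z. nra. }
    destruct Hx as (x & Hx & Hne).
    set (mu := Cmod (phi (RtoC (1 - x) * b)%C - w)).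
    assert (Hmu : 0 < mu).
    { apply Cmod_gt_0. intros E. apply Hne.
      replace (phi (RtoC (1 - x) * b)%C) with (phi (RtoC (1 - x) * b) - w + w)%C by ring. rewrite E. ring. }
    destruct (cdiff_cont phi (RtoC (1 - x) * b)%C) with (eps := mu / 2) as (d & D & Hd); [|lra|].
    { apply phi_diff, Hin; lra. }
    exists (Rmin d (mu / 2)). split; [apply Rmin_pos; lra|].
    pose proof (Rmin_l d (mu / 2)). pose proof (Rmin_r d (mu / 2)).
    intros b' Hb' Hbb. exists x. split; auto.
    assert (Hd2 : Cmod (RtoC (1 - x) * b' - RtoC (1 - x) * b) < d).
    { replace (RtoC (1 - x) * b' - RtoC (1 - x) * b)%C with (RtoC (1 - x) * (b' - b))%C by ring.
      rewrite Cmod_mult, Cmod_R, Rabs_pos_eq by lra. pose proof (Cmod_ge_0 (b' - b)).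
      apply Rle_lt_trans with (1 * Cmod (b' - b)); [apply Rmult_le_compat_r; lra|lra]. }
    specialize (Hd _ Hd2).
    pose proof (Cmod_sub_trans (phi (RtoC (1 - x) * b)%C) (phi (RtoC (1 - x) * b')%C) w) as T.
    rewrite (Cmod_sub_sym (phi (RtoC (1 - x) * b)%C) (phi (RtoC (1 - x) * b')%C)) in T. fold mu in T. lra.
  - exists d. split; auto. intros b Hb. destruct (HH b ltac:(lra)) as (u & e & H1 & H2 & H3).
    destruct (H1 b Hb H2) as (x & Hx & Hge). exists x. split; auto. lra.
Qed.

(** A path of definite size with values near [w] would, by [near_path_value], force a value near [w]
    at every point [(1 - x) e 0] with [x] between [1 / 4] and [1 / 2], against [value_gap]. *)
Lemma path_near_value_small (w : C) (eps0 : R) : 0 < eps0 -> exists eta, 0 < eta /\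
  forall e, pcont_on 0 1 e ->
    (forall t, 0 <= t <= 1 -> Cmod (e t) < 1 /\ Cmod (phi (e t) - w) < eta) -> Cmod (e 1 - e 0) < eps0.
Proof.
  intros Hep.
  set (e1 := Rmin eps0 1). assert (He1 : 0 < e1) by (apply Rmin_pos; lra).
  assert (He2 : e1 <= eps0) by apply Rmin_l. assert (He3 : e1 <= 1) by apply Rmin_r.
  destruct (value_gap w (e1 / 2) ltac:(lra)) as (eta & Heta & Hgap).
  destruct (near_path_value (e1 / 4) 2 (e1 / 8) w eta) as (eps & Heps & HH); try lra.
  assert (Main : forall e, pcont_on 0 1 e ->
    (forall t, 0 <= t <= 1 -> Cmod (e t) < 1 /\ Cmod (phi (e t) - w) < eps) ->
    e1 / 2 <= Cmod (e 0) -> Cmod (e 1 - e 0) < e1).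
  { intros e He Hv H0. apply Rnot_le_lt. intros Hge.
    destruct (first_hit (fun t => Cmod (e t - e 0)) 0 1 (e1 / 4)) as (u & Hu & Eu & Hlt).
    { lra. }
    { apply (pcont_lip (fun z => Cmod (z - e 0))); auto. apply Cmod_dist_lip. }
    { rewrite Cmod_sub_self. lra. }
    simpl in Eu.
    destruct (Hgap (e 0)) as (x & Hx & Hx2). { destruct (Hv 0 ltac:(lra)). lra. }
    pose proof (pcont_reparam e 0 1 0 u ltac:(lra) ltac:(lra) He) as He'.
    destruct (Hv 0 ltac:(lra)) as [He0 _].
    assert (Ez : Cmod (RtoC (1 - x) * e 0) = (1 - x) * Cmod (e 0)).
    { rewrite Cmod_mult, Cmod_R, Rabs_pos_eq; lra. }
    pose proof (Cmod_ge_0 (e 0)).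
    specialize (HH (fun t => e (0 + t * (u - 0))) (RtoC (1 - x) * e 0)%C). cbv beta in HH.
    rewrite Ez in HH.
    replace (0 + 0 * (u - 0)) with 0 in HH by ring.
    replace (0 + 1 * (u - 0)) with u in HH by ring.
    assert (Cmod (phi (RtoC (1 - x) * e 0)%C - w) < eta); [|lra].
    apply HH; auto.
    - nra.
    - intros t Ht. assert (Hin : 0 <= 0 + t * (u - 0) <= u) by nra.
      set (v := 0 + t * (u - 0)) in *.
      assert (Cmod (e v - e 0) <= e1 / 4).
      { destruct (Req_dec v u) as [->|]; [lra|]. left. apply Hlt. lra. }
      pose proof (Cmod_sub_lower (e 0) (e v)). rewrite Cmod_sub_sym in H2. lra.
    - intros t Ht. left. apply Hv. nra.
    - replace (e 0 - RtoC (1 - x) * e 0)%C with (RtoC x * e 0)%C by (rewrite RtoC_minus; ring).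
      rewrite Cmod_mult, Cmod_R, Rabs_pos_eq by lra. nra.
    - rewrite Eu. assert (1 - (1 - x) * Cmod (e 0) <= 1) by nra. nra. }
  exists eps. split; auto. intros e He Hv.
  (* [Main] needs a start away from the origin. Otherwise the path is reversed; if both ends are
     within [e1 / 2] of 0, they are within [e1] of each other. *)
  destruct (Rle_lt_dec (e1 / 2) (Cmod (e 0))) as [H0|H0].
  { specialize (Main e He Hv H0). lra. }
  destruct (Rle_lt_dec (e1 / 2) (Cmod (e 1))) as [H1|H1].
  - pose proof (pcont_reparam e 0 1 1 0 ltac:(lra) ltac:(lra) He) as He'.
    specialize (Main (fun t => e (1 + t * (0 - 1))) He'). cbv beta in Main.
    replace (1 + 0 * (0 - 1)) with 1 in Main by ring.
    replace (1 + 1 * (0 - 1)) with 0 in Main by ring.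
    rewrite Cmod_sub_sym. apply Rlt_le_trans with e1; auto. apply Main; auto.
    intros t Ht. apply Hv. lra.
  - pose proof (Cmod_triangle (e 1) (- e 0)) as T. rewrite Cmod_opp in T.
    unfold Cminus. lra.
Qed.

Definition radial_lim (alpha w : C) : Prop :=
  forall eps, 0 < eps -> exists delta, 0 < delta /\
    forall r, 0 <= r < 1 -> 1 - delta < r -> Cmod (phi (RtoC r * alpha)%C - w) < eps.

Lemma near_value_radial alpha v w eps : Cmod alpha = 1 -> radial_lim alpha v ->
  Cmod (v - w) < eps -> near_value phi w eps alpha.
Proof.
  intros Ha Hv Hw. right. split; auto. intros delta Hd.
  destruct (Hv (eps - Cmod (v - w))) as (d & D & H); [lra|].
  set (m := Rmin delta (Rmin d 1)).
  assert (M1 : m <= delta) by apply Rmin_l.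
  assert (M2 : m <= d) by (eapply Rle_trans; [apply Rmin_r|apply Rmin_l]).
  assert (M3 : m <= 1) by (eapply Rle_trans; [apply Rmin_r|apply Rmin_r]).
  assert (M4 : 0 < m) by (repeat apply Rmin_pos; lra).
  exists (1 - m / 2). split; [lra|].
  specialize (H (1 - m / 2) ltac:(lra) ltac:(lra)).
  pose proof (Cmod_sub_trans (phi (RtoC (1 - m / 2) * alpha)%C) v w). lra.
Qed.

(** Here [z] is nontangential to a nearby point [chat s] of the lift rather than to [chat s0].
    Continuity of the homotopy in the converse needs this uniformity, since both parameters vary
    there. *)
Lemma nontangential_limit_along_lift (chat c : R -> C) (s0 : R) (eta C0 : R) :
  pcont_on 0 1 chat -> pcont_on 0 1 c ->
  (forall s, 0 <= s <= 1 -> (Cmod (chat s) < 1 /\ c s = phi (chat s)) \/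
     (Cmod (chat s) = 1 /\ radial_lim (chat s) (c s))) ->
  0 <= s0 <= 1 -> Cmod (chat s0) = 1 -> 0 < eta -> 0 < C0 ->
  exists delta, 0 < delta /\ forall s z, 0 <= s <= 1 -> Rabs (s - s0) < delta -> Cmod z < 1 ->
    Cmod (z - chat s) <= C0 * (1 - Cmod z) -> Cmod (z - chat s0) < delta ->
    Cmod (phi z - c s0) < eta.
Proof.
  intros Hch Hc Hl Hs0 Hal Heta HC0. set (w := c s0). set (alpha := chat s0) in *.
  destruct (near_path_value (1 / 2) (C0 + 1) (1 / 8) w eta) as (eps & Heps & HH); try lra.
  assert (Hrad : radial_lim alpha w).
  { destruct (Hl s0 Hs0) as [[H _]|[_ H]]; auto. fold alpha in H. lra. }
  destruct (Hrad eps Heps) as (d1 & D1 & Hd1).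
  destruct (Hc s0 Hs0 eps Heps) as (d2 & D2 & Hd2).
  destruct (Hch s0 Hs0 (1 / 2)) as (d3 & D3 & Hd3); [lra|]. fold alpha in Hd3. fold w in Hd2.
  set (rho := Rmin (d1 / 2) (1 / 2)).
  assert (R1 : rho <= d1 / 2) by apply Rmin_l. assert (R2 : rho <= 1 / 2) by apply Rmin_r.
  assert (R3 : 0 < rho) by (apply Rmin_pos; lra).
  set (delta := Rmin rho (Rmin d2 d3)).
  assert (X1 : delta <= rho) by apply Rmin_l.
  assert (X2 : delta <= d2) by (eapply Rle_trans; [apply Rmin_r|apply Rmin_l]).
  assert (X3 : delta <= d3) by (eapply Rle_trans; [apply Rmin_r|apply Rmin_r]).
  exists delta. split. { repeat apply Rmin_pos; lra. }
  intros s z Hs Hss Hz Hzs Hza.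
  assert (Hd : 1 - Cmod z < delta).
  { pose proof (Cmod_sub_lower alpha z). rewrite Cmod_sub_sym in H. lra. }
  (* If [chat s] is far from [alpha] compared with the depth of [z], the lift between them is the
     continuum. Otherwise [z] is nontangential to [alpha] itself, and the radius at [alpha] is the
     continuum. *)
  destruct (Rle_lt_dec (1 / 8 * (1 - Cmod z)) (Cmod (alpha - chat s))) as [Hfar|Hnear].
  - pose proof (pcont_reparam chat 0 1 s s0 Hs Hs0 Hch) as He.
    specialize (HH (fun t => chat (s + t * (s0 - s))) z Hz He). cbv beta in HH.
    replace (s + 0 * (s0 - s)) with s in HH by ring.
    replace (s + 1 * (s0 - s)) with s0 in HH by ring.
    assert (Hin : forall t, 0 <= t <= 1 -> 0 <= s + t * (s0 - s) <= 1 /\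
      Rabs (s + t * (s0 - s) - s0) < delta).
    { intros t Ht. split; [nra|].
      replace (s + t * (s0 - s) - s0) with ((1 - t) * (s - s0)) by ring.
      rewrite Rabs_mult, (Rabs_pos_eq (1 - t)) by lra. pose proof (Rabs_pos (s - s0)). nra. }
    apply HH; auto.
    + intros t Ht. destruct (Hin t Ht) as [I1 I2]. set (v := s + t * (s0 - s)) in *.
      specialize (Hd3 v I1 ltac:(lra)). pose proof (Cmod_sub_lower alpha (chat v)).
      rewrite Cmod_sub_sym in H. lra.
    + intros t Ht. destruct (Hin t Ht) as [I1 I2]. set (v := s + t * (s0 - s)) in *.
      specialize (Hd2 v I1 ltac:(lra)).
      destruct (Hl v I1) as [[L1 L2]|[L1 L2]].
      * left. split; auto. rewrite <- L2. auto.
      * apply (near_value_radial _ (c v)); auto.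
    + rewrite Cmod_sub_sym. lra.
  - assert (Hza2 : Cmod (alpha - z) <= (C0 + 1) * (1 - Cmod z)).
    { pose proof (Cmod_sub_trans alpha (chat s) z). rewrite (Cmod_sub_sym (chat s) z) in H. lra. }
    set (e := fun t => (RtoC (1 - t * rho) * alpha)%C).
    assert (Em : forall t, 0 <= t <= 1 -> Cmod (e t) = 1 - t * rho).
    { intros t Ht. unfold e. rewrite Cmod_mult, Hal, Cmod_R, Rabs_pos_eq; nra. }
    assert (Ed : forall s t, Cmod (e s - e t) = Rabs (s - t) * rho).
    { intros s' t. unfold e.
      replace (RtoC (1 - s' * rho) * alpha - RtoC (1 - t * rho) * alpha)%C
        with (RtoC ((t - s') * rho) * alpha)%C.
      - rewrite Cmod_mult, Hal, Cmod_R, Rabs_mult, (Rabs_pos_eq rho), Rabs_minus_sym by lra. ring.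
      - replace ((t - s') * rho) with ((1 - s' * rho) - (1 - t * rho)) by ring.
        rewrite (RtoC_minus (1 - s' * rho)). ring. }
    assert (E0 : e 0 = alpha).
    { unfold e. replace (1 - 0 * rho) with 1 by ring. ring. }
    apply (HH e z Hz).
    + intros t Ht ep Hep. exists ep. split; auto. intros s' Hs' Hst. rewrite Ed.
      pose proof (Rabs_pos (s' - t)). nra.
    + intros t Ht. rewrite Em; nra.
    + intros t Ht. destruct (Req_dec t 0) as [->|Hn].
      * rewrite E0. apply (near_value_radial _ w); auto. rewrite Cmod_sub_self. auto.
      * left. rewrite Em by auto. split; [nra|]. unfold e. apply Hd1; nra.
    + rewrite E0. auto.
    + rewrite Ed. rewrite Rabs_pos_eq by lra. lra.
Qed.

Lemma lindelof (e : R -> C) (alpha w : C) :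
  Cmod alpha = 1 -> (forall T, T < 1 -> pcont_on 0 T e) -> (forall t, 0 <= t < 1 -> Cmod (e t) < 1) ->
  (forall eps, 0 < eps -> exists T, 0 <= T < 1 /\ forall t, T <= t < 1 ->
     Cmod (e t - alpha) < eps /\ Cmod (phi (e t) - w) < eps) ->
  radial_lim alpha w.
Proof.
  intros Ha He Hin Hlim eta Heta.
  destruct (near_path_value (1 / 2) 2 (1 / 8) w eta) as (eps & Heps & HH); try lra.
  destruct (Hlim (Rmin eps (1 / 2))) as (T & HT & HlT); [apply Rmin_pos; lra|].
  pose proof (Rmin_l eps (1 / 2)). pose proof (Rmin_r eps (1 / 2)).
  set (rho := Cmod (e T - alpha)).
  assert (Hrho : 0 < rho).
  { unfold rho. pose proof (Cmod_sub_lower alpha (e T)). rewrite Cmod_sub_sym in H1.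
    specialize (Hin T HT). lra. }
  exists rho. split; auto. intros r Hr Hr2. set (d := 1 - r). assert (Hd : 0 < d) by (unfold d; lra).
  (* The continuum is a compact piece of the path, from a time so late that it is within [d] of
     [alpha] back to the fixed time [T], at distance [rho] from [alpha]. The late time depends on
     [r], as nothing is known about [e] at 1. *)
  destruct (Hlim (Rmin d (rho / 2))) as (T1 & HT1 & HlT1); [apply Rmin_pos; lra|].
  pose proof (Rmin_l d (rho / 2)). pose proof (Rmin_r d (rho / 2)).
  set (T2 := Rmax T T1). assert (HT2 : T <= T2) by apply Rmax_l. assert (HT3 : T1 <= T2) by apply Rmax_r.
  assert (HT4 : T2 < 1) by (apply Rmax_lub_lt; lra).
  destruct (HlT1 T2 ltac:(lra)) as [N1 _].
  assert (Ez : Cmod (RtoC r * alpha) = r) by (rewrite Cmod_mult, Ha, Cmod_R, Rabs_pos_eq; lra).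
  pose proof (pcont_reparam e 0 T2 T2 T ltac:(lra) ltac:(lra) (He T2 HT4)) as He'.
  specialize (HH (fun t => e (T2 + t * (T - T2))) (RtoC r * alpha)%C).
  cbv beta in HH. rewrite Ez in HH. fold d in HH.
  replace (T2 + 0 * (T - T2)) with T2 in HH by ring.
  replace (T2 + 1 * (T - T2)) with T in HH by ring.
  assert (Hrange : forall t, 0 <= t <= 1 -> T <= T2 + t * (T - T2) < 1) by (intros t Ht; nra).
  apply HH; auto; try lra.
  - intros t Ht. destruct (HlT _ (Hrange t Ht)) as [L1 _].
    pose proof (Cmod_sub_lower alpha (e (T2 + t * (T - T2)))). rewrite Cmod_sub_sym in H3. lra.
  - intros t Ht. left. split; [apply Hin; specialize (Hrange t Ht); lra|].
    destruct (HlT _ (Hrange t Ht)) as [_ L2]. lra.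
  - pose proof (Cmod_sub_trans (e T2) alpha (RtoC r * alpha)) as Tr.
    replace (alpha - RtoC r * alpha)%C with (RtoC d * alpha)%C in Tr
      by (unfold d; rewrite RtoC_minus; ring).
    rewrite Cmod_mult, Ha, Cmod_R, Rabs_pos_eq in Tr by lra. lra.
  - pose proof (Cmod_sub_trans (e T) (e T2) alpha) as Tr. fold rho in Tr.
    assert (d < rho) by (unfold d; lra). lra.
Qed.

End BoundedAnalytic.

(** * Lifting through a covering of the plane *)

Lemma Cnorm_Cmod (z : C) : Cnorm z = Cmod z.
Proof. unfold Cnorm, Cmod. f_equal. ring. Qed.

Lemma Cnorm_Csub (z w : C) : Cnorm (Csub z w) = Cmod (z - w).
Proof. apply Cnorm_Cmod. Qed.

Lemma holomorphic_cdiff (f : C -> C) : holomorphic_on in_disk f -> forall z, Cmod z < 1 -> cdiff f z.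
Proof.
  intros H z Hz. destruct (H z) as [l Hl]. { unfold in_disk. rewrite Cnorm_Cmod. auto. }
  exists (fun w => if excluded_middle_informative (w = z) then l else ((f w - f z) / (w - z))%C). split.
  - intros eps He. destruct (Hl (eps / 2)) as (d & D & Hd); [lra|].
    exists (Rmin d (1 - Cmod z)). split; [apply Rmin_pos; lra|]. intros w Hw.
    pose proof (Rmin_l d (1 - Cmod z)). pose proof (Rmin_r d (1 - Cmod z)).
    destruct (excluded_middle_informative (z = z)) as [_|n]; [|contradiction].
    destruct (excluded_middle_informative (w = z)) as [_|n]; [rewrite Cmod_sub_self; auto|].
    assert (Hwz : (w - z)%C <> 0).
    { intros E. apply n. replace w with (w - z + z)%C by ring. rewrite E. ring. }
    specialize (Hd (w - z)%C). rewrite !Cnorm_Cmod in Hd.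
    assert (E : Cadd z (w - z)%C = w) by (change ((z + (w - z))%C = w :> C); ring).
    rewrite E in Hd.
    specialize (Hd ltac:(lra)). unfold in_disk in Hd. rewrite Cnorm_Cmod in Hd.
    pose proof (Cmod_sub_lower w z) as L. specialize (Hd ltac:(lra)).
    change (Csub (Csub (f w) (f z)) (Cmul l (w - z)%C)) with ((f w - f z) - l * (w - z))%C in Hd.
    replace ((f w - f z) / (w - z) - l)%C with (((f w - f z) - l * (w - z)) / (w - z))%C by (field; auto).
    assert (0 < Cmod (w - z)) by (apply Cmod_gt_0; auto).
    rewrite Cmod_div by auto.
    apply Rle_lt_trans with (eps / 2); [|lra]. apply div_le_of_le_mul; auto.
  - intros w. destruct (excluded_middle_informative (w = z)) as [->|n]; [ring|]. field.
    intros E. apply n. replace w with (w - z + z)%C by ring. rewrite E. ring.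
Qed.

Lemma interval_clopen (A : R -> Prop) (a b : R) : a <= b -> A a ->
  (forall t, a <= t <= b -> A t -> exists d, 0 < d /\ forall s, a <= s <= b -> Rabs (s - t) < d -> A s) ->
  (forall t, a <= t <= b -> ~ A t -> exists d, 0 < d /\ forall s, a <= s <= b -> Rabs (s - t) < d -> ~ A s) ->
  A b.
Proof.
  intros Hab Ha H1 H2. apply NNPP. intros HN.
  set (g := fun t => if excluded_middle_informative (A t) then 0 else 1).
  destruct (ivt_on g a b (1 / 2)) as (u & _ & Hu); auto.
  - intros t Ht eps He. destruct (classic (A t)) as [At|At].
    + destruct (H1 t Ht At) as (d & D & Hd). exists d. split; auto. intros s Hs Hst.
      specialize (Hd s Hs Hst). unfold g.
      destruct (excluded_middle_informative (A s)); [|contradiction].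
      destruct (excluded_middle_informative (A t)); [|contradiction].
      rewrite Rminus_diag, Rabs_R0. auto.
    + destruct (H2 t Ht At) as (d & D & Hd). exists d. split; auto. intros s Hs Hst.
      specialize (Hd s Hs Hst). unfold g.
      destruct (excluded_middle_informative (A s)); [contradiction|].
      destruct (excluded_middle_informative (A t)); [contradiction|].
      rewrite Rminus_diag, Rabs_R0. auto.
  - left. unfold g. destruct (excluded_middle_informative (A a)); [|contradiction].
    destruct (excluded_middle_informative (A b)); [contradiction|]. lra.
  - unfold g in Hu. destruct (excluded_middle_informative (A u)); lra.
Qed.

(** The step is allowed between any [a <= b] near [t], on either side of it, so that at a supremum
    the property is carried from a point just below to one just beyond. *)
Lemma chain_induction (P : R -> Prop) : P 0 ->
  (forall t, 0 <= t <= 1 -> exists d, 0 < d /\ forall a b, 0 <= a <= b -> b <= 1 ->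
     Rabs (a - t) < d -> Rabs (b - t) < d -> P a -> P b) ->
  P 1.
Proof.
  intros H0 Hs.
  destruct (completeness (fun x => 0 <= x <= 1 /\ P x)) as [S [HS1 HS2]].
  { exists 1. intros x [Hx _]. lra. } { exists 0. split; [lra|auto]. }
  assert (HS0 : 0 <= S) by (apply HS1; split; [lra|auto]).
  assert (HSle : S <= 1) by (apply HS2; intros x [Hx _]; lra).
  destruct (Hs S ltac:(lra)) as (d & D & Hd).
  assert (Ha : exists a, 0 <= a <= 1 /\ P a /\ S - d < a).
  { apply NNPP. intros HN. assert (S <= S - d); [|lra]. apply HS2. intros x [Hx Px].
    apply Rnot_lt_le. intros Hl. apply HN. exists x. auto. }
  destruct Ha as (a & Ha & Pa & HaS). assert (HaS2 : a <= S) by (apply HS1; auto).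
  set (b := Rmin 1 (S + d / 2)).
  assert (Hb1 : b <= 1) by apply Rmin_l. assert (Hb2 : b <= S + d / 2) by apply Rmin_r.
  assert (Hb3 : S <= b) by (apply Rmin_glb; lra).
  assert (Pb : P b).
  { apply (Hd a b); auto; try lra; apply Rabs_lt_between; lra. }
  assert (HbS : b <= S) by (apply HS1; split; [lra|auto]).
  destruct (Rle_lt_dec 1 (S + d / 2)) as [H|H].
  - unfold b in Pb. rewrite Rmin_left in Pb; auto.
  - unfold b in HbS. rewrite Rmin_right in HbS; lra.
Qed.

Lemma pcont_glue (e1 e2 : R -> C) (lo a b : R) : lo <= a <= b ->
  pcont_on lo a e1 -> pcont_on a b e2 -> e1 a = e2 a ->
  pcont_on lo b (fun s => if Rle_dec s a then e1 s else e2 s).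
Proof.
  intros Hab H1 H2 E t Ht eps He.
  destruct (Rtotal_order t a) as [Hta|[Hta|Hta]].
  - destruct (H1 t ltac:(lra) eps He) as (d & D & Hd).
    exists (Rmin d (a - t)). split; [apply Rmin_pos; lra|]. intros s Hs Hst.
    pose proof (Rmin_l d (a - t)). pose proof (Rmin_r d (a - t)).
    assert (Rabs (s - t) < a - t) by lra. apply Rabs_lt_between in H3.
    destruct (Rle_dec s a); [|lra]. destruct (Rle_dec t a); [|lra]. apply Hd; lra.
  - subst t. destruct (H1 a ltac:(lra) eps He) as (d1 & D1 & Hd1).
    destruct (H2 a ltac:(lra) eps He) as (d2 & D2 & Hd2).
    exists (Rmin d1 d2). split; [apply Rmin_pos; auto|]. intros s Hs Hst.
    pose proof (Rmin_l d1 d2). pose proof (Rmin_r d1 d2).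
    destruct (Rle_dec a a); [|lra]. destruct (Rle_dec s a); [apply Hd1; lra|].
    rewrite E. apply Hd2; lra.
  - destruct (H2 t ltac:(lra) eps He) as (d & D & Hd).
    exists (Rmin d (t - a)). split; [apply Rmin_pos; lra|]. intros s Hs Hst.
    pose proof (Rmin_l d (t - a)). pose proof (Rmin_r d (t - a)).
    assert (Rabs (s - t) < t - a) by lra. apply Rabs_lt_between in H3.
    destruct (Rle_dec s a); [lra|]. destruct (Rle_dec t a); [lra|]. apply Hd; lra.
Qed.

Lemma pcont_comp (g : C -> C) (c : R -> C) (a b : R) : pcont_on a b c ->
  (forall t, a <= t <= b -> ccont g (c t)) -> pcont_on a b (fun t => g (c t)).
Proof.
  intros Hc Hg t Ht eps He. destruct (Hg t Ht eps He) as (d & D & Hd).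
  destruct (Hc t Ht d D) as (d' & D' & Hd'). exists d'. split; auto.
Qed.

Lemma pcont_sub (e : R -> C) a b a' b' : pcont_on a b e -> a <= a' -> b' <= b -> pcont_on a' b' e.
Proof.
  intros H Ha Hb t Ht eps He. destruct (H t ltac:(lra) eps He) as (d & D & Hd).
  exists d. split; auto. intros s Hs. apply Hd. lra.
Qed.

Section Covering.

Variables (Omega : C -> Prop) (phi : C -> C).
Hypothesis cov : covering_map Omega phi.

(** The third clause makes [V] relatively closed in the preimage of the disk around [w]. This is the
    form in which disjointness of sheets is used: together with openness it confines a path to one
    sheet. *)
Definition is_sheet (w : C) (rho : R) (V : C -> Prop) (g : C -> C) : Prop :=
  (forall x, V x -> Cmod x < 1) /\
  (forall x, V x -> exists r, 0 < r /\ forall y, Cmod (y - x) < r -> V y) /\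
  (forall x, Cmod x < 1 -> Cmod (phi x - w) < rho -> ~ V x ->
     exists r, 0 < r /\ forall y, Cmod (y - x) < r -> ~ V y) /\
  (forall x, V x -> g (phi x) = x) /\
  (forall u, Cmod (u - w) < rho -> V (g u) /\ phi (g u) = u /\ ccont g u).

Lemma sheets (w : C) : Omega w -> exists rho, 0 < rho /\
  forall z, Cmod z < 1 -> Cmod (phi z - w) < rho -> exists V g, V z /\ is_sheet w rho V g.
Proof.
  intros Hw. destruct cov as (_ & _ & _ & Hev).
  destruct (Hev w Hw) as (U & Uo & Uw & _ & I & V & Vo & Vd & Vdisj & Vcov & Vg).
  destruct (Uo w Uw) as (rho & Hrho & HU).
  assert (HU' : forall u, Cmod (u - w) < rho -> U u).
  { intros u Hu. apply HU. rewrite Cnorm_Csub. auto. }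
  exists rho. split; auto. intros z Hz Hzw.
  destruct (proj1 (Vcov z ltac:(unfold in_disk; rewrite Cnorm_Cmod; auto)) (HU' _ Hzw)) as [i Hi].
  destruct (Vg i) as (g & G1 & G2 & G3 & G4).
  exists (V i), g. split; auto. repeat split.
  - intros x Hx. specialize (Vd i x Hx). unfold in_disk in Vd. rewrite Cnorm_Cmod in Vd. auto.
  - intros x Hx. destruct (Vo i x Hx) as (r & Hr & H). exists r. split; auto.
    intros y Hy. apply H. rewrite Cnorm_Csub. auto.
  - intros x Hx Hxw Hn.
    destruct (proj1 (Vcov x ltac:(unfold in_disk; rewrite Cnorm_Cmod; auto)) (HU' _ Hxw)) as [j Hj].
    destruct (Vo j x Hj) as (r & Hr & H). exists r. split; auto.
    intros y Hy Hy2. apply Hn. rewrite (Vdisj i j y Hy2); auto. apply H. rewrite Cnorm_Csub. auto.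
  - auto.
  - apply G1; auto.
  - apply G2; auto.
  - intros eps He. destruct (G4 u (HU' u H) eps He) as (d & D & Hd).
    destruct (Uo u (HU' u H)) as (r & Hr & HUr).
    exists (Rmin d r). split; [apply Rmin_pos; auto|]. intros v Hv.
    pose proof (Rmin_l d r). pose proof (Rmin_r d r).
    rewrite <- Cnorm_Csub. apply Hd; [apply HUr|]; rewrite Cnorm_Csub; lra.
Qed.

Lemma covering_loc_inj z : Cmod z < 1 -> exists r, 0 < r /\
  forall x y, Cmod (x - z) < r -> Cmod (y - z) < r -> phi x = phi y -> x = y.
Proof.
  intros Hz. destruct (sheets (phi z)) as (rho & Hrho & HS).
  { apply cov. unfold in_disk. rewrite Cnorm_Cmod. auto. }
  destruct (HS z Hz) as (V & g & Vz & _ & Vo & _ & Vg & _). { rewrite Cmod_sub_self. auto. }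
  destruct (Vo z Vz) as (r & Hr & H). exists r. split; auto.
  intros x y Hx Hy E. rewrite <- (Vg x), <- (Vg y), E by auto. auto.
Qed.

Lemma stays_in_sheet w rho V g (e : R -> C) a b : is_sheet w rho V g -> a <= b ->
  pcont_on a b e -> (forall t, a <= t <= b -> Cmod (e t) < 1 /\ Cmod (phi (e t) - w) < rho) ->
  V (e a) -> V (e b).
Proof.
  intros (S1 & S2 & S3 & S4 & S5) Hab He Hin Ha.
  apply (interval_clopen (fun t => V (e t)) a b); auto.
  - intros t Ht Vt. destruct (S2 _ Vt) as (r & Hr & H).
    destruct (He t Ht r Hr) as (d & D & Hd). exists d. split; auto.
  - intros t Ht Vt. destruct (Hin t Ht) as [I1 I2].
    destruct (S3 _ I1 I2 Vt) as (r & Hr & H).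
    destruct (He t Ht r Hr) as (d & D & Hd). exists d. split; auto.
Qed.

(** A radius whose image tends to a point of [Omega] would end in one sheet. There the local inverse
    [g] carries the image back near [g w], inside the disk, whereas the radius tends to the
    circle. *)
Lemma radial_limit_outside alpha w : Cmod alpha = 1 -> radial_lim phi alpha w -> ~ Omega w.
Proof.
  intros Ha Hl Hw. destruct (sheets w Hw) as (rho & Hrho & HS).
  destruct (Hl rho Hrho) as (d & D & Hd).
  set (m := Rmin (d / 2) (1 / 2)). assert (M1 : m <= d / 2) by apply Rmin_l.
  assert (M2 : m <= 1 / 2) by apply Rmin_r. assert (M3 : 0 < m) by (apply Rmin_pos; lra).
  assert (Em : forall r, 0 <= r -> Cmod (RtoC r * alpha) = r).
  { intros r Hr. rewrite Cmod_mult, Ha, Cmod_R, Rabs_pos_eq; lra. }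
  destruct (HS (RtoC (1 - m) * alpha)%C) as (V & g & Vz & Hsh).
  { rewrite Em; lra. } { apply Hd; lra. }
  destruct Hsh as (S1 & S2 & S3 & S4 & S5) eqn:Es. clear Es.
  assert (HV : forall r, 1 - m <= r < 1 -> V (RtoC r * alpha)%C).
  { intros r Hr. apply (stays_in_sheet w rho V g (fun r => RtoC r * alpha)%C (1 - m) r); auto; [lra| |].
    - intros t Ht eps He. exists eps. split; auto. intros s Hs Hst.
      replace (RtoC s * alpha - RtoC t * alpha)%C with (RtoC (s - t) * alpha)%C by (rewrite RtoC_minus; ring).
      rewrite Cmod_mult, Ha, Cmod_R. lra.
    - intros t Ht. rewrite Em by lra. split; [lra|]. apply Hd; lra. }
  destruct (S5 w) as (G1 & G2 & G3). { rewrite Cmod_sub_self. auto. }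
  assert (Hgw : Cmod (g w) < 1) by auto.
  destruct (G3 ((1 - Cmod (g w)) / 2)) as (d1 & D1 & Hd1); [lra|].
  destruct (Hl d1 D1) as (d2 & D2 & Hd2).
  set (k := Rmin m (Rmin (d2 / 2) ((1 - Cmod (g w)) / 2))).
  assert (K1 : k <= m) by apply Rmin_l.
  assert (K2 : k <= d2 / 2) by (eapply Rle_trans; [apply Rmin_r|apply Rmin_l]).
  assert (K3 : k <= (1 - Cmod (g w)) / 2) by (eapply Rle_trans; [apply Rmin_r|apply Rmin_r]).
  assert (K4 : 0 < k) by (apply Rmin_pos; auto; apply Rmin_pos; lra).
  specialize (Hd2 (1 - k) ltac:(lra) ltac:(lra)). specialize (Hd1 _ Hd2).
  rewrite S4 in Hd1 by (apply HV; lra).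
  pose proof (Cmod_sub_lower (RtoC (1 - k) * alpha) (g w)) as L. rewrite Em in L by lra. lra.
Qed.

Lemma path_lifting (c : R -> C) (z0 : C) : pcont_on 0 1 c -> (forall t, 0 <= t <= 1 -> Omega (c t)) ->
  Cmod z0 < 1 -> phi z0 = c 0 ->
  exists e, e 0 = z0 /\ pcont_on 0 1 e /\ forall t, 0 <= t <= 1 -> Cmod (e t) < 1 /\ phi (e t) = c t.
Proof.
  intros Hc HO Hz0 E0.
  apply (chain_induction (fun b => exists e, e 0 = z0 /\ pcont_on 0 b e /\
    forall t, 0 <= t <= b -> Cmod (e t) < 1 /\ phi (e t) = c t)).
  - exists (fun _ => z0). split; auto. split.
    + intros t Ht eps He. exists 1. split; [lra|]. intros. rewrite Cmod_sub_self. auto.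
    + intros t Ht. replace t with 0 by lra. auto.
  - intros t Ht. destruct (sheets (c t) (HO t Ht)) as (rho & Hrho & HS).
    destruct (Hc t Ht rho Hrho) as (d & D & Hd). exists d. split; auto.
    intros a b Hab Hb Hat Hbt (e & e0 & Ec & Ev).
    assert (Hnear : forall s, a <= s <= b -> Cmod (c s - c t) < rho).
    { intros s Hs. apply Hd; [lra|]. apply Rabs_lt_between in Hat. apply Rabs_lt_between in Hbt.
      apply Rabs_lt_between. lra. }
    destruct (Ev a ltac:(lra)) as [Ea1 Ea2].
    destruct (HS (e a) Ea1) as (V & g & Va & S1 & S2 & S3 & S4 & S5).
    { rewrite Ea2. apply Hnear. lra. }
    exists (fun s => if Rle_dec s a then e s else g (c s)). split; [|split].
    + destruct (Rle_dec 0 a); [auto|lra].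
    + apply (pcont_glue e (fun s => g (c s))); auto.
      * apply pcont_comp; [apply (pcont_sub c 0 1); auto; lra|].
        intros s Hs. apply S5, Hnear. auto.
      * rewrite <- Ea2. symmetry. apply S4. auto.
    + intros s Hs. destruct (Rle_dec s a); [apply Ev; lra|].
      destruct (S5 (c s)) as (G1 & G2 & _); [apply Hnear; lra|]. split; auto.
Qed.

(** Serves both as uniqueness of lifts and as their continuous dependence on the path and the
    starting point; closeness is carried along from sheet to sheet. *)
Lemma lift_stability (c e : R -> C) : pcont_on 0 1 c -> (forall t, 0 <= t <= 1 -> Omega (c t)) ->
  pcont_on 0 1 e -> (forall t, 0 <= t <= 1 -> Cmod (e t) < 1 /\ phi (e t) = c t) ->
  forall eps, 0 < eps -> exists eta, 0 < eta /\ forall c' e', pcont_on 0 1 e' ->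
    (forall t, 0 <= t <= 1 -> Cmod (e' t) < 1 /\ phi (e' t) = c' t) ->
    (forall t, 0 <= t <= 1 -> Cmod (c' t - c t) < eta) -> Cmod (e' 0 - e 0) < eta ->
    Cmod (e' 1 - e 1) < eps.
Proof.
  intros Hc HO He Hl.
  apply (chain_induction (fun b => forall eps, 0 < eps -> exists eta, 0 < eta /\ forall c' e', pcont_on 0 1 e' ->
    (forall t, 0 <= t <= 1 -> Cmod (e' t) < 1 /\ phi (e' t) = c' t) ->
    (forall t, 0 <= t <= 1 -> Cmod (c' t - c t) < eta) -> Cmod (e' 0 - e 0) < eta ->
    Cmod (e' b - e b) < eps)).
  - intros eps Hep. exists eps. auto.
  - intros t Ht. destruct (sheets (c t) (HO t Ht)) as (rho & Hrho & HS).
    destruct (Hl t Ht) as [L1 L2].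
    destruct (HS (e t) L1) as (V & g & Vt & Hsh). { rewrite L2, Cmod_sub_self. auto. }
    pose proof Hsh as (S1 & S2 & S3 & S4 & S5).
    destruct (S2 _ Vt) as (r & Hr & HVr).
    destruct (Hc t Ht (rho / 2)) as (d1 & D1 & Hd1); [lra|].
    destruct (He t Ht (r / 2)) as (d2 & D2 & Hd2); [lra|].
    exists (Rmin d1 d2). split; [apply Rmin_pos; auto|].
    pose proof (Rmin_l d1 d2). pose proof (Rmin_r d1 d2).
    intros a b Hab Hb Hat Hbt Pa eps Hep.
    assert (Hnear : forall s, a <= s <= b -> Cmod (c s - c t) < rho / 2).
    { intros s Hs. apply Hd1; [lra|]. apply Rabs_lt_between in Hat. apply Rabs_lt_between in Hbt.
      apply Rabs_lt_between. lra. }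
    destruct (S5 (c b)) as (_ & _ & G3). { specialize (Hnear b ltac:(lra)). lra. }
    destruct (G3 eps Hep) as (h1 & Hh1 & Hg).
    destruct (Pa (r / 2)) as (h2 & Hh2 & Hpa); [lra|].
    set (eta := Rmin h1 (Rmin h2 (rho / 2))).
    assert (N1 : eta <= h1) by apply Rmin_l.
    assert (N2 : eta <= h2) by (eapply Rle_trans; [apply Rmin_r|apply Rmin_l]).
    assert (N3 : eta <= rho / 2) by (eapply Rle_trans; [apply Rmin_r|apply Rmin_r]).
    exists eta. split. { apply Rmin_pos; auto; apply Rmin_pos; lra. }
    intros c' e' He' Hl' Hcc Hst.
    assert (Hea : Cmod (e' a - e a) < r / 2).
    { apply (Hpa c' e'); auto; [|lra]. intros s Hs. specialize (Hcc s Hs). lra. }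
    assert (Va : V (e' a)).
    { apply HVr. pose proof (Hd2 a ltac:(lra) ltac:(lra)). pose proof (Cmod_sub_trans (e' a) (e a) (e t)). lra. }
    assert (Vb : V (e' b)).
    { apply (stays_in_sheet (c t) rho V g e' a b); auto; [lra|apply (pcont_sub e' 0 1); auto; lra|].
      intros s Hs. destruct (Hl' s ltac:(lra)) as [I1 I2]. split; auto. rewrite I2.
      specialize (Hcc s ltac:(lra)). specialize (Hnear s Hs).
      pose proof (Cmod_sub_trans (c' s) (c s) (c t)). lra. }
    assert (Vb2 : V (e b)).
    { apply HVr. pose proof (Hd2 b ltac:(lra) ltac:(lra)). lra. }
    rewrite <- (S4 _ Vb), <- (S4 _ Vb2).
    destruct (Hl' b ltac:(lra)) as [_ ->]. destruct (Hl b ltac:(lra)) as [_ ->].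
    apply Hg. specialize (Hcc b ltac:(lra)). lra.
Qed.

End Covering.

(** * Lifts of homotopies and homotopies of lifts *)

Lemma continuous_01_pcont (f : R -> C) : continuous_01 f <-> pcont_on 0 1 f.
Proof.
  split; intros H t Ht eps He; destruct (H t Ht eps He) as (d & D & Hd); exists d; split; auto;
    intros s Hs Hst; specialize (Hd s Hs Hst); [rewrite Cnorm_Csub in Hd|rewrite Cnorm_Csub]; auto.
Qed.

Lemma radial_limit_radial_lim (phi : C -> C) (alpha w : C) :
  radial_limit phi alpha w <-> radial_lim phi alpha w.
Proof.
  assert (E : forall r, Cscal r alpha = (RtoC r * alpha)%C :> C).
  { intros r. unfold Cscal, Cmult, RtoC; simpl. f_equal; ring. }
  split; intros H eps He; destruct (H eps He) as (d & D & Hd); exists d; split; auto;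
    intros r Hr Hr2; specialize (Hd r Hr Hr2).
  - rewrite Cnorm_Csub, E in Hd. auto.
  - rewrite Cnorm_Csub, E. auto.
Qed.

Lemma phibar_iff (phi : C -> C) (z w : C) :
  phibar phi z w <-> (Cmod z < 1 /\ w = phi z) \/ (Cmod z = 1 /\ radial_lim phi z w).
Proof. unfold phibar. rewrite Cnorm_Cmod, radial_limit_radial_lim. tauto. Qed.

Definition jcont_at (h : R -> R -> C) (s t : R) : Prop :=
  forall eps, 0 < eps -> exists delta, 0 < delta /\
    forall s' t', 0 <= s' <= 1 -> 0 <= t' <= 1 -> Rabs (s' - s) < delta -> Rabs (t' - t) < delta ->
      Cmod (h s' t' - h s t) < eps.

Lemma continuous_01x01_jcont (h : R -> R -> C) :
  continuous_01x01 h <-> forall s t, 0 <= s <= 1 -> 0 <= t <= 1 -> jcont_at h s t.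
Proof.
  split; intros H s t Hs Ht eps He; destruct (H s t Hs Ht eps He) as (d & D & Hd); exists d; split; auto;
    intros s' t' Hs' Ht' H1 H2; specialize (Hd s' t' Hs' Ht' H1 H2);
    [rewrite Cnorm_Csub in Hd|rewrite Cnorm_Csub]; auto.
Qed.

Lemma square_unif_cont (h : R -> R -> C) (eps : R) : 0 < eps ->
  (forall s t, 0 <= s <= 1 -> 0 <= t <= 1 -> jcont_at h s t) ->
  exists delta, 0 < delta /\ forall s t s' t', 0 <= s <= 1 -> 0 <= t <= 1 -> 0 <= s' <= 1 -> 0 <= t' <= 1 ->
    Rabs (s' - s) < delta -> Rabs (t' - t) < delta -> Cmod (h s' t' - h s t) < eps.
Proof.
  intros He Hc.
  destruct (plane_gauge_choice (fun u d => forall s t s' t', 0 <= s <= 1 -> 0 <= t <= 1 ->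
    0 <= s' <= 1 -> 0 <= t' <= 1 -> Cmod ((s, t) - u) < d -> Rabs (s' - s) < d -> Rabs (t' - t) < d ->
    Cmod (h s' t' - h s t) < eps) 2) as (d & D & HH).
  - intros [x y].
    (* The compactness lemma wants a radius at every point of the plane, so coordinates are clamped
       to [[0,1]]. *)
    set (cl := fun v => Rmin 1 (Rmax 0 v)).
    assert (Hcl : forall v, 0 <= cl v <= 1).
    { intros v. unfold cl. split; [apply Rmin_glb; [lra|apply Rmax_l]|apply Rmin_l]. }
    assert (Hcl2 : forall v s, 0 <= s <= 1 -> Rabs (s - cl v) <= Rabs (s - v)).
    { intros v s Hs. unfold cl, Rmin, Rmax, Rabs.
      repeat (destruct (Rle_dec _ _) || destruct (Rcase_abs _)); lra. }
    destruct (Hc (cl x) (cl y) (Hcl x) (Hcl y) (eps / 2)) as (d & D & Hd); [lra|].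
    exists (d / 2). split; [lra|]. intros s t s' t' Hs Ht Hs' Ht' Hu H1 H2.
    pose proof (fst_le_Cmod ((s, t) - (x, y))) as F1. pose proof (snd_le_Cmod ((s, t) - (x, y))) as F2.
    simpl in F1, F2. change (s + - x) with (s - x) in F1. change (t + - y) with (t - y) in F2.
    pose proof (Hcl2 x s Hs). pose proof (Hcl2 y t Ht).
    assert (Rabs (s' - cl x) < d).
    { replace (s' - cl x) with ((s' - s) + (s - cl x)) by ring.
      eapply Rle_lt_trans; [apply Rabs_triang|]. lra. }
    assert (Rabs (t' - cl y) < d).
    { replace (t' - cl y) with ((t' - t) + (t - cl y)) by ring.
      eapply Rle_lt_trans; [apply Rabs_triang|]. lra. }
    pose proof (Hd s t Hs Ht ltac:(lra) ltac:(lra)). pose proof (Hd s' t' Hs' Ht' ltac:(lra) ltac:(lra)).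
    pose proof (Cmod_sub_trans (h s' t') (h (cl x) (cl y)) (h s t)) as Tr.
    rewrite (Cmod_sub_sym (h (cl x) (cl y)) (h s t)) in Tr. lra.
  - exists d. split; auto. intros s t s' t' Hs Ht Hs' Ht' H1 H2.
    destruct (HH (s, t)) as (u & e & P1 & P2 & P3).
    { eapply Rle_trans; [apply Cmod_le_abs|]. simpl. rewrite !Rabs_pos_eq; lra. }
    apply P1; auto; lra.
Qed.

Lemma left_limit_R (g : R -> R) :
  (forall eps, 0 < eps -> exists T, 0 <= T < 1 /\ forall t t', T <= t < 1 -> T <= t' < 1 ->
     Rabs (g t - g t') < eps) ->
  exists l, forall eps, 0 < eps -> exists T, 0 <= T < 1 /\ forall t, T <= t < 1 -> Rabs (g t - l) < eps.
Proof.
  intros HC.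
  (* The limit is obtained as a limit inferior, the supremum of the eventual lower bounds. *)
  set (E := fun x => exists T, 0 <= T < 1 /\ forall t, T <= t < 1 -> x <= g t).
  assert (ub : forall eps T, 0 <= T < 1 -> (forall t t', T <= t < 1 -> T <= t' < 1 -> Rabs (g t - g t') < eps) ->
    forall x, E x -> x <= g T + eps).
  { intros eps T HT HH x (T' & HT' & Hx).
    set (m := Rmax T T'). assert (M1 : T <= m) by apply Rmax_l. assert (M2 : T' <= m) by apply Rmax_r.
    assert (M3 : m < 1) by (apply Rmax_lub_lt; lra).
    specialize (Hx m ltac:(lra)). specialize (HH m T ltac:(lra) ltac:(lra)).
    apply Rabs_lt_between in HH. lra. }
  assert (lb : forall eps T, 0 <= T < 1 -> (forall t t', T <= t < 1 -> T <= t' < 1 -> Rabs (g t - g t') < eps) ->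
    E (g T - eps)).
  { intros eps T HT HH. exists T. split; auto. intros t Ht. specialize (HH t T Ht ltac:(lra)).
    apply Rabs_lt_between in HH. lra. }
  destruct (HC 1 Rlt_0_1) as (T1 & HT1 & HH1).
  destruct (completeness E) as [l [Hl1 Hl2]].
  { exists (g T1 + 1). intros x Hx. apply (ub 1 T1); auto. }
  { exists (g T1 - 1). apply (lb 1 T1); auto. }
  exists l. intros eps He. destruct (HC (eps / 2)) as (T & HT & HH); [lra|].
  exists T. split; auto. intros t Ht.
  assert (HHt : forall s s', t <= s < 1 -> t <= s' < 1 -> Rabs (g s - g s') < eps / 2).
  { intros s s' Hs Hs'. apply HH; lra. }
  pose proof (Hl1 _ (lb (eps / 2) t ltac:(lra) HHt)).
  assert (l <= g t + eps / 2) by (apply Hl2; intros x Hx; apply (ub (eps / 2) t); auto; lra).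
  apply Rabs_lt_between. lra.
Qed.

Lemma left_limit_C (g : R -> C) :
  (forall eps, 0 < eps -> exists T, 0 <= T < 1 /\ forall t t', T <= t < 1 -> T <= t' < 1 ->
     Cmod (g t - g t') < eps) ->
  exists l, forall eps, 0 < eps -> exists T, 0 <= T < 1 /\ forall t, T <= t < 1 -> Cmod (g t - l) < eps.
Proof.
  intros HC.
  destruct (left_limit_R (fun t => fst (g t))) as [l1 H1].
  { intros eps He. destruct (HC eps He) as (T & HT & HH). exists T. split; auto.
    intros t t' Ht Ht'. eapply Rle_lt_trans; [apply (fst_le_Cmod (g t - g t'))|auto]. }
  destruct (left_limit_R (fun t => snd (g t))) as [l2 H2].
  { intros eps He. destruct (HC eps He) as (T & HT & HH). exists T. split; auto.
    intros t t' Ht Ht'. eapply Rle_lt_trans; [apply (snd_le_Cmod (g t - g t'))|auto]. }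
  exists (l1, l2). intros eps He.
  destruct (H1 (eps / 2)) as (T1 & HT1 & G1); [lra|]. destruct (H2 (eps / 2)) as (T2 & HT2 & G2); [lra|].
  pose proof (Rmax_l T1 T2). pose proof (Rmax_r T1 T2).
  exists (Rmax T1 T2). split; [split; [lra|apply Rmax_lub_lt; lra]|]. intros t Ht.
  eapply Rle_lt_trans; [apply Cmod_le_abs|].
  specialize (G1 t ltac:(lra)). specialize (G2 t ltac:(lra)). simpl.
  change (fst (g t) + - l1) with (fst (g t) - l1). change (snd (g t) + - l2) with (snd (g t) - l2). lra.
Qed.

Lemma Cmod_eq_of_small (z w : C) : (forall eps, 0 < eps -> Cmod (z - w) < eps) -> z = w.
Proof.
  intros H. assert (E : Cmod (z - w) = 0).
  { destruct (Req_dec (Cmod (z - w)) 0) as [|n]; auto. pose proof (Cmod_ge_0 (z - w)).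
    specialize (H (Cmod (z - w)) ltac:(lra)). lra. }
  apply Cmod_eq_0 in E. replace z with (z - w + w)%C by ring. rewrite E. ring.
Qed.

Lemma convex_lt a b c v : a < c -> b < c -> 0 <= v <= 1 -> a + v * (b - a) < c.
Proof.
  intros Ha Hb Hv. assert (0 < (1 - v) * (c - a) + v * (c - b)); [|lra].
  destruct (Rle_lt_dec v (1 / 2)); nra.
Qed.

Lemma convex_gt a b c v : c < a -> c < b -> 0 <= v <= 1 -> c < a + v * (b - a).
Proof.
  intros Ha Hb Hv. assert (0 < (1 - v) * (a - c) + v * (b - c)); [|lra].
  destruct (Rle_lt_dec v (1 / 2)); nra.
Qed.

Section Lifts.

Variables (Omega : C -> Prop) (phi : C -> C) (p q : C) (gamma ghat : R -> C) (M0 : R).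
Hypothesis cov : covering_map Omega phi.
Hypothesis phi_diff : forall z, Cmod z < 1 -> cdiff phi z.
Hypothesis phi_bound : forall z, Cmod z < 1 -> Cmod (phi z) <= M0.
Hypothesis gamma_cont : pcont_on 0 1 gamma.
Hypothesis gamma_0 : gamma 0 = p.
Hypothesis gamma_1 : gamma 1 = q.
Hypothesis gamma_in : forall t, 0 < t < 1 -> Omega (gamma t).
Hypothesis ghat_cont : pcont_on 0 1 ghat.
Hypothesis ghat_lift : forall t, 0 <= t <= 1 ->
  (Cmod (ghat t) < 1 /\ gamma t = phi (ghat t)) \/ (Cmod (ghat t) = 1 /\ radial_lim phi (ghat t) (gamma t)).

Lemma ghat_in t : 0 < t < 1 -> Cmod (ghat t) < 1 /\ phi (ghat t) = gamma t.
Proof.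
  intros Ht. destruct (ghat_lift t ltac:(lra)) as [[H1 H2]|[H1 H2]]; auto.
  exfalso. apply (radial_limit_outside Omega phi cov (ghat t) (gamma t)); auto.
Qed.

(** * Lifting a homotopy up to its final time *)

Section Homotopy.

Variables (h : R -> R -> C).
Hypothesis h_cont : forall s t, 0 <= s <= 1 -> 0 <= t <= 1 -> jcont_at h s t.
Hypothesis h_start : forall s, 0 <= s <= 1 -> h s 0 = gamma s.
Hypothesis h_left : forall t, 0 <= t < 1 -> h 0 t = p.
Hypothesis h_right : forall t, 0 <= t < 1 -> h 1 t = q.
Hypothesis h_in : forall s t, 0 < s < 1 -> 0 <= t < 1 -> Omega (h s t).

(** The point over [(s, T)] is reached along the vertical segment from [ghat s], rescaled to
    [[0,1]]. Each [(s, T)] gets a lift of its own by choice, and [lift_stability] makes its end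
    depend continuously on [(s, T)]. *)
Definition vertical_lift (s T : R) (e : R -> C) : Prop :=
  e 0 = ghat s /\ pcont_on 0 1 e /\ forall u, 0 <= u <= 1 -> Cmod (e u) < 1 /\ phi (e u) = h s (u * T).

Lemma h_line_cont s t s' t' : 0 <= s <= 1 -> 0 <= t <= 1 -> 0 <= s' <= 1 -> 0 <= t' <= 1 ->
  pcont_on 0 1 (fun u => h (s + u * (s' - s)) (t + u * (t' - t))).
Proof.
  intros Hs Ht Hs' Ht' u Hu eps He.
  destruct (h_cont (s + u * (s' - s)) (t + u * (t' - t)) ltac:(nra) ltac:(nra) eps He) as (d & D & Hd).
  exists (d / 2). split; [lra|]. intros v Hv Huv. apply Hd; try nra.
  - replace (s + v * (s' - s) - (s + u * (s' - s))) with ((v - u) * (s' - s)) by ring.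
    rewrite Rabs_mult. assert (Rabs (s' - s) <= 1) by (apply Rabs_le; lra).
    pose proof (Rabs_pos (v - u)). pose proof (Rabs_pos (s' - s)). nra.
  - replace (t + v * (t' - t) - (t + u * (t' - t))) with ((v - u) * (t' - t)) by ring.
    rewrite Rabs_mult. assert (Rabs (t' - t) <= 1) by (apply Rabs_le; lra).
    pose proof (Rabs_pos (v - u)). pose proof (Rabs_pos (t' - t)). nra.
Qed.

Lemma h_vertical_cont s T : 0 <= s <= 1 -> 0 <= T <= 1 -> pcont_on 0 1 (fun u => h s (u * T)).
Proof.
  intros Hs HT u Hu eps He.
  destruct (h_line_cont s 0 s T Hs ltac:(lra) Hs HT u Hu eps He) as (d & D & Hd).
  exists d. split; auto. intros v Hv Huv. specialize (Hd v Hv Huv).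
  replace (s + v * (s - s)) with s in Hd by ring. replace (s + u * (s - s)) with s in Hd by ring.
  replace (0 + v * (T - 0)) with (v * T) in Hd by ring. replace (0 + u * (T - 0)) with (u * T) in Hd by ring.
  auto.
Qed.

Lemma vertical_lift_ex s T : 0 < s < 1 -> 0 <= T < 1 -> exists e, vertical_lift s T e.
Proof.
  intros Hs HT. destruct (ghat_in s Hs) as [G1 G2].
  destruct (path_lifting Omega phi cov (fun u => h s (u * T)) (ghat s)) as (e & E1 & E2 & E3); auto.
  - apply h_vertical_cont; lra.
  - intros u Hu. apply h_in; nra.
  - rewrite G2, Rmult_0_l, h_start; auto. lra.
  - exists e. repeat split; auto; apply E3; auto.
Qed.

Definition lift_path (s T : R) : R -> C := epsilon (inhabits (fun _ => RtoC 0)) (vertical_lift s T).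
Definition hhat (s T : R) : C := lift_path s T 1.

Lemma lift_path_spec s T : 0 < s < 1 -> 0 <= T < 1 -> vertical_lift s T (lift_path s T).
Proof. intros Hs HT. unfold lift_path. apply epsilon_spec, vertical_lift_ex; auto. Qed.

Lemma hhat_spec s T : 0 < s < 1 -> 0 <= T < 1 -> Cmod (hhat s T) < 1 /\ phi (hhat s T) = h s T.
Proof.
  intros Hs HT. destruct (lift_path_spec s T Hs HT) as (_ & _ & H).
  destruct (H 1 ltac:(lra)) as [H1 H2]. rewrite Rmult_1_l in H2. auto.
Qed.

Lemma hhat_start s : 0 < s < 1 -> hhat s 0 = ghat s.
Proof.
  intros Hs. destruct (lift_path_spec s 0 Hs ltac:(lra)) as (E1 & E2 & E3).
  destruct (ghat_in s Hs) as [G1 G2].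
  apply Cmod_eq_of_small. intros eps He.
  destruct (lift_stability Omega phi cov (fun _ => gamma s) (fun _ => ghat s)) with (eps := eps)
    as (eta & Heta & HH); auto.
  - intros t _ e0 He0. exists 1. split; [lra|]. intros. rewrite Cmod_sub_self. auto.
  - intros t _ e0 He0. exists 1. split; [lra|]. intros. rewrite Cmod_sub_self. auto.
  - apply (HH (fun u => h s (u * 0)) (lift_path s 0)); auto.
    + intros t Ht. rewrite Rmult_0_r, h_start, Cmod_sub_self; auto. lra.
    + rewrite E1, Cmod_sub_self. auto.
Qed.

Lemma hhat_cont s T eps : 0 < s < 1 -> 0 <= T < 1 -> 0 < eps -> exists delta, 0 < delta /\
  forall s' T', 0 < s' < 1 -> 0 <= T' < 1 -> Rabs (s' - s) < delta -> Rabs (T' - T) < delta ->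
    Cmod (hhat s' T' - hhat s T) < eps.
Proof.
  intros Hs HT He. destruct (lift_path_spec s T Hs HT) as (E1 & E2 & E3).
  destruct (lift_stability Omega phi cov (fun u => h s (u * T)) (lift_path s T)) with (eps := eps)
    as (eta & Heta & HH); auto.
  { apply h_vertical_cont; lra. } { intros u Hu. apply h_in; nra. }
  destruct (square_unif_cont h eta Heta h_cont) as (d1 & D1 & Hd1).
  destruct (ghat_cont s ltac:(lra) eta Heta) as (d2 & D2 & Hd2).
  exists (Rmin d1 d2). split; [apply Rmin_pos; auto|].
  intros s' T' Hs' HT' H1 H2. pose proof (Rmin_l d1 d2). pose proof (Rmin_r d1 d2).
  destruct (lift_path_spec s' T' Hs' HT') as (F1 & F2 & F3).
  apply (HH (fun u => h s' (u * T')) (lift_path s' T')); auto.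
  - intros u Hu. apply Hd1; try nra.
    replace (u * T' - u * T) with (u * (T' - T)) by ring. rewrite Rabs_mult, (Rabs_pos_eq u) by lra.
    pose proof (Rabs_pos (T' - T)). nra.
  - rewrite E1, F1. apply Hd2; lra.
Qed.

Lemma hhat_line_cont s t s' t' : 0 < s < 1 -> 0 <= t < 1 -> 0 < s' < 1 -> 0 <= t' < 1 ->
  pcont_on 0 1 (fun u => hhat (s + u * (s' - s)) (t + u * (t' - t))).
Proof.
  intros Hs Ht Hs' Ht' u Hu eps He.
  assert (Hr : forall v, 0 <= v <= 1 -> 0 < s + v * (s' - s) < 1 /\ 0 <= t + v * (t' - t) < 1).
  { intros v Hv. repeat split; try (apply convex_lt; lra); [apply convex_gt; lra|nra]. }
  destruct (Hr u Hu) as [R1 R2].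
  destruct (hhat_cont _ _ eps R1 R2 He) as (d & D & Hd).
  exists d. split; auto. intros v Hv Huv. destruct (Hr v Hv) as [Q1 Q2]. apply Hd; auto.
  - replace (s + v * (s' - s) - (s + u * (s' - s))) with ((v - u) * (s' - s)) by ring.
    rewrite Rabs_mult. assert (Rabs (s' - s) <= 1) by (apply Rabs_le; lra).
    pose proof (Rabs_pos (v - u)). pose proof (Rabs_pos (s' - s)). nra.
  - replace (t + v * (t' - t) - (t + u * (t' - t))) with ((v - u) * (t' - t)) by ring.
    rewrite Rabs_mult. assert (Rabs (t' - t) <= 1) by (apply Rabs_le; lra).
    pose proof (Rabs_pos (v - u)). pose proof (Rabs_pos (t' - t)). nra.
Qed.

(** By convexity the segment between two parameter points stays in [(0,1) x [0,1)], so [hhat] along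
    it is a path in the disk for [path_near_value_small]. The estimate is uniform up to the edges
    where [hhat] is not controlled directly. *)
Lemma hhat_osc w eps : 0 < eps -> exists eta, 0 < eta /\ forall s t s' t',
  0 < s < 1 -> 0 <= t < 1 -> 0 < s' < 1 -> 0 <= t' < 1 ->
  (forall u, 0 <= u <= 1 -> Cmod (h (s + u * (s' - s)) (t + u * (t' - t)) - w) < eta) ->
  Cmod (hhat s' t' - hhat s t) < eps.
Proof.
  intros He.
  destruct (path_near_value_small phi M0 phi_diff phi_bound (covering_loc_inj Omega phi cov) w eps He)
    as (eta & Heta & HH).
  exists eta. split; auto. intros s t s' t' Hs Ht Hs' Ht' Hn.
  specialize (HH _ (hhat_line_cont s t s' t' Hs Ht Hs' Ht')). cbv beta in HH.
  replace (s + 1 * (s' - s)) with s' in HH by ring. replace (t + 1 * (t' - t)) with t' in HH by ring.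
  replace (s + 0 * (s' - s)) with s in HH by ring. replace (t + 0 * (t' - t)) with t in HH by ring.
  apply HH. intros u Hu.
  destruct (hhat_spec (s + u * (s' - s)) (t + u * (t' - t))) as [G1 G2].
  { split; [apply convex_gt|apply convex_lt]; lra. }
  { split; [nra|apply convex_lt; lra]. }
  split; auto. rewrite G2. apply Hn; auto.
Qed.

Lemma hhat_osc_top s0 eps : 0 <= s0 <= 1 -> 0 < eps -> exists delta, 0 < delta /\
  forall s t s' t', 0 < s < 1 -> 0 <= t < 1 -> 0 < s' < 1 -> 0 <= t' < 1 ->
    Rabs (s - s0) < delta -> Rabs (s' - s0) < delta -> 1 - delta < t -> 1 - delta < t' ->
    Cmod (hhat s' t' - hhat s t) < eps.
Proof.
  intros Hs0 He. destruct (hhat_osc (h s0 1) eps He) as (eta & Heta & HH).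
  destruct (h_cont s0 1 Hs0 ltac:(lra) eta Heta) as (d & D & Hd).
  exists d. split; auto. intros s t s' t' Hs Ht Hs' Ht' H1 H2 H3 H4.
  apply HH; auto. intros u Hu. apply Rabs_lt_between in H1. apply Rabs_lt_between in H2.
  apply Hd; try nra.
  - apply Rabs_lt_between. pose proof (convex_lt s s' (s0 + d) u). pose proof (convex_gt s s' (s0 - d) u). lra.
  - apply Rabs_lt_between. pose proof (convex_lt t t' 1 u). pose proof (convex_gt t t' (1 - d) u). lra.
Qed.

(** Meant for the two sides of the square, where the homotopy is constant: on every vertical segment
    near such a side [h] stays near [w], so the lift hardly moves, uniformly in [t]. *)
Lemma hhat_side (s0 : R) (w : C) eps : 0 <= s0 <= 1 -> (forall t, 0 <= t < 1 -> h s0 t = w) -> 0 < eps ->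
  exists delta, 0 < delta /\ forall s t, 0 < s < 1 -> 0 <= t < 1 -> Rabs (s - s0) < delta ->
    Cmod (hhat s t - ghat s) < eps.
Proof.
  intros Hs0 Hw He. destruct (hhat_osc w eps He) as (eta & Heta & HH).
  destruct (square_unif_cont h eta Heta h_cont) as (d & D & Hd).
  exists d. split; auto. intros s t Hs Ht Hss. rewrite <- hhat_start by auto.
  apply HH; auto; [lra|]. intros u Hu.
  replace (s + u * (s - s)) with s by ring.
  rewrite <- (Hw (0 + u * (t - 0))) by nra.
  apply Hd; try nra. rewrite Rminus_diag, Rabs_R0. auto.
Qed.

Lemma hhat_limit s : 0 < s < 1 -> exists l, forall eps, 0 < eps ->
  exists T, 0 <= T < 1 /\ forall t, T <= t < 1 -> Cmod (hhat s t - l) < eps.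
Proof.
  intros Hs. apply left_limit_C. intros eps He.
  destruct (hhat_osc_top s eps ltac:(lra) He) as (d & D & Hd).
  set (m := Rmin (d / 2) (1 / 2)). assert (M1 : m <= d / 2) by apply Rmin_l.
  assert (M2 : m <= 1 / 2) by apply Rmin_r. assert (M3 : 0 < m) by (apply Rmin_pos; lra).
  exists (1 - m). split; [lra|]. intros t t' Ht Ht'.
  apply Hd; try lra; rewrite Rminus_diag, Rabs_R0; auto.
Qed.

(** The ends are prescribed because the lift over the homotopy is controlled only for [0 < s < 1];
    [hhat_side] makes these values fit continuously. *)
Definition lhat (s : R) : C :=
  if Rle_dec s 0 then ghat 0 else if Rle_dec 1 s then ghat 1 else
  epsilon (inhabits (RtoC 0)) (fun l => forall eps, 0 < eps ->
    exists T, 0 <= T < 1 /\ forall t, T <= t < 1 -> Cmod (hhat s t - l) < eps).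

Lemma lhat_spec s : 0 < s < 1 -> forall eps, 0 < eps ->
  exists T, 0 <= T < 1 /\ forall t, T <= t < 1 -> Cmod (hhat s t - lhat s) < eps.
Proof.
  intros Hs. unfold lhat. destruct (Rle_dec s 0); [lra|]. destruct (Rle_dec 1 s); [lra|].
  apply (epsilon_spec (inhabits (RtoC 0)) (fun l => forall eps, 0 < eps ->
    exists T, 0 <= T < 1 /\ forall t, T <= t < 1 -> Cmod (hhat s t - l) < eps)), hhat_limit; auto.
Qed.

Lemma lhat_0 : lhat 0 = ghat 0.
Proof. unfold lhat. destruct (Rle_dec 0 0); [auto|lra]. Qed.

Lemma lhat_1 : lhat 1 = ghat 1.
Proof. unfold lhat. destruct (Rle_dec 1 0); [lra|]. destruct (Rle_dec 1 1); [auto|lra]. Qed.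

Lemma lhat_cont_side (s0 : R) (w : C) : (s0 = 0 \/ s0 = 1) -> (forall t, 0 <= t < 1 -> h s0 t = w) ->
  lhat s0 = ghat s0 -> forall eps, 0 < eps -> exists d, 0 < d /\
    forall s, 0 <= s <= 1 -> Rabs (s - s0) < d -> Cmod (lhat s - lhat s0) < eps.
Proof.
  intros Hs0 Hw E eps He.
  destruct (hhat_side s0 w (eps / 3)) as (d1 & D1 & Hd1); [lra|auto|lra|].
  destruct (ghat_cont s0 ltac:(lra) (eps / 3)) as (d2 & D2 & Hd2); [lra|].
  exists (Rmin 1 (Rmin d1 d2)). split; [repeat apply Rmin_pos; lra|].
  intros s Hs Hss. pose proof (Rmin_l 1 (Rmin d1 d2)). pose proof (Rmin_r 1 (Rmin d1 d2)).
  pose proof (Rmin_l d1 d2). pose proof (Rmin_r d1 d2).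
  destruct (Req_dec s s0) as [->|Hn]; [rewrite Cmod_sub_self; auto|].
  assert (Hs' : 0 < s < 1).
  { assert (Rabs (s - s0) < 1) by lra. apply Rabs_lt_between in H3. lra. }
  destruct (lhat_spec s Hs' (eps / 3)) as (T & HT & HHT); [lra|].
  specialize (HHT T ltac:(lra)). specialize (Hd1 s T Hs' ltac:(lra) ltac:(lra)).
  specialize (Hd2 s Hs ltac:(lra)). rewrite E.
  pose proof (Cmod_sub_trans (lhat s) (hhat s T) (ghat s0)).
  pose proof (Cmod_sub_trans (hhat s T) (ghat s) (ghat s0)).
  rewrite (Cmod_sub_sym (lhat s) (hhat s T)) in H3. lra.
Qed.

Lemma lhat_cont : pcont_on 0 1 lhat.
Proof.
  intros s0 Hs0 eps He.
  destruct (Req_dec s0 0) as [->|H0].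
  { apply (lhat_cont_side 0 p); auto. apply lhat_0. }
  destruct (Req_dec s0 1) as [->|H1].
  { apply (lhat_cont_side 1 q); auto. apply lhat_1. }
  assert (Hs : 0 < s0 < 1) by lra.
  destruct (hhat_osc_top s0 (eps / 3) Hs0 ltac:(lra)) as (d & D & Hd).
  set (m := Rmin d (Rmin s0 (1 - s0))). assert (M1 : m <= d) by apply Rmin_l.
  assert (M2 : m <= s0) by (eapply Rle_trans; [apply Rmin_r|apply Rmin_l]).
  assert (M3 : m <= 1 - s0) by (eapply Rle_trans; [apply Rmin_r|apply Rmin_r]).
  exists m. split; [repeat apply Rmin_pos; lra|].
  intros s Hsi Hss. assert (Hs' : 0 < s < 1) by (apply Rabs_lt_between in Hss; lra).
  destruct (lhat_spec s Hs' (eps / 3)) as (T1 & HT1 & G1); [lra|].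
  destruct (lhat_spec s0 Hs (eps / 3)) as (T2 & HT2 & G2); [lra|].
  set (k := Rmin (d / 2) (1 / 2)). assert (K1 : k <= d / 2) by apply Rmin_l.
  assert (K2 : k <= 1 / 2) by apply Rmin_r. assert (K3 : 0 < k) by (apply Rmin_pos; lra).
  set (t := Rmax (1 - k) (Rmax T1 T2)).
  assert (T3 : 1 - k <= t) by apply Rmax_l.
  assert (T4 : T1 <= t) by (eapply Rle_trans; [apply Rmax_l|apply Rmax_r]).
  assert (T5 : T2 <= t) by (eapply Rle_trans; [apply Rmax_r|apply Rmax_r]).
  assert (T6 : t < 1) by (repeat apply Rmax_lub_lt; lra).
  specialize (G1 t ltac:(lra)). specialize (G2 t ltac:(lra)).
  assert (G3 : Cmod (hhat s t - hhat s0 t) < eps / 3).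
  { apply Hd; try lra. rewrite Rminus_diag, Rabs_R0. auto. }
  pose proof (Cmod_sub_trans (lhat s) (hhat s t) (lhat s0)).
  pose proof (Cmod_sub_trans (hhat s t) (hhat s0 t) (lhat s0)).
  rewrite (Cmod_sub_sym (lhat s) (hhat s t)) in H. lra.
Qed.

Lemma h_top s : 0 <= s <= 1 -> forall eps, 0 < eps -> exists T, 0 <= T < 1 /\
  forall t, T <= t < 1 -> Cmod (h s t - h s 1) < eps.
Proof.
  intros Hs eps He. destruct (h_cont s 1 Hs ltac:(lra) eps He) as (d & D & Hd).
  set (m := Rmin (d / 2) (1 / 2)). assert (M1 : m <= d / 2) by apply Rmin_l.
  assert (M2 : m <= 1 / 2) by apply Rmin_r. assert (M3 : 0 < m) by (apply Rmin_pos; lra).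
  exists (1 - m). split; [lra|]. intros t Ht. apply Hd; try lra.
  - rewrite Rminus_diag, Rabs_R0. auto.
  - apply Rabs_lt_between. lra.
Qed.

Lemma h_top_const s w : 0 <= s <= 1 -> (forall t, 0 <= t < 1 -> h s t = w) -> h s 1 = w.
Proof.
  intros Hs Hw. symmetry. apply Cmod_eq_of_small. intros eps He.
  destruct (h_top s Hs eps He) as (T & HT & HH). specialize (HH T ltac:(lra)).
  rewrite (Hw T HT) in HH. auto.
Qed.

Lemma lhat_lift s : 0 <= s <= 1 ->
  (Cmod (lhat s) < 1 /\ h s 1 = phi (lhat s)) \/ (Cmod (lhat s) = 1 /\ radial_lim phi (lhat s) (h s 1)).
Proof.
  intros Hs.
  destruct (Req_dec s 0) as [->|H0].
  { rewrite lhat_0, (h_top_const 0 p), <- gamma_0; auto. }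
  destruct (Req_dec s 1) as [->|H1].
  { rewrite lhat_1, (h_top_const 1 q), <- gamma_1; auto. }
  assert (Hs' : 0 < s < 1) by lra.
  assert (Hle : Cmod (lhat s) <= 1).
  { apply Rnot_lt_le. intros Hl. destruct (lhat_spec s Hs' (Cmod (lhat s) - 1)) as (T & HT & HH); [lra|].
    specialize (HH T ltac:(lra)). destruct (hhat_spec s T Hs' HT) as [G _].
    pose proof (Cmod_sub_lower (lhat s) (hhat s T)). rewrite Cmod_sub_sym in H. lra. }
  destruct (Rle_lt_or_eq_dec _ _ Hle) as [Hlt|Heq].
  - left. split; auto. symmetry. apply Cmod_eq_of_small. intros eps He.
    destruct (cdiff_cont phi (lhat s) (phi_diff _ Hlt) (eps / 2)) as (d & D & Hd); [lra|].
    destruct (lhat_spec s Hs' d D) as (T1 & HT1 & G1).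
    destruct (h_top s Hs (eps / 2)) as (T2 & HT2 & G2); [lra|].
    set (t := Rmax T1 T2). assert (R1 : T1 <= t) by apply Rmax_l. assert (R2 : T2 <= t) by apply Rmax_r.
    assert (R3 : t < 1) by (apply Rmax_lub_lt; lra).
    specialize (Hd _ (G1 t ltac:(lra))). specialize (G2 t ltac:(lra)).
    destruct (hhat_spec s t Hs' ltac:(lra)) as [_ E]. rewrite E in Hd.
    pose proof (Cmod_sub_trans (phi (lhat s)) (h s t) (h s 1)).
    rewrite (Cmod_sub_sym (phi (lhat s)) (h s t)) in H. lra.
  - right. split; auto.
    (* The vertical path [hhat s] tends to the point [lhat s] of the circle and its image tends to
       [h s 1], so this value is also the radial limit. *)
    apply (lindelof phi M0 phi_diff phi_bound (hhat s)); auto.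
    + intros T HT t Ht eps He.
      destruct (hhat_cont s t eps Hs' ltac:(lra) He) as (d & D & Hd). exists d. split; auto.
      intros t' Ht' Htt. apply Hd; auto; [lra|]. rewrite Rminus_diag, Rabs_R0. auto.
    + intros t Ht. apply hhat_spec; auto.
    + intros eps He. destruct (lhat_spec s Hs' eps He) as (T1 & HT1 & G1).
      destruct (h_top s Hs eps He) as (T2 & HT2 & G2).
      set (t := Rmax T1 T2). assert (R1 : T1 <= t) by apply Rmax_l. assert (R2 : T2 <= t) by apply Rmax_r.
      assert (R3 : t < 1) by (apply Rmax_lub_lt; lra).
      exists t. split; [lra|]. intros u Hu. destruct (hhat_spec s u Hs' ltac:(lra)) as [_ E].
      rewrite E. split; [apply G1|apply G2]; lra.
Qed.

End Homotopy.

(** * The homotopy between two lifts with common endpoints *)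

Section Converse.

Variables (lambda lam : R -> C).
Hypothesis lambda_cont : pcont_on 0 1 lambda.
Hypothesis lambda_0 : lambda 0 = p.
Hypothesis lambda_1 : lambda 1 = q.
Hypothesis lam_cont : pcont_on 0 1 lam.
Hypothesis lam_lift : forall t, 0 <= t <= 1 ->
  (Cmod (lam t) < 1 /\ lambda t = phi (lam t)) \/ (Cmod (lam t) = 1 /\ radial_lim phi (lam t) (lambda t)).
Hypothesis lam_0 : lam 0 = ghat 0.
Hypothesis lam_1 : lam 1 = ghat 1.

(* The segment from [a] to [b], pushed into the disk so that each of its points is nontangential
   to the nearer one of [a] and [b]. *)
Definition bent (a b : C) (t : R) : C :=
  (RtoC (1 - t * (1 - t) * Cmod (a - b) / 2) * (RtoC (1 - t) * a + RtoC t * b))%C.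

Lemma bent_lip a b a' b' t t' : Cmod a <= 1 -> Cmod b <= 1 -> Cmod a' <= 1 -> Cmod b' <= 1 ->
  0 <= t <= 1 -> 0 <= t' <= 1 ->
  Cmod (bent a' b' t' - bent a b t) <= 3 * (Cmod (a' - a) + Cmod (b' - b) + Rabs (t' - t)).
Proof.
  intros Ha Hb Ha' Hb' Ht Ht'. unfold bent.
  set (k := t * (1 - t) * Cmod (a - b) / 2). set (k' := t' * (1 - t') * Cmod (a' - b') / 2).
  set (m := (RtoC (1 - t) * a + RtoC t * b)%C). set (m' := (RtoC (1 - t') * a' + RtoC t' * b')%C).
  assert (D2 : forall x y, Cmod x <= 1 -> Cmod y <= 1 -> Cmod (x - y) <= 2).
  { intros x y Hx Hy. pose proof (Cmod_triangle x (- y)) as T. rewrite Cmod_opp in T.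
    unfold Cminus. lra. }
  pose proof (D2 a b Ha Hb) as Dab. pose proof (D2 a' b' Ha' Hb') as Dab'.
  pose proof (Cmod_ge_0 (a - b)). pose proof (Cmod_ge_0 (a' - b')).
  assert (Hm : Cmod m <= 1).
  { unfold m. eapply Rle_trans; [apply Cmod_triangle|]. rewrite !Cmod_mult, !Cmod_R, !Rabs_pos_eq by lra. nra. }
  assert (Hmm : Cmod (m' - m) <= Cmod (a' - a) + Cmod (b' - b) + 2 * Rabs (t' - t)).
  { replace (m' - m)%C with (RtoC (1 - t') * (a' - a) + RtoC t' * (b' - b) + RtoC (t' - t) * (b - a))%C
      by (unfold m, m'; rewrite !RtoC_minus; ring).
    eapply Rle_trans; [apply Cmod_triangle|].
    eapply Rle_trans; [apply Rplus_le_compat_r, Cmod_triangle|].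
    rewrite !Cmod_mult, !Cmod_R, (Rabs_pos_eq (1 - t')), (Rabs_pos_eq t') by lra.
    rewrite (Cmod_sub_sym b a). pose proof (Rabs_pos (t' - t)).
    pose proof (Cmod_ge_0 (a' - a)). pose proof (Cmod_ge_0 (b' - b)). nra. }
  assert (Hq : 0 <= t * (1 - t) <= 1) by nra. assert (Hq' : 0 <= t' * (1 - t') <= 1) by nra.
  assert (Hk' : 0 <= k' <= 1) by (unfold k'; nra).
  assert (Hkk : Rabs (k' - k) <= (Cmod (a' - a) + Cmod (b' - b)) / 2 + Rabs (t' - t)).
  { replace (k' - k) with (t' * (1 - t') * ((Cmod (a' - b') - Cmod (a - b)) / 2) +
      (t' - t) * ((1 - t - t') * (Cmod (a - b) / 2))) by (unfold k, k'; field).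
    eapply Rle_trans; [apply Rabs_triang|]. rewrite !Rabs_mult.
    assert (E1 : Rabs ((Cmod (a' - b') - Cmod (a - b)) / 2) <= (Cmod (a' - a) + Cmod (b' - b)) / 2).
    { rewrite Rabs_div, (Rabs_pos_eq 2) by lra. apply Rmult_le_compat_r; [lra|].
      eapply Rle_trans; [apply Cmod_lip|].
      replace (a' - b' - (a - b))%C with ((a' - a) - (b' - b))%C by ring.
      eapply Rle_trans; [apply Cmod_triangle|]. rewrite Cmod_opp. lra. }
    assert (E2 : Rabs (1 - t - t') <= 1) by (apply Rabs_le; lra).
    assert (E3 : Rabs (Cmod (a - b) / 2) <= 1) by (apply Rabs_le; lra).
    pose proof (Rabs_pos (1 - t - t')). pose proof (Rabs_pos (Cmod (a - b) / 2)).
    assert (E4 : Rabs (1 - t - t') * Rabs (Cmod (a - b) / 2) <= 1) by nra.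
    rewrite <- Rabs_mult, (Rabs_pos_eq (t' * (1 - t'))) by lra.
    pose proof (Rabs_pos ((Cmod (a' - b') - Cmod (a - b)) / 2)). pose proof (Rabs_pos (t' - t)).
    apply Rplus_le_compat; nra. }
  replace (RtoC (1 - k') * m' - RtoC (1 - k) * m)%C
    with (RtoC (1 - k') * (m' - m) + RtoC (k - k') * m)%C by (rewrite !RtoC_minus; ring).
  eapply Rle_trans; [apply Cmod_triangle|].
  rewrite !Cmod_mult, !Cmod_R, (Rabs_pos_eq (1 - k')), (Rabs_minus_sym k k') by lra.
  pose proof (Rabs_pos (k' - k)). pose proof (Cmod_ge_0 m). pose proof (Cmod_ge_0 (m' - m)).
  assert (Rabs (k' - k) * Cmod m <= Rabs (k' - k)) by nra.
  assert ((1 - k') * Cmod (m' - m) <= Cmod (m' - m)) by nra.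
  pose proof (Cmod_ge_0 (a' - a)). pose proof (Cmod_ge_0 (b' - b)). pose proof (Rabs_pos (t' - t)). lra.
Qed.

(** With [k = t (1 - t) |a - b| / 2] the depth is at least [k]. In the half of the segment nearer to
    an endpoint, the unbent point is within [4 k] of that endpoint and the bending moves it by at
    most [k], whence the 5. *)
Lemma bent_depth a b t : Cmod a <= 1 -> Cmod b <= 1 -> 0 <= t <= 1 ->
  Cmod (bent a b t) <= 1 /\
  (Cmod a < 1 -> t < 1 -> Cmod (bent a b t) < 1) /\
  (1 / 2 <= t -> Cmod (bent a b t - b) <= 5 * (1 - Cmod (bent a b t))) /\
  (t <= 1 / 2 -> Cmod (bent a b t - a) <= 5 * (1 - Cmod (bent a b t))).
Proof.
  intros Ha Hb Ht. unfold bent.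
  set (k := t * (1 - t) * Cmod (a - b) / 2). set (m := (RtoC (1 - t) * a + RtoC t * b)%C).
  pose proof (Cmod_ge_0 (a - b)) as H0.
  assert (H2 : Cmod (a - b) <= 2).
  { pose proof (Cmod_triangle a (- b)) as T. rewrite Cmod_opp in T. unfold Cminus. lra. }
  assert (Hq : 0 <= t * (1 - t) <= 1) by nra. assert (Hk : 0 <= k <= 1) by (unfold k; nra).
  assert (Hm : Cmod m <= (1 - t) * Cmod a + t * Cmod b).
  { unfold m. eapply Rle_trans; [apply Cmod_triangle|]. rewrite !Cmod_mult, !Cmod_R, !Rabs_pos_eq by lra. lra. }
  pose proof (Cmod_ge_0 a). pose proof (Cmod_ge_0 b). pose proof (Cmod_ge_0 m).
  assert (Hm1 : Cmod m <= 1) by nra.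
  assert (Ez : Cmod (RtoC (1 - k) * m) = (1 - k) * Cmod m) by (rewrite Cmod_mult, Cmod_R, Rabs_pos_eq; lra).
  assert (Hz : Cmod (RtoC (1 - k) * m) <= 1 - k) by (rewrite Ez; nra).
  split; [lra|]. split; [|split].
  - intros Ha1 Ht1. rewrite Ez. assert (Cmod m < 1) by nra. nra.
  - intros Hth.
    replace (RtoC (1 - k) * m - b)%C with (RtoC (1 - t) * (a - b) + RtoC (- k) * m)%C
      by (unfold m; rewrite !RtoC_minus, RtoC_opp; ring).
    eapply Rle_trans; [apply Cmod_triangle|].
    rewrite !(Cmod_mult _ (a - b)), (Cmod_mult _ m), !Cmod_R, Rabs_Ropp, !Rabs_pos_eq by lra.
    assert ((1 - t) * Cmod (a - b) <= 4 * k).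
    { unfold k. assert (0 <= (1 - t) * Cmod (a - b)) by (apply Rmult_le_pos; lra). nra. }
    assert (k * Cmod m <= k) by nra. lra.
  - intros Hth.
    replace (RtoC (1 - k) * m - a)%C with (RtoC (- t) * (a - b) + RtoC (- k) * m)%C
      by (unfold m; rewrite !RtoC_minus, !RtoC_opp; ring).
    eapply Rle_trans; [apply Cmod_triangle|].
    rewrite !(Cmod_mult _ (a - b)), (Cmod_mult _ m), !Cmod_R, !Rabs_Ropp, !Rabs_pos_eq by lra.
    assert (t * Cmod (a - b) <= 4 * k).
    { unfold k. assert (0 <= t * Cmod (a - b)) by (apply Rmult_le_pos; lra). nra. }
    assert (k * Cmod m <= k) by nra. lra.
Qed.

Lemma bent_same a t : bent a a t = a.
Proof.
  unfold bent. rewrite Cmod_sub_self. replace (1 - t * (1 - t) * 0 / 2) with 1 by field.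
  rewrite RtoC_minus. ring.
Qed.

Lemma bent_0 a b : bent a b 0 = a.
Proof.
  unfold bent. replace (1 - 0 * (1 - 0) * Cmod (a - b) / 2) with 1 by field.
  replace (1 - 0) with 1 by ring. ring.
Qed.

Lemma bent_1 a b : bent a b 1 = b.
Proof.
  unfold bent. replace (1 - 1 * (1 - 1) * Cmod (a - b) / 2) with 1 by field.
  replace (1 - 1) with 0 by ring. ring.
Qed.

Definition kmap (s t : R) : C := bent (ghat s) (lam s) t.

(** By [kmap_boundary] the second branch occurs only on the top edge and the two sides of the
    square. There [kmap s t] equals [lam s], a point of the circle at which [phi] has radial limit
    [lambda s]. *)
Definition hmap (s t : R) : C :=
  if Rlt_dec (Cmod (kmap s t)) 1 then phi (kmap s t) else lambda s.

Lemma lift_le_1 (e c : R -> C) s : (Cmod (e s) < 1 /\ c s = phi (e s)) \/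
  (Cmod (e s) = 1 /\ radial_lim phi (e s) (c s)) -> Cmod (e s) <= 1.
Proof. intros [[H _]|[H _]]; lra. Qed.

Lemma ghat_le s : 0 <= s <= 1 -> Cmod (ghat s) <= 1.
Proof. intros Hs. apply (lift_le_1 ghat gamma). auto. Qed.

Lemma lam_le s : 0 <= s <= 1 -> Cmod (lam s) <= 1.
Proof. intros Hs. apply (lift_le_1 lam lambda). auto. Qed.

Lemma kmap_0 t : kmap 0 t = ghat 0.
Proof. unfold kmap. rewrite lam_0. apply bent_same. Qed.

Lemma kmap_1 t : kmap 1 t = ghat 1.
Proof. unfold kmap. rewrite lam_1. apply bent_same. Qed.

Lemma kmap_boundary s t : 0 <= s <= 1 -> 0 <= t <= 1 -> ~ Cmod (kmap s t) < 1 ->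
  Cmod (kmap s t) = 1 /\ kmap s t = lam s /\ ((s = 0 \/ s = 1) \/ t = 1).
Proof.
  intros Hs Ht Hn.
  destruct (bent_depth (ghat s) (lam s) t (ghat_le s Hs) (lam_le s Hs) Ht) as (B1 & B2 & _).
  fold (kmap s t) in B1, B2. split; [lra|].
  destruct (Req_dec s 0) as [->|H0]. { rewrite kmap_0, lam_0. auto. }
  destruct (Req_dec s 1) as [->|H1]. { rewrite kmap_1, lam_1. auto. }
  destruct (Req_dec t 1) as [->|H2]. { unfold kmap. rewrite bent_1. auto. }
  exfalso. apply Hn, B2; [|lra]. apply ghat_in. lra.
Qed.

Lemma kmap_cont s t : 0 <= s <= 1 -> 0 <= t <= 1 -> jcont_at kmap s t.
Proof.
  intros Hs Ht eps He.
  destruct (ghat_cont s Hs (eps / 9)) as (d1 & D1 & Hd1); [lra|].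
  destruct (lam_cont s Hs (eps / 9)) as (d2 & D2 & Hd2); [lra|].
  exists (Rmin (eps / 9) (Rmin d1 d2)). split; [repeat apply Rmin_pos; lra|].
  intros s' t' Hs' Ht' H1 H2.
  pose proof (Rmin_l (eps / 9) (Rmin d1 d2)). pose proof (Rmin_r (eps / 9) (Rmin d1 d2)).
  pose proof (Rmin_l d1 d2). pose proof (Rmin_r d1 d2).
  specialize (Hd1 s' Hs' ltac:(lra)). specialize (Hd2 s' Hs' ltac:(lra)).
  eapply Rle_lt_trans; [apply bent_lip; auto using ghat_le, lam_le|]. lra.
Qed.

Lemma hmap_cont s t : 0 <= s <= 1 -> 0 <= t <= 1 -> jcont_at hmap s t.
Proof.
  intros Hs Ht eps He. unfold hmap at 2.
  destruct (Rlt_dec (Cmod (kmap s t)) 1) as [Hin|Hbd].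
  - destruct (cdiff_cont phi _ (phi_diff _ Hin) eps He) as (d & D & Hd).
    destruct (kmap_cont s t Hs Ht (Rmin d (1 - Cmod (kmap s t)))) as (d' & D' & Hd').
    { apply Rmin_pos; lra. }
    exists d'. split; auto. intros s' t' Hs' Ht' H1 H2. specialize (Hd' s' t' Hs' Ht' H1 H2).
    pose proof (Rmin_l d (1 - Cmod (kmap s t))). pose proof (Rmin_r d (1 - Cmod (kmap s t))).
    pose proof (Cmod_sub_lower (kmap s' t') (kmap s t)).
    unfold hmap. destruct (Rlt_dec (Cmod (kmap s' t')) 1); [|lra]. apply Hd. lra.
  - destruct (kmap_boundary s t Hs Ht Hbd) as (K1 & K2 & K3).
    destruct (lambda_cont s Hs eps He) as (d0 & D0 & Hd0).
    destruct (nontangential_limit_along_lift phi M0 phi_diff phi_bound lam lambda s eps 5)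
      as (d1 & D1 & Hd1); auto; try lra. { rewrite <- K2. auto. }
    (* Nearby points with [t' <= 1 / 2] are nontangential to [ghat s'] rather than to [lam s']. They
       occur only when [s] is 0 or 1, and there both lifts and both paths agree. *)
    assert (Hg : exists d2, 0 < d2 /\ forall s' t', 0 <= s' <= 1 -> 0 <= t' <= 1 -> t' <= 1 / 2 ->
      Rabs (s' - s) < d2 -> Rabs (t' - t) < d2 -> Cmod (kmap s' t') < 1 ->
      Cmod (kmap s' t' - kmap s t) < d2 -> Cmod (phi (kmap s' t') - lambda s) < eps).
    { destruct K3 as [K3|K3].
      - assert (E1 : ghat s = lam s) by (destruct K3 as [-> | ->]; congruence).
        assert (E2 : gamma s = lambda s) by (destruct K3 as [-> | ->]; congruence).
        destruct (nontangential_limit_along_lift phi M0 phi_diff phi_bound ghat gamma s eps 5)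
          as (d2 & D2 & Hd2); auto; try lra. { rewrite E1, <- K2. auto. }
        exists d2. split; auto. intros s' t' Hs' Ht' Hth H1 H2 H3 H4. rewrite <- E2.
        apply (Hd2 s'); auto; [|rewrite E1, <- K2; auto].
        apply bent_depth; auto using ghat_le, lam_le.
      - exists (1 / 2). split; [lra|]. intros s' t' Hs' Ht' Hth H1 H2. exfalso.
        apply Rabs_lt_between in H2. lra. }
    destruct Hg as (d2 & D2 & Hd2).
    destruct (kmap_cont s t Hs Ht (Rmin d1 d2)) as (d3 & D3 & Hd3). { apply Rmin_pos; auto. }
    pose proof (Rmin_l d1 d2) as N1. pose proof (Rmin_r d1 d2) as N2.
    set (d := Rmin (Rmin d0 d1) (Rmin d2 d3)).
    assert (X0 : d <= d0) by (eapply Rle_trans; [apply Rmin_l|apply Rmin_l]).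
    assert (X1 : d <= d1) by (eapply Rle_trans; [apply Rmin_l|apply Rmin_r]).
    assert (X2 : d <= d2) by (eapply Rle_trans; [apply Rmin_r|apply Rmin_l]).
    assert (X3 : d <= d3) by (eapply Rle_trans; [apply Rmin_r|apply Rmin_r]).
    exists d. split. { apply Rmin_pos; apply Rmin_pos; auto. }
    intros s' t' Hs' Ht' H1 H2. specialize (Hd3 s' t' Hs' Ht' ltac:(lra) ltac:(lra)).
    unfold hmap. destruct (Rlt_dec (Cmod (kmap s' t')) 1) as [Hin'|Hbd'].
    + destruct (Rle_lt_dec t' (1 / 2)) as [Hth|Hth].
      * apply Hd2; auto; lra.
      * apply (Hd1 s'); auto; [lra| |rewrite <- K2; lra].
        apply bent_depth; auto using ghat_le, lam_le. lra.
    + apply Hd0; auto. lra.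
Qed.

Lemma hmap_side s t : s = 0 \/ s = 1 -> 0 <= t <= 1 -> hmap s t = lambda s.
Proof.
  intros Hs Ht. unfold hmap.
  destruct (Rlt_dec (Cmod (kmap s t)) 1) as [H|H]; auto.
  assert (E : kmap s t = ghat s) by (destruct Hs as [-> | ->]; [apply kmap_0|apply kmap_1]).
  assert (Hs01 : 0 <= s <= 1) by (destruct Hs; lra).
  rewrite E in H |- *. destruct (ghat_lift s Hs01) as [[_ G]|[G _]]; [|lra].
  rewrite <- G. destruct Hs as [-> | ->]; congruence.
Qed.

Lemma hmap_bottom s : 0 <= s <= 1 -> hmap s 0 = gamma s.
Proof.
  intros Hs. destruct (Req_dec s 0) as [->|H0]. { rewrite hmap_side by (auto; lra). congruence. }
  destruct (Req_dec s 1) as [->|H1]. { rewrite hmap_side by (auto; lra). congruence. }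
  destruct (ghat_in s ltac:(lra)) as [G1 G2].
  unfold hmap, kmap. rewrite bent_0. destruct (Rlt_dec (Cmod (ghat s)) 1); [auto|lra].
Qed.

Lemma hmap_top s : 0 <= s <= 1 -> hmap s 1 = lambda s.
Proof.
  intros Hs. unfold hmap, kmap. rewrite bent_1. destruct (Rlt_dec (Cmod (lam s)) 1); auto.
  destruct (lam_lift s Hs) as [[_ G]|[G _]]; [auto|lra].
Qed.

Lemma hmap_in s t : 0 < s < 1 -> 0 <= t < 1 -> Omega (hmap s t).
Proof.
  intros Hs Ht. unfold hmap. destruct (Rlt_dec (Cmod (kmap s t)) 1) as [H|H].
  - apply cov. unfold in_disk. rewrite Cnorm_Cmod. auto.
  - destruct (kmap_boundary s t ltac:(lra) ltac:(lra) H) as (_ & _ & K). lra.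
Qed.

End Converse.

End Lifts.

Theorem theorem2p9 (Omega : Cpx -> Prop) (phi : Cpx -> Cpx) (p q : Cpx)
  (gamma ghat : R -> Cpx) :
  Cis_open Omega -> Cbounded Omega -> Cconnected Omega ->
  analytic_covering_map Omega phi ->
  Cclosure Omega p -> Cclosure Omega q ->
  path_epe Omega p q gamma ->
  is_lift phi gamma ghat ->
  (forall lambda : R -> Cpx, in_hclass_closure Omega p q gamma lambda ->
     exists lhat : R -> Cpx, is_lift phi lambda lhat /\
       (forall t, I01 t -> Cnorm (lhat t) <= 1) /\
       lhat 0 = ghat 0 /\ lhat 1 = ghat 1) /\
  (forall lambda : R -> Cpx,
     continuous_01 lambda -> (forall t, I01 t -> Cclosure Omega (lambda t)) ->
     lambda 0 = p -> lambda 1 = q ->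
     (exists lhat : R -> Cpx, is_lift phi lambda lhat /\
        (forall t, I01 t -> Cnorm (lhat t) <= 1) /\
        lhat 0 = ghat 0 /\ lhat 1 = ghat 1) ->
     in_hclass_closure Omega p q gamma lambda).
Proof.
  intros _ [M HM] _ [Hhol Hcov] _ _ (Hgc & Hg0 & Hg1 & Hgin) (Hghc & Hghl).
  pose proof (holomorphic_cdiff phi Hhol) as Hdiff.
  assert (Hbd : forall z, Cmod z < 1 -> Cmod (phi z) <= M).
  { intros z Hz. rewrite <- Cnorm_Cmod. apply HM, Hcov. unfold in_disk. rewrite Cnorm_Cmod. auto. }
  apply (continuous_01_pcont gamma) in Hgc. apply (continuous_01_pcont ghat) in Hghc.
  assert (Hgl : forall t, 0 <= t <= 1 -> (Cmod (ghat t) < 1 /\ gamma t = phi (ghat t)) \/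
    (Cmod (ghat t) = 1 /\ radial_lim phi (ghat t) (gamma t))).
  { intros t Ht. apply phibar_iff. auto. }
  split.
  - intros lambda (h & Hhc & Hh0 & Hh1 & Hpe).
    pose proof (proj1 (continuous_01x01_jcont h) Hhc) as Hh.
    assert (HL : forall t, 0 <= t < 1 -> h 0 t = p) by (intros t Ht; apply (Hpe t Ht)).
    assert (HR : forall t, 0 <= t < 1 -> h 1 t = q) by (intros t Ht; apply (Hpe t Ht)).
    assert (HI : forall s t, 0 < s < 1 -> 0 <= t < 1 -> Omega (h s t)).
    { intros s t Hs Ht. destruct (Hpe t Ht) as (_ & _ & _ & H). auto. }
    set (l := lhat phi ghat h).
    assert (Hl : forall s, 0 <= s <= 1 -> (Cmod (l s) < 1 /\ h s 1 = phi (l s)) \/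
      (Cmod (l s) = 1 /\ radial_lim phi (l s) (h s 1))).
    { intros s Hs. apply (lhat_lift Omega phi p q gamma ghat M); auto. }
    exists l. split; [split|split; [|split]].
    + apply continuous_01_pcont. apply (lhat_cont Omega phi p q gamma ghat M); auto.
    + intros t Ht. rewrite <- Hh1 by auto. apply phibar_iff. auto.
    + intros t Ht. rewrite Cnorm_Cmod. destruct (Hl t Ht) as [[H _]|[H _]]; lra.
    + apply lhat_0.
    + apply lhat_1.
  - intros lambda Hlc _ Hl0 Hl1 (lam & (Hlamc & Hlaml) & _ & Hlam0 & Hlam1).
    apply (continuous_01_pcont lambda) in Hlc. apply (continuous_01_pcont lam) in Hlamc.
    assert (Hll : forall t, 0 <= t <= 1 -> (Cmod (lam t) < 1 /\ lambda t = phi (lam t)) \/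
      (Cmod (lam t) = 1 /\ radial_lim phi (lam t) (lambda t))).
    { intros t Ht. apply phibar_iff. auto. }
    set (h := hmap phi ghat lambda lam).
    assert (Hh : forall s t, 0 <= s <= 1 -> 0 <= t <= 1 -> jcont_at h s t).
    { intros s t Hs Ht. apply (hmap_cont Omega phi p q gamma ghat M); auto. }
    assert (Hside : forall s t, s = 0 \/ s = 1 -> 0 <= t <= 1 -> h s t = lambda s).
    { intros s t Hs Ht. apply (hmap_side phi p q gamma ghat); auto. }
    exists h. split; [|split; [|split]].
    + apply (continuous_01x01_jcont h). auto.
    + intros s Hs. apply (hmap_bottom Omega phi p q gamma ghat); auto.
    + intros s Hs. apply hmap_top; auto.
    + intros t Ht. split; [|split; [|split]].
      * apply continuous_01_pcont. intros s Hs eps He.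
        destruct (Hh s t Hs ltac:(lra) eps He) as (d & D & Hd). exists d. split; auto.
        intros s' Hs' Hss. apply Hd; auto; [lra|]. rewrite Rminus_diag, Rabs_R0. auto.
      * rewrite Hside; auto. lra.
      * rewrite Hside; auto. lra.
      * intros s Hs. apply (hmap_in Omega phi gamma ghat Hcov Hgin Hgl); auto.
Qed.
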